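(* There exists a constant $c > 0$ such that $$\mathbf{P}[P_{r,d,D} \text{ is connected}] > c$$ for all constants $r,d,D \in \mathbf{N} \cup \{0\}$ satisfying $D \geq 3$ and $\mathcal{P}(r,d,D) \neq \emptyset$.
   Context: For integers $r,d,D \ge 0$, $\mathcal{P}(r,d,D)$ denotes the set of all labelled (simple) planar graphs on the vertex set $\{1,2,\ldots,r\}$ whose every vertex has degree between $d$ and $D$ inclusive (i.e. minimum degree at least $d$ and maximum degree at most $D$). $P_{r,d,D}$ denotes a graph chosen uniformly at random from $\mathcal{P}(r,d,D)$. *)

(* Defs.v *)
From HB Require Import structures.
From mathcomp Require Import all_boot all_order all_algebra.
From mathcomp Require Import all_classical all_reals all_analysis.

Set Implicit Arguments.
Unset Strict Implicit.
Unset Printing Implicit Defensive.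

Import Order.TTheory GRing.Theory Num.Theory.
Import numFieldNormedType.Exports.

Local Open Scope classical_set_scope.
Local Open Scope ring_scope.

(* A labelled simple graph, given by its edge set. The labels are 0, ..., r-1. *)
Definition labelled_graph (r : nat) :=
  {E : {set {set 'I_r}} | [forall e in E, #|e| == 2%N]}.

Definition edges (r : nat) (G : labelled_graph r) : {set {set 'I_r}} := val G.

(* Irreflexive, because [set u; u] has a single element. *)
Definition adj (r : nat) (G : labelled_graph r) : rel 'I_r :=
  fun u v => [set u; v]%SET \in edges G.

Definition degree (r : nat) (G : labelled_graph r) (v : 'I_r) : nat :=
  #|[set e in edges G | v \in e]%SET|.

(* The graph with no vertices counts as connected. *)
Definition connected_graph (r : nat) (G : labelled_graph r) : bool :=
  [forall u, forall v, connect (adj G) u v].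

(* A drawing of G in the plane without crossings: the vertices are distinct
   points p v, and the edge e is the Jordan arc a e restricted to [0, 1]. An arc
   meets the vertices only in its own two ends, and two distinct arcs can meet
   only in ends. *)
Definition plane_drawing (R : realType) (r : nat) (G : labelled_graph r)
    (p : 'I_r -> R * R) (a : {set 'I_r} -> R -> R * R) : Prop :=
  [/\ injective p,
      forall e, e \in edges G ->
        [/\ {within `[0, 1], continuous (a e)},
            {in `[0, 1] &, injective (a e)}
          & exists u v, [/\ e = [set u; v]%SET, a e 0 = p u & a e 1 = p v]],
      forall e v t, e \in edges G -> t \in `]0, 1[ -> a e t <> p v
    & forall e f s t, e \in edges G -> f \in edges G -> e != f ->
        s \in `]0, 1[ -> t \in `]0, 1[ -> a e s <> a f t].

Definition planar (R : realType) (r : nat) (G : labelled_graph r) : Prop :=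
  exists p a, @plane_drawing R r G p a.

Definition planar_graphs (R : realType) (r d D : nat) :
    {set labelled_graph r} :=
  [set G : labelled_graph r |
     `[< planar R G >] && [forall v, (d <= degree G v <= D)%N]]%SET.

(* The probability that a uniformly random element of S satisfies Q; S is meant
   to be nonempty. *)
Definition uniformly_random_prob (R : realType) (T : finType) (S : {set T})
    (Q : pred T) : R :=
  #|[set x in S | Q x]%SET|%:R / #|S|%:R.

(* Main.v *)
(** Let X_k be the set of admissible graphs with k components. It is enough to
    show k |X_{k+1}| <= K |X_k| for an absolute constant K, since then
    |X_{k+1}| <= K^k / k! |X_1|, and summing over k shows that the connected graphs
    form at least a proportion exp(-K) of all admissible graphs.

    The inequality is a double count of local moves that turn a graph with k+1
    components into one with k components. A graph with k+1 components on n vertices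
    has at least a constant times k n moves, and every graph with k components arises
    from at most a constant times n moves. Given components A and B, the moves are:
    - if A and B are isolated vertices, join them;
    - if v is a vertex of B of degree at most 1, use v to subdivide an edge of A;
    - if u, v, w is a path of B through vertices of degree 2 with u, w not adjacent,
      use v to subdivide an edge of A, and replace uv by uw;
    - if a1a2 in A and b1b2 in B lie on few 2-edge-cuts, replace them by a1b1 and a2b2.
    A component with few edges outside a spanning tree is close to a tree or to a long
    cycle, so that linearly many moves of the second or third kind use it. In any other
    component linearly many edges outside a spanning forest T lie on few 2-edge-cuts:
    an edge of T forms a 2-edge-cut with at most one edge outside T. No bound on the
    number of edges of a planar graph is needed.

    The moves preserve planarity because the middle part of an edge can be cut out
    inside a small disc that meets nothing else. An inversion centred on the boundary of
    that disc carries the component to a half-plane, with the two loose ends on its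
    boundary line, and the loose ends of two components facing each other are joined by
    straight segments. *)

Require Import Defs.
From mathcomp Require Import all_boot all_order all_algebra.
From mathcomp Require Import all_classical all_reals all_analysis.
From mathcomp Require Import ring lra zify.
(* Imported again so that set operations refer to finite sets. *)
From mathcomp Require Import fintype finset.

Set Implicit Arguments.
Unset Strict Implicit.
Unset Printing Implicit Defensive.

Import Order.TTheory GRing.Theory Num.Theory.
Import numFieldNormedType.Exports.

Local Open Scope ring_scope.

(** * Arcs in the plane *)

Section Continuity.
Local Open Scope classical_set_scope.
Local Open Scope ring_scope.
Variable R : realType.
Implicit Types f g : R -> R.

Lemma contD f g : continuous f -> continuous g -> continuous (fun t => f t + g t).
Proof. by move=> cf cg t; apply: cvgD; [exact: cf|exact: cg]. Qed.

Lemma contB f g : continuous f -> continuous g -> continuous (fun t => f t - g t).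
Proof. by move=> cf cg t; apply: cvgB; [exact: cf|exact: cg]. Qed.

Lemma contM f g : continuous f -> continuous g -> continuous (fun t => f t * g t).
Proof. by move=> cf cg t; apply: cvgM; [exact: cf|exact: cg]. Qed.

Lemma cont_id : continuous (fun t : R => t).
Proof. by move=> t; exact: cvg_id. Qed.

Lemma cont_cst (c : R) : continuous (fun _ : R => c).
Proof. by move=> t; exact: cvg_cst. Qed.

Lemma cont_comp f g : continuous f -> continuous g -> continuous (fun t => f (g t)).
Proof. by move=> cf cg t; apply: continuous_comp; [exact: cg|exact: cf]. Qed.

Lemma cont_min f g : continuous f -> continuous g ->
  continuous (fun t => Num.min (f t) (g t)).
Proof. by move=> cf cg t; apply: (@continuous_min R R); [exact: cf|exact: cg]. Qed.

Lemma cont_max f g : continuous f -> continuous g ->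
  continuous (fun t => Num.max (f t) (g t)).
Proof. by move=> cf cg t; apply: (@continuous_max R R); [exact: cf|exact: cg]. Qed.

Lemma first_nonpos f : continuous f -> 0 < f 0 -> f 1 <= 0 ->
  exists t, [/\ 0 < t <= 1, f t = 0 & forall s, 0 <= s -> s < t -> 0 < f s].
Proof.
move=> cf f0 f1.
pose A := (`[0, 1]%classic `&` [set t | f t <= 0])%classic.
have clA : closed A.
  apply: closedI; first exact: interval_closed.
  by have := @closed_comp _ _ f [set y : R | y <= 0]%classic
     (fun x _ => cf x) (@closed_le R 0).
have cA : compact A.
  by apply: (subclosed_compact clA (@segment_compact R 0 1)) => t [].
have A0 : (A !=set0)%classic by exists 1; split => //=; rewrite in_itv/= ler01 lexx.
have cid : {within A, continuous (fun t : R => t)}.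
  by apply: continuous_subspaceT; exact: cont_id.
have [t tA tmin] := compact_EVT_min A0 cA cid.
move/set_mem: tA => -[/=]; rewrite in_itv/= => /andP[t0 t1] ft.
have pos s : 0 <= s -> s < t -> 0 < f s.
  move=> s0 st; rewrite ltNge; apply/negP => fs.
  have : t <= s.
    apply: tmin; apply/mem_set; split => //=; rewrite in_itv/= s0/=.
    exact: le_trans (ltW st) t1.
  by rewrite leNgt st.
have tgt0 : 0 < t.
  rewrite lt_neqAle t0 andbT; apply/eqP => t0'.
  by move: ft; rewrite -t0' leNgt f0.
exists t; split => //; first by rewrite tgt0.
apply/eqP; rewrite eq_le ft/= leNgt; apply/negP => ft0.
have [||s] := @IVT R f 0 t (f t / 2) t0.
- exact: continuous_subspaceT.
- by rewrite ge_min le_max; apply/andP; split; apply/orP; [right|left]; lra.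
rewrite in_itv/= => /andP[s0 st] fs.
have [ts|ts] := eqVneq s t; first by move: fs; rewrite ts; lra.
have := pos s s0; rewrite lt_neqAle ts st fs => /(_ isT); lra.
Qed.

End Continuity.

Section Arcs.
Variable R : realType.
Local Notation pt := (R * R)%type.
Implicit Types (x y z : pt) (S T : pt -> Prop).

(* Only the image S of the arc is kept, so that cutting and concatenating arcs are
   set operations; the two coordinates are functions on the whole line, so that
   only global continuity is needed. *)
Definition arc x y S : Prop := exists g h : R -> R,
  [/\ continuous g /\ continuous h,
      forall s t : R, 0 <= s <= 1 -> 0 <= t <= 1 -> g s = g t -> h s = h t -> s = t,
      x = (g 0, h 0), y = (g 1, h 1)
    & forall z, S z <-> exists2 t : R, 0 <= t <= 1 & z = (g t, h t)].

Lemma arc_source x y S : arc x y S -> S x.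
Proof. by move=> [g [h [_ _ -> _ ->]]]; exists 0; rewrite // lexx ler01. Qed.

Lemma arc_neq x y S : arc x y S -> x <> y.
Proof.
move=> [g [h [_ i -> -> _]]] [g01 h01].
have : (0 : R) = 1 by apply: i => //; rewrite lexx ler01.
by move/eqP; rewrite eq_sym oner_eq0.
Qed.

Lemma arc_sym x y S : arc x y S -> arc y x S.
Proof.
move=> [g [h [[cg ch] i -> -> e]]].
exists (fun t => g (1 - t)), (fun t => h (1 - t)); split.
- by split; apply: cont_comp => //; apply: contB; [exact: cont_cst|exact: cont_id
    |exact: cont_cst|exact: cont_id].
- move=> s t s1 t1 gst hst.
  have : 1 - s = 1 - t by apply: i => //; lra.
  by lra.
- by rewrite subr0.
- by rewrite subrr.
move=> z; rewrite e; split=> -[t t1 ->]; (exists (1 - t); first by lra) => //.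
by congr (g _, h _); lra.
Qed.

Lemma arc_cat x y z S T : arc x y S -> arc y z T ->
  (forall w, S w -> T w -> w = y) -> arc x z (fun w => S w \/ T w).
Proof.
move=> [g [h [[cg ch] i -> -> e]]] [g' [h' [[cg' ch'] i' y0 -> e']]] ST.
case: y0 => gg hh.
(* Clamping both parameters writes the concatenation as a sum of continuous
   functions, which avoids gluing. *)
pose a (t : R) := Num.min (t + t) 1.
pose b (t : R) := Num.max (t + t - 1) 0.
have ca : continuous a.
  by apply: cont_min; [apply: contD; exact: cont_id|exact: cont_cst].
have cb : continuous b.
  apply: cont_max; last exact: cont_cst.
  by apply: contB; [apply: contD; exact: cont_id|exact: cont_cst].
have a0 t : t <= 1/2 -> a t = t + t by move=> ?; rewrite /a min_l//; lra.
have a1 t : 1/2 <= t -> a t = 1 by move=> ?; rewrite /a min_r//; lra.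
have b0 t : t <= 1/2 -> b t = 0 by move=> ?; rewrite /b max_r//; lra.
have b1 t : 1/2 <= t -> b t = t + t - 1 by move=> ?; rewrite /b max_l//; lra.
pose G t := g (a t) + (g' (b t) - g' 0).
pose H t := h (a t) + (h' (b t) - h' 0).
have G0 t : t <= 1/2 -> G t = g (t + t).
  by move=> t2; rewrite /G a0// b0// subrr addr0.
have H0 t : t <= 1/2 -> H t = h (t + t).
  by move=> t2; rewrite /H a0// b0// subrr addr0.
have G1 t : 1/2 <= t -> G t = g' (t + t - 1).
  by move=> t2; rewrite /G a1// b1// gg; lra.
have H1 t : 1/2 <= t -> H t = h' (t + t - 1).
  by move=> t2; rewrite /H a1// b1// hh; lra.
exists G, H; split.
- split; (apply: contD; first exact: cont_comp);
    apply: contB; by [exact: cont_comp|exact: cont_cst].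
- have wl (s t : R) : 0 <= s <= 1 -> 0 <= t <= 1 -> s < t ->
      G s = G t -> H s = H t -> s = t.
    move=> s1 t1 st.
    have [t2|t2] := lerP t (1/2).
      rewrite !G0 ?H0; try lra; move=> gst hst.
      have : s + s = t + t by apply: i => //; lra.
      lra.
    have [s2|s2] := lerP s (1/2); last first.
      rewrite !G1 ?H1; try lra; move=> gst hst.
      have : s + s - 1 = t + t - 1 by apply: i' => //; lra.
      lra.
    rewrite (G0 s) ?(H0 s) ?(G1 t) ?(H1 t); try lra; move=> gst hst.
    have Ss : S (g (s + s), h (s + s)) by apply/e; exists (s + s) => //; lra.
    have Ts : T (g (s + s), h (s + s)).
      by apply/e'; exists (t + t - 1); [lra|rewrite gst hst].
    have [gs hs] := ST _ Ss Ts.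
    have s12 : s + s = 1 by apply: i => //; lra.
    have : t + t - 1 = 0 by apply: i'; rewrite -?gst -?hst ?gs ?hs //; lra.
    lra.
  move=> s t s1 t1 gst hst.
  have [st|st|//] := ltgtP s t; first exact: wl.
  by symmetry; apply: wl.
- by rewrite G0 ?H0 ?addr0 //; lra.
- by rewrite G1 ?H1 ?addrK//; lra.
move=> w; split.
  case=> [/e[t t1 ->]|/e'[t t1 ->]].
    exists (t / 2); first by lra.
    by rewrite G0 ?H0; [congr (g _, h _)| |]; lra.
  exists ((t + 1) / 2); first by lra.
  by rewrite G1 ?H1; [congr (g' _, h' _)| |]; lra.
move=> [t t1 ->]; have [t2|t2] := lerP t (1/2).
  by left; apply/e; exists (t + t); rewrite ?G0 ?H0//; lra.
by right; apply/e'; exists (t + t - 1); rewrite ?G1 ?H1//; lra.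
Qed.

Definition seg x y z : Prop := exists2 t : R, 0 <= t <= 1
  & z = (x.1 + t * (y.1 - x.1), x.2 + t * (y.2 - x.2)).

Lemma arc_seg x y : x <> y -> arc x y (seg x y).
Proof.
move=> xy.
exists (fun t => x.1 + t * (y.1 - x.1)), (fun t => x.2 + t * (y.2 - x.2)).
split=> //.
- by split; (apply: contD; first exact: cont_cst); apply: contM;
    by [exact: cont_id|exact: cont_cst].
- move=> s t _ _ /addrI e1 /addrI e2.
  have [y1|y1] := eqVneq (y.1 - x.1) 0; last exact: mulIf y1 _ _ e1.
  have [y2|y2] := eqVneq (y.2 - x.2) 0; last exact: mulIf y2 _ _ e2.
  case: xy; move/eqP: y1; move/eqP: y2; rewrite !subr_eq0.
  by case: (x) (y) => [? ?] [? ?] /= /eqP -> /eqP ->.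
- by rewrite !mul0r !addr0; case: (x).
- by rewrite !mul1r ![_ + (_ - _)]addrC !subrK; case: (y).
Qed.

End Arcs.

(** * Drawings *)

Section Drawings.
Variable R : realType.
Local Notation pt := (R * R)%type.
Variable V : finType.
Implicit Types (W : {set V}) (E : {set {set V}}) (p : V -> pt) (S : {set V} -> pt -> Prop).

(* Only the points p w for w in W and the arcs S e for e in E are drawn. *)
Definition drawing W E p S : Prop :=
  [/\ {in W &, injective p},
      forall e, e \in E -> exists u v,
        [/\ u \in W, v \in W, e = [set u; v]%SET & arc (p u) (p v) (S e)],
      forall e w, e \in E -> w \in W -> S e (p w) -> w \in e
    & forall e f z, e \in E -> f \in E -> e <> f -> S e z -> S f z ->
        exists2 w, w \in W & z = p w].

(* The rest of a drawing after the middle part of the edge ab has been cut out: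
   everything lies strictly on the side sg * (x - k) < 0 of the line x = k, except
   the ends (k, y1) and (k, y2) of the two remaining pieces s1, s2 of ab. *)
Definition half_drawing W E (a b : V) p S (s1 s2 : pt -> Prop) (y1 y2 : R) (sg k : R) :=
  [/\ drawing W E p S,
      (forall w, w \in W -> sg * ((p w).1 - k) < 0) /\
        (forall e z, e \in E -> S e z -> sg * (z.1 - k) < 0),
      [/\ arc (p a) (k, y1) s1, arc (p b) (k, y2) s2 & y1 <> y2],
      [/\ (forall z, s1 z -> z <> (k, y1) -> sg * (z.1 - k) < 0),
          (forall z, s2 z -> z <> (k, y2) -> sg * (z.1 - k) < 0) &
          (forall z, s1 z -> s2 z -> False)]
    & (forall z e, e \in E -> S e z -> (s1 z -> z = p a) /\ (s2 z -> z = p b)) /\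
        (forall w, w \in W -> (s1 (p w) -> w = a) /\ (s2 (p w) -> w = b))].

Lemma drawing_arc W E p S a b : drawing W E p S -> [set a; b]%SET \in E ->
  [/\ a \in W, b \in W & arc (p a) (p b) (S [set a; b]%SET)].
Proof.
move=> [pI arcE _ _] abE; have [u [v [uW vW euv]]] := arcE _ abE.
move=> uvA; have uv : u != v by apply/eqP => uv'; move/arc_neq: uvA; rewrite uv'.
have : a \in [set u; v]%SET by rewrite -euv !inE eqxx.
have : b \in [set u; v]%SET by rewrite -euv !inE eqxx orbT.
have : u \in [set a; b]%SET by rewrite euv !inE eqxx.
have : v \in [set a; b]%SET by rewrite euv !inE eqxx orbT.
rewrite !inE => vab uab /orP[]/eqP bE /orP[]/eqP aE; subst a b.
- by case/orP: vab uv => /eqP ->; rewrite eqxx.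
- by split=> //; apply: arc_sym.
- by split.
- by case/orP: uab uv => /eqP ->; rewrite eqxx.
Qed.

Definition dist2 (c z : pt) := (z.1 - c.1) * (z.1 - c.1) + (z.2 - c.2) * (z.2 - c.2).

Lemma dist2_ge0 c z : 0 <= dist2 c z.
Proof. by rewrite /dist2 -!expr2 addr_ge0 ?sqr_ge0. Qed.

Lemma dist2_gt0 c z : z <> c -> 0 < dist2 c z.
Proof.
move=> zc; rewrite lt_neqAle dist2_ge0 andbT eq_sym; apply/eqP => d0; apply: zc.
have d0' : (z.1 - c.1) ^+ 2 + (z.2 - c.2) ^+ 2 = 0 by rewrite !expr2.
move/eqP: d0'; rewrite paddr_eq0 ?sqr_ge0// !sqrf_eq0 !subr_eq0.
by case: (z) (c) => [? ?] [? ?] /= /andP[/eqP -> /eqP ->].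
Qed.

Lemma cont_dist2 (c : pt) (g h : R -> R) : continuous g -> continuous h ->
  continuous (fun t => dist2 c (g t, h t)).
Proof.
move=> cg ch; rewrite /dist2 /=.
by apply: contD; apply: contM; apply: contB => //; exact: cont_cst.
Qed.

Lemma arc_away x y (T : pt -> Prop) c : arc x y T -> ~ T c ->
  exists2 r : R, 0 < r & forall z, T z -> r < dist2 c z.
Proof.
move=> [g [h [[cg ch] _ _ _ e]]] Tc.
have [t] := @EVT_min R (fun t => dist2 c (g t, h t)) 0 1 ler01
  (continuous_subspaceT (@cont_dist2 c g h cg ch)).
rewrite in_itv/= => t1 tm.
have d0 : 0 < dist2 c (g t, h t).
  by apply: dist2_gt0 => E; apply: Tc; apply/e; exists t.
exists (dist2 c (g t, h t) / 2); first lra.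
move=> z /e[s s1 ->]; have := tm s; rewrite in_itv/= => /(_ s1); lra.
Qed.

Lemma uniform_gt0 (I : eqType) (s : seq I) (P : I -> R -> Prop) :
  (forall i, i \in s -> exists2 r : R, 0 < r & forall r', r' <= r -> P i r') ->
  exists2 r : R, 0 < r & forall i, i \in s -> forall r', r' <= r -> P i r'.
Proof.
elim: s => [|i s IH] H; first by exists 1.
have [|r r0 Hr] := IH; first by move=> j js; apply: H; rewrite inE js orbT.
have [|r1 r10 Hr1] := H i; first exact: mem_head.
exists (Num.min r r1); first by rewrite lt_min r0.
move=> j; rewrite inE => /orP[/eqP ->|js] r'; rewrite le_min => /andP[? ?].
  exact: Hr1.
exact: Hr.
Qed.

Lemma arc_sub x y (T : pt -> Prop) (g h : R -> R) (al be : R) :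
  continuous g -> continuous h ->
  (forall s t : R, 0 <= s <= 1 -> 0 <= t <= 1 -> g s = g t -> h s = h t -> s = t) ->
  0 <= al -> al < be -> be <= 1 -> x = (g al, h al) -> y = (g be, h be) ->
  (forall z, T z <-> exists2 t : R, al <= t <= be & z = (g t, h t)) ->
  arc x y T.
Proof.
move=> cg ch i a0 ab b1 -> -> e.
have c : continuous (fun t : R => al + t * (be - al)).
  apply: contD; first exact: cont_cst.
  by apply: contM; [exact: cont_id|exact: cont_cst].
have bd (t : R) : 0 <= t <= 1 -> al <= al + t * (be - al) <= be by move=> ?; nra.
exists (fun t => g (al + t * (be - al))), (fun t => h (al + t * (be - al))); split.
- by split; apply: cont_comp.
- move=> s t /bd s1 /bd t1 gst hst.
  have /addrI : al + s * (be - al) = al + t * (be - al) by apply: i => //; lra.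
  by apply: mulIf; apply/eqP; lra.
- by rewrite mul0r addr0.
- by rewrite mul1r addrC subrK.
move=> z; rewrite e; split=> -[t t1 ->].
  exists ((t - al) / (be - al)).
    by rewrite divr_ge0 ?ler_pdivrMr//=; lra.
  by rewrite divfK ?[al + _]addrC ?subrK//; apply/eqP; lra.
by exists (al + t * (be - al)) => //; exact: bd.
Qed.

End Drawings.

Section Inversion.
Variables (R : realType) (c : R * R) (rho n1 n2 sg k : R).
Hypotheses (rho_gt0 : 0 < rho) (unit_n : n1 * n1 + n2 * n2 = 1) (unit_sg : sg * sg = 1).
Local Notation pt := (R * R)%type.
Implicit Types z : pt.

(* With c the centre and rho the radius of a disc, inv_u and inv_v are the
   coordinates of z with respect to the boundary point c - rho n, along the unit
   vector n and orthogonally to it. The inversion centred at that point maps the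
   exterior of the disc onto the half-plane sg * (x - k) < 0. *)
Definition inv_u z := n1 * (z.1 - c.1) + n2 * (z.2 - c.2) + rho.
Definition inv_v z := - n2 * (z.1 - c.1) + n1 * (z.2 - c.2).
Definition inv_d z := inv_u z * inv_u z + inv_v z * inv_v z.

Definition inversion z : pt :=
  (k + sg * (inv_u z / inv_d z - (2 * rho)^-1), inv_v z / inv_d z).

Lemma inv_dist2 z : dist2 c z = inv_d z - 2 * rho * inv_u z + rho * rho.
Proof.
rewrite /inv_d /inv_u /inv_v /dist2.
set a := z.1 - _; set b := z.2 - _.
by transitivity ((n1 * n1 + n2 * n2) * (a * a + b * b)); [rewrite unit_n mul1r|ring].
Qed.

Lemma inv_d_gt0 z : z <> (c.1 - rho * n1, c.2 - rho * n2) -> 0 < inv_d z.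
Proof.
move=> zw; rewrite lt_neqAle; apply/andP; split; last first.
  by rewrite /inv_d -!expr2 addr_ge0 ?sqr_ge0.
rewrite eq_sym; apply/eqP => d0; apply: zw.
move/eqP: d0; rewrite /inv_d -!expr2 paddr_eq0 ?sqr_ge0// !sqrf_eq0.
move=> /andP[/eqP u0 /eqP v0].
have e1 : n1 * inv_u z - n2 * inv_v z =
    (n1 * n1 + n2 * n2) * (z.1 - c.1) + rho * n1 by rewrite /inv_u /inv_v; ring.
have e2 : n2 * inv_u z + n1 * inv_v z =
    (n1 * n1 + n2 * n2) * (z.2 - c.2) + rho * n2 by rewrite /inv_u /inv_v; ring.
move: e1 e2; rewrite u0 v0 unit_n => e1 e2.
by rewrite [z]surjective_pairing; congr (_, _); lra.
Qed.

Lemma inversion_inj z z' : 0 < inv_d z -> 0 < inv_d z' ->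
  inversion z = inversion z' -> z = z'.
Proof.
move=> d0 d0' [/addrI e1 e2].
have {}e1 : inv_u z / inv_d z = inv_u z' / inv_d z'.
  have sg0 : sg != 0 by apply/eqP => s0; move: unit_sg; rewrite s0; lra.
  by move/(mulfI sg0): e1; lra.
have dn : inv_d z != 0 by rewrite gt_eqF.
have dn' : inv_d z' != 0 by rewrite gt_eqF.
have q w : inv_d w != 0 -> (inv_d w)^-1 =
    inv_u w / inv_d w * (inv_u w / inv_d w) + inv_v w / inv_d w * (inv_v w / inv_d w).
  move=> w0.
  transitivity (inv_d w / inv_d w / inv_d w); first by rewrite divff// mul1r.
  by rewrite {1}/inv_d; ring.
have ed : inv_d z = inv_d z' by apply: invr_inj; move: (q z dn); rewrite e1 e2 => ->; exact: esym (q z' dn').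
move: e1 e2; rewrite ed => /(mulIf (invr_neq0 dn')) e1 /(mulIf (invr_neq0 dn')) e2.
have x1 w : w.1 = c.1 + (n1 * (inv_u w - rho) - n2 * inv_v w).
  transitivity (c.1 + (n1 * n1 + n2 * n2) * (w.1 - c.1)); last by rewrite /inv_u /inv_v; ring.
  by rewrite unit_n; ring.
have x2 w : w.2 = c.2 + (n2 * (inv_u w - rho) + n1 * inv_v w).
  transitivity (c.2 + (n1 * n1 + n2 * n2) * (w.2 - c.2)); last by rewrite /inv_u /inv_v; ring.
  by rewrite unit_n; ring.
rewrite [z]surjective_pairing [z']surjective_pairing.
by congr (_, _); [rewrite (x1 z) (x1 z')|rewrite (x2 z) (x2 z')]; rewrite e1 e2.
Qed.

Lemma inversion_side z : 0 < inv_d z ->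
  sg * ((inversion z).1 - k) = (rho * rho - dist2 c z) / (2 * rho * inv_d z).
Proof.
move=> d0; rewrite /= [k + _]addrC addrK mulrA unit_sg mul1r inv_dist2.
by field; rewrite !gt_eqF.
Qed.

Lemma arc_inversion x y (T : pt -> Prop) : arc x y T -> (forall z, T z -> 0 < inv_d z) ->
  arc (inversion x) (inversion y) (fun w => exists2 z, T z & w = inversion z).
Proof.
move=> [g [h [[cg ch] i -> -> e]]] T0.
have cst := @cont_cst R.
have cu : continuous (fun t => inv_u (g t, h t)).
  by rewrite /inv_u /=; apply: contD => //; apply: contD; apply: contM => //; apply: contB.
have cv : continuous (fun t => inv_v (g t, h t)).
  by rewrite /inv_v /=; apply: contD; apply: contM => //; apply: contB.
have cd : continuous (fun t => inv_d (g t, h t)) by apply: contD; apply: contM.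
have [r r0 rd] : exists2 r : R, 0 < r & forall t : R, 0 <= t <= 1 -> r <= inv_d (g t, h t).
  have [t] := @EVT_min R _ 0 1 ler01 (continuous_subspaceT cd).
  rewrite in_itv/= => t1 tm; exists (inv_d (g t, h t)); first by apply: T0; apply/e; exists t.
  by move=> s s1; apply: tm; rewrite in_itv.
pose D t := Num.max r (inv_d (g t, h t)).
have DE (t : R) : 0 <= t <= 1 -> D t = inv_d (g t, h t).
  by move=> /rd ?; rewrite /D max_r.
have cD : continuous (fun t => (D t)^-1).
  move=> t; apply: cvgV; first by rewrite gt_eqF// lt_max r0.
  exact: (cont_max (cst r) cd).
have dgt0 (t : R) : 0 <= t <= 1 -> 0 < inv_d (g t, h t).
  by move=> t1; apply: T0; apply/e; exists t.
exists (fun t => k + sg * (inv_u (g t, h t) / D t - (2 * rho)^-1)),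
  (fun t => inv_v (g t, h t) / D t).
have EE (t : R) : 0 <= t <= 1 -> inversion (g t, h t) =
    (k + sg * (inv_u (g t, h t) / D t - (2 * rho)^-1), inv_v (g t, h t) / D t).
  by move=> t1; rewrite DE.
split.
- split; last exact: contM.
  by apply: contD => //; apply: contM => //; apply: contB => //; apply: contM.
- move=> s t s1 t1 e1 e2.
  have [gst hst] : (g s, h s) = (g t, h t).
    by apply: inversion_inj; rewrite ?dgt0// !EE// e1 e2.
  exact: i.
- by rewrite EE// lexx ler01.
- by rewrite EE// lexx ler01.
move=> w; split=> [[z /e[t t1 ->] ->]|[t t1 ->]].
  by exists t => //; rewrite EE.
by exists (g t, h t); [apply/e; exists t|rewrite EE].
Qed.

End Inversion.

Section Stubs.
Variables (R : realType) (V : finType).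
Local Notation pt := (R * R)%type.
Implicit Types (W : {set V}) (E : {set {set V}}) (p : V -> pt) (S : {set V} -> pt -> Prop).

Lemma off_two_points (c P Q : pt) (rho : R) : 0 < rho -> exists n1 n2 : R,
  [/\ n1 * n1 + n2 * n2 = 1, P <> (c.1 - rho * n1, c.2 - rho * n2)
    & Q <> (c.1 - rho * n1, c.2 - rho * n2)].
Proof.
move=> r0; pose q (n : R * R) := (c.1 - rho * n.1, c.2 - rho * n.2).
have qI : injective q.
  move=> [a b] [a' b'] [/addrI/oppr_inj e1 /addrI/oppr_inj e2].
  by congr (_, _); [apply: mulfI e1|apply: mulfI e2]; rewrite gt_eqF.
pose s : seq (R * R) := [:: (1, 0); (-1, 0); (0, 1)].
have us : uniq (map q s).
  have e1 : ((1 : R) == -1) = false by apply/eqP; lra.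
  have e2 : ((-1 : R) == 0) = false by apply/eqP; lra.
  by rewrite map_inj_uniq//= !inE !xpair_eqE e1 e2 oner_eq0.
have [n ns /norP[nP nQ]] : exists2 n, n \in s & ~~ ((q n == P) || (q n == Q)).
  apply/hasP; rewrite has_predC; apply/negP => al.
  suff : (size (map q s) <= size [:: P; Q])%N by [].
  apply: uniq_leq_size us _ => _ /mapP[n ns ->].
  by rewrite !inE (allP al).
exists n.1, n.2; split; last 2 first.
- by apply/eqP; rewrite eq_sym.
- by apply/eqP; rewrite eq_sym.
by move: ns; rewrite !inE => /or3P[] /eqP -> /=; rewrite ?mulr0 ?mul0r ?addr0 ?add0r ?mulr1 ?mulrNN ?mulr1.
Qed.

Lemma disc_around (W : {set V}) E p S a b (c : pt) :
  drawing W E p S -> [set a; b]%SET \in E ->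
  S [set a; b]%SET c -> c <> p a -> c <> p b ->
  exists2 rho : R, 0 < rho &
    (forall w, w \in W -> rho * rho < dist2 c (p w)) /\
    (forall e z, e \in E -> e != [set a; b]%SET -> S e z -> rho * rho < dist2 c z).
Proof.
move=> dr abE Sc ca cb; have [pI arcE onE meetE] := dr.
have cW w : w \in W -> p w <> c.
  move=> wW pwc; have : w \in [set a; b]%SET by apply: onE => //; rewrite pwc.
  by rewrite !inE => /orP[]/eqP Q; [apply: ca|apply: cb]; rewrite -pwc Q.
have [r1 r10 H1] : exists2 r : R, 0 < r & forall w, w \in enum W ->
    forall r', r' <= r -> r' < dist2 c (p w).
  apply: uniform_gt0 => w; rewrite mem_enum => /cW/dist2_gt0 d0.
  by exists (dist2 c (p w) / 2); [lra|move=> r' ?; lra].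
have [r2 r20 H2] : exists2 r : R, 0 < r & forall e, e \in enum (E :\ [set a; b]%SET) ->
    forall r', r' <= r -> forall z, S e z -> r' < dist2 c z.
  apply: uniform_gt0 => e; rewrite mem_enum in_setD1 => /andP[eab eE].
  have [u [v [uW vW _ au]]] := arcE _ eE.
  have [|r r0 rd] := arc_away au (c := c).
    move=> Sec; have [|w wW cw] := meetE _ _ c eE abE _ Sec Sc; first exact/eqP.
    by apply: (cW w wW).
  by exists r => // r' r'r z /rd; apply: le_lt_trans.
pose r := Num.min r1 r2; have r0 : 0 < r by rewrite lt_min r10.
have rr1 : r <= r1 by rewrite ge_min lexx.
have rr2 : r <= r2 by rewrite ge_min lexx orbT.
pose rho := Num.min 1 r.
have rho0 : 0 < rho by rewrite lt_min r0 ltr01.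
have rho1 : rho <= 1 by rewrite ge_min lexx.
have rhor : rho <= r by rewrite ge_min lexx orbT.
have rhoq : rho * rho <= r by nra.
exists rho => //; split=> [w wW|e z eE eab].
  by apply: (H1 w); rewrite ?mem_enum// (le_trans rhoq).
by apply: (H2 e); rewrite ?mem_enum ?in_setD1 ?eab// (le_trans rhoq).
Qed.

(* The edge is cut where it first and last meets the boundary of a small disc
   around its midpoint; the centre of the inversion is a third boundary point. *)
Lemma stubs W E a b p S (sg k : R) : sg * sg = 1 -> drawing W E p S ->
  [set a; b]%SET \in E ->
  exists p' S' s1 s2 y1 y2,
    half_drawing W (E :\ [set a; b]%SET) a b p' S' s1 s2 y1 y2 sg k.
Proof.
move=> sg1 dr abE; have [pI arcE onE meetE] := dr.
set e := [set a; b]%SET in abE *.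
have [aW bW] := drawing_arc dr abE.
move=> [g [h [[cg ch] i pa pb Sg]]].
pose gam (t : R) : pt := (g t, h t).
have gI (s t : R) : 0 <= s <= 1 -> 0 <= t <= 1 -> gam s = gam t -> s = t.
  by move=> s1 t1 [? ?]; apply: i.
have Sgam (t : R) : 0 <= t <= 1 -> S e (gam t) by move=> t1; apply/Sg; exists t.
pose c := gam (1/2).
have ca : c <> p a by rewrite pa => /gI Q; have := Q; lra.
have cb : c <> p b by rewrite pb => /gI Q; have := Q; lra.
have [|rho rho0 [dW dE]] := disc_around dr abE _ ca cb; first by apply: Sgam; lra.
have dc : dist2 c c = 0 by rewrite /dist2 !subrr mul0r addr0.
have [t1 [t11 ft1 lt1]] : exists t1 : R, [/\ 0 < t1 <= 1,
    dist2 c (gam (t1 / 2)) - rho * rho = 0 &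
    forall s, 0 <= s -> s < t1 -> 0 < dist2 c (gam (s / 2)) - rho * rho].
  apply: first_nonpos.
  - apply: contB; last exact: cont_cst.
    have ch2 : continuous (fun t : R => t / 2).
      by apply: contM; [exact: cont_id|exact: cont_cst].
    by apply: cont_dist2; apply: cont_comp.
  - by rewrite mul0r subr_gt0 /gam -pa dW.
  - by rewrite -/c dc; nra.
have [t2 [t21 ft2 lt2]] : exists t2 : R, [/\ 0 < t2 <= 1,
    dist2 c (gam (1 - t2 / 2)) - rho * rho = 0 &
    forall s, 0 <= s -> s < t2 -> 0 < dist2 c (gam (1 - s / 2)) - rho * rho].
  apply: first_nonpos.
  - apply: contB; last exact: cont_cst.
    have ch2 : continuous (fun t : R => 1 - t / 2).
      apply: contB; first exact: cont_cst.
      by apply: contM; [exact: cont_id|exact: cont_cst].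
    by apply: cont_dist2; apply: cont_comp.
  - by rewrite mul0r subr0 subr_gt0 /gam -pb dW.
  - have -> : 1 - 1 / 2 = 1 / 2 :> R by lra.
    by rewrite -/c dc; nra.
have t1n : t1 <> 1 by move=> Q; move: ft1; rewrite Q -/c dc; nra.
have t2n : t2 <> 1.
  move=> Q; move: ft2; rewrite Q; have -> : 1 - 1 / 2 = 1 / 2 :> R by lra.
  by rewrite -/c dc; nra.
have {}t11 : 0 < t1 < 1 by move/eqP: t1n => ?; rewrite lt_neqAle; lra.
have {}t21 : 0 < t2 < 1 by move/eqP: t2n => ?; rewrite lt_neqAle; lra.
pose al := t1 / 2; pose be := 1 - t2 / 2.
have al1 : 0 < al < 1/2 by rewrite /al; lra.
have be1 : 1/2 < be < 1 by rewrite /be; lra.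
have dal (s : R) : 0 <= s -> s < al -> rho * rho < dist2 c (gam s).
  move=> s0 sa; have := lt1 (s + s); rewrite subr_gt0.
  have -> : (s + s) / 2 = s by lra.
  by apply; move: sa; rewrite /al; lra.
have dbe (s : R) : s <= 1 -> be < s -> rho * rho < dist2 c (gam s).
  move=> s0 sb; have := lt2 (2 - (s + s)); rewrite subr_gt0.
  have -> : 1 - (2 - (s + s)) / 2 = s by lra.
  by apply; move: sb; rewrite /be; lra.
have [n1 [n2 [nn nP nQ]]] := off_two_points c (gam al) (gam be) rho0.
pose d := inv_d c rho n1 n2; pose phi := inversion c rho n1 n2 sg k.
have dist_inv z : z <> (c.1 - rho * n1, c.2 - rho * n2) -> 0 < d z.
  exact: inv_d_gt0.
have dist_om : dist2 c (c.1 - rho * n1, c.2 - rho * n2) = rho * rho.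
  rewrite /dist2 /=; transitivity (rho * rho * (n1 * n1 + n2 * n2)); last by rewrite nn mulr1.
  by ring.
have far z : rho * rho < dist2 c z -> 0 < d z.
  by move=> zr; apply: dist_inv => Q; move: zr; rewrite Q dist_om ltxx.
have side z : rho * rho < dist2 c z -> sg * ((phi z).1 - k) < 0.
  move=> zr; rewrite (inversion_side k rho0 nn sg1 (far _ zr)).
  by rewrite pmulr_llt0 ?subr_lt0// invr_gt0 !mulr_gt0// far.
have phiI z z' : 0 < d z -> 0 < d z' -> phi z = phi z' -> z = z'.
  exact: inversion_inj.
pose T1 z := exists2 t : R, 0 <= t <= al & z = gam t.
pose T2 z := exists2 t : R, be <= t <= 1 & z = gam t.
have dT1 z : T1 z -> 0 < d z.
  move=> [t ta ->]; have [->|tal] := eqVneq t al; first exact: dist_inv.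
  by apply: far; apply: dal; move/eqP: tal => ?; rewrite ?lt_neqAle; lra.
have dT2 z : T2 z -> 0 < d z.
  move=> [t ta ->]; have [->|tal] := eqVneq t be; first exact: dist_inv.
  by apply: far; apply: dbe; move/eqP: tal => ?; rewrite ?lt_neqAle; lra.
have T1S z : T1 z -> S e z by move=> [t ta ->]; apply: Sgam; lra.
have T2S z : T2 z -> S e z by move=> [t ta ->]; apply: Sgam; lra.
have aT1 : arc (p a) (gam al) T1.
  by apply: (@arc_sub _ _ _ _ g h 0 al cg ch i _ _ _ pa erefl (fun z => iff_refl _)); lra.
have bT2 : arc (p b) (gam be) T2.
  apply: arc_sym.
  by apply: (@arc_sub _ _ _ _ g h be 1 cg ch i _ _ _ erefl pb (fun z => iff_refl _)); lra.
have phik (t : R) : 0 < d (gam t) -> dist2 c (gam t) = rho * rho -> (phi (gam t)).1 = k.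
  move=> d0 dd; have := inversion_side k rho0 nn sg1 d0; rewrite dd subrr mul0r -/phi.
  have sg0 : sg != 0 by apply/eqP => s0; move: sg1; rewrite s0; lra.
  by move/eqP; rewrite mulf_eq0 (negbTE sg0) subr_eq0 => /eqP.
have dgal : 0 < d (gam al) by exact: dist_inv.
have dgbe : 0 < d (gam be) by exact: dist_inv.
have kal : (phi (gam al)).1 = k by apply: phik => //; move: ft1; rewrite -/al; lra.
have kbe : (phi (gam be)).1 = k by apply: phik => //; move: ft2; rewrite -/be; lra.
pose img (T : pt -> Prop) w := exists2 z, T z & w = phi z.
have dp w : w \in W -> 0 < d (p w) by move=> wW; apply: far; apply: dW.
have pW (T : pt -> Prop) w : (forall z, T z -> 0 < d z) -> w \in W -> img T (phi (p w)) -> T (p w).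
  by move=> Td wW [z Tz /phiI Q]; rewrite Q ?dp ?Td.
have dS f z : f \in E :\ e -> S f z -> 0 < d z.
  by rewrite in_setD1 => /andP[fe fE] Sf; apply: far; apply: (dE f).
exists (phi \o p), (fun f => img (S f)), (img T1), (img T2), (phi (gam al)).2, (phi (gam be)).2.
split.
- split.
  + by move=> u v uW vW /= /phiI Q; apply: pI => //; apply: Q; apply: dp.
  + move=> f fE; have := fE; rewrite in_setD1 => /andP[fe fE'].
    have [u [v [uW vW fuv au]]] := arcE _ fE'.
    exists u, v; split=> //; apply: arc_inversion => // z; exact: dS.
  + move=> f w fE wW /pW H; have := fE; rewrite in_setD1 => /andP[fe fE'].
    by apply: onE => //; apply: H => // z; apply: dS.
  + move=> f f' z fE fE' ff' [u Su ->] [v Sv /phiI uv].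
    have {}uv : u = v by apply: uv; [exact: dS Su|exact: dS Sv].
    move: Sv; rewrite -uv => Sv.
    move: fE fE'; rewrite !in_setD1 => /andP[_ fE] /andP[_ fE'].
    by have [w wW ->] := meetE _ _ _ fE fE' ff' Su Sv; exists w.
- split=> [w wW|f _ fE [z Sz ->]]; first by apply: side; apply: dW.
  by move: fE; rewrite in_setD1 => /andP[fe fE]; apply: side; apply: (dE f).
- split.
  + by rewrite -{1}kal -surjective_pairing; apply: arc_inversion.
  + by rewrite -{1}kbe -surjective_pairing; apply: arc_inversion.
  + move=> Q; have : phi (gam al) = phi (gam be).
      by rewrite [LHS]surjective_pairing [RHS]surjective_pairing kal kbe Q.
    by move=> /phiI Q'; have /gI := Q' dgal dgbe; lra.
- split.
  + move=> _ [_ [t ta ->] ->] tn; apply: side; apply: dal; first lra.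
    have [tal|?] := eqVneq t al; last by rewrite lt_neqAle; lra.
    by case: tn; rewrite tal -{1}kal -surjective_pairing.
  + move=> _ [_ [t ta ->] ->] tn; apply: side; apply: dbe; first lra.
    have [tal|?] := eqVneq t be; last by rewrite lt_neqAle; lra.
    by case: tn; rewrite tal -{1}kbe -surjective_pairing.
  + move=> _ [z Tz ->] [z' Tz' /phiI Q].
    have {}Q : z = z' by apply: Q; [exact: dT1|exact: dT2].
    move: Tz Tz' => [t ta zt] [t' ta' zt'].
    have /gI : gam t = gam t' by rewrite -zt -zt'.
    lra.
have T1b : T1 (p b) -> False.
  by rewrite pb => -[t ta /gI]; lra.
have T2a : T2 (p a) -> False.
  by rewrite pa => -[t ta /gI]; lra.
split.
- move=> _ f fE [z Sz ->]; have dz := dS _ _ fE Sz.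
  move: fE; rewrite in_setD1 => /andP[/eqP fe fE].
  split=> -[z' Tz' /phiI Q]; [have Tz : T1 z by rewrite Q// dT1|have Tz : T2 z by rewrite Q// dT2].
    have [w wW zw] := meetE _ _ _ fE abE fe Sz (T1S _ Tz).
    have : w \in e by apply: onE => //; rewrite -zw; exact: T1S.
    by rewrite !inE => /orP[]/eqP wE; [rewrite zw wE|case: T1b; rewrite -wE -zw].
  have [w wW zw] := meetE _ _ _ fE abE fe Sz (T2S _ Tz).
  have : w \in e by apply: onE => //; rewrite -zw; exact: T2S.
  by rewrite !inE => /orP[]/eqP wE; [case: T2a; rewrite -wE -zw|rewrite zw wE].
move=> w wW; split=> /pW H.
  have : T1 (p w) by exact: H.
  move=> Tw; have : w \in e by apply: onE => //; exact: T1S.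
  by rewrite !inE => /orP[]/eqP wE//; case: T1b; rewrite -wE.
have : T2 (p w) by exact: H.
move=> Tw; have : w \in e by apply: onE => //; exact: T2S.
by rewrite !inE => /orP[]/eqP wE//; case: T2a; rewrite -wE.
Qed.

End Stubs.

Section Assembly.
Variables (R : realType) (V : finType).
Local Notation pt := (R * R)%type.
Implicit Types (W : {set V}) (E : {set {set V}}) (p q : V -> pt) (S T : {set V} -> pt -> Prop).

(* Half of a half_drawing: a single loose end s, starting at a. *)
Definition stub_drawing W E a p S (s : pt -> Prop) (y sg k : R) :=
  [/\ drawing W E p S, a \in W,
      (forall w, w \in W -> sg * ((p w).1 - k) < 0) /\
        (forall e z, e \in E -> S e z -> sg * (z.1 - k) < 0),
      arc (p a) (k, y) s /\ (forall z, s z -> z <> (k, y) -> sg * (z.1 - k) < 0)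
    & (forall z e, e \in E -> S e z -> s z -> z = p a) /\
        (forall w, w \in W -> s (p w) -> w = a)].

Lemma drawing_sub W E W' E' p S : drawing W E p S -> W' \subset W -> E' \subset E ->
  (forall e, e \in E' -> e \subset W') -> drawing W' E' p S.
Proof.
move=> [pI arcE onE meetE] /subsetP WW /subsetP EE eW; split.
- by move=> u v /WW ? /WW ?; apply: pI.
- move=> e eE; have [u [v [uW vW euv au]]] := arcE _ (EE _ eE).
  have /subsetP ew := eW _ eE; exists u, v; split=> //.
    by apply: ew; rewrite euv !inE eqxx.
  by apply: ew; rewrite euv !inE eqxx orbT.
- by move=> e w /EE ? /WW ?; apply: onE.
move=> e f z eE fE ef Se Sf; have [w wW zw] := meetE _ _ _ (EE _ eE) (EE _ fE) ef Se Sf.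
exists w => //; have /subsetP ew := eW _ eE; apply: ew.
by apply: (onE _ _ (EE _ eE) wW); rewrite -zw.
Qed.

Lemma half_sym W E a b p S s1 s2 y1 y2 (sg k : R) :
  half_drawing W E a b p S s1 s2 y1 y2 sg k -> half_drawing W E b a p S s2 s1 y2 y1 sg k.
Proof.
move=> [dr sd [a1 a2 y12] [b1 b2 d] [c1 c2]]; split=> //.
- by split=> // ?; apply: y12.
- by split=> // z ? ?; apply: (d z).
by split=> [z e eE Sz|w wW]; [have [] := c1 z e eE Sz|have [] := c2 w wW].
Qed.

Lemma half_stub W E a b p S s1 s2 y1 y2 (sg k : R) : a \in W ->
  half_drawing W E a b p S s1 s2 y1 y2 sg k -> stub_drawing W E a p S s1 y1 sg k.
Proof.
move=> aW [dr sd [a1 _ _] [b1 _ _] [c1 c2]]; split=> //.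
by split=> [z e eE Sz|w wW]; [have [] := c1 z e eE Sz|have [] := c2 w wW].
Qed.

Lemma stub_sub W E W' E' a p S s y (sg k : R) : stub_drawing W E a p S s y sg k ->
  a \in W' -> W' \subset W -> E' \subset E -> (forall e, e \in E' -> e \subset W') ->
  stub_drawing W' E' a p S s y sg k.
Proof.
move=> [dr aW [sd1 sd2] st [m1 m2]] aW' WW EE eW; split=> //.
- exact: drawing_sub dr WW EE eW.
- by split=> [w /(subsetP WW)|e z /(subsetP EE)]; [apply: sd1|apply: sd2].
by split=> [z e /(subsetP EE)|w /(subsetP WW)]; [apply: m1|apply: m2].
Qed.

Definition glue W p q := fun w => if w \in W then p w else q w.
Definition glue_edges E S T := fun e : {set V} => if e \in E then S e else T e.
Definition set_edge S e (A : pt -> Prop) := fun f : {set V} => if f == e then A else S f.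

Lemma drawing_glue (A B : pt -> Prop) W1 E1 p S W2 E2 q T :
  drawing W1 E1 p S -> drawing W2 E2 q T -> [disjoint W1 & W2] ->
  (forall z, A z -> B z -> False) ->
  (forall w, w \in W1 -> A (p w)) -> (forall e z, e \in E1 -> S e z -> A z) ->
  (forall w, w \in W2 -> B (q w)) -> (forall e z, e \in E2 -> T e z -> B z) ->
  drawing (W1 :|: W2) (E1 :|: E2) (glue W1 p q) (glue_edges E1 S T).
Proof.
move=> [pI arcE onE meetE] [qI arcF onF meetF] dW AB A1 A2 B1 B2.
have g1 w : w \in W1 -> glue W1 p q w = p w by rewrite /glue => ->.
have g2 w : w \in W2 -> glue W1 p q w = q w.
  by move=> w2; rewrite /glue (disjointFl dW w2).
have dE e : e \in E1 -> e \in E2 -> False.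
  move=> /arcE[u [v [uW _ e1 _]]] /arcF[u' [v' [uW' vW' e2 _]]].
  have : u \in e by rewrite e1 !inE eqxx.
  by rewrite e2 !inE => /orP[]/eqP uu; move: (disjointFr dW uW); rewrite uu ?uW' ?vW'.
have G1 e : e \in E1 -> glue_edges E1 S T e = S e by rewrite /glue_edges => ->.
have G2 e : e \in E2 -> glue_edges E1 S T e = T e.
  by rewrite /glue_edges => e2; case: ifP => // /dE.
split.
- move=> u v; rewrite !inE => /orP[uW|uW] /orP[vW|vW]; rewrite ?(g1 _ uW) ?(g2 _ uW) ?(g1 _ vW) ?(g2 _ vW).
  + exact: pI.
  + by move=> E; case: (AB (p u)); [apply: A1|rewrite E; apply: B1].
  + by move=> E; case: (AB (p v)); [apply: A1|rewrite -E; apply: B1].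
  + exact: qI.
- move=> e; rewrite inE => /orP[eE|eE].
    have [u [v [uW vW euv au]]] := arcE _ eE.
    by exists u, v; rewrite !inE uW vW !g1// G1.
  have [u [v [uW vW euv au]]] := arcF _ eE.
  by exists u, v; rewrite !inE uW vW !orbT !g2// G2.
- move=> e w; rewrite !inE => /orP[eE|eE] /orP[wW|wW]; rewrite ?(G1 _ eE) ?(G2 _ eE) ?(g1 _ wW) ?(g2 _ wW).
  + exact: onE.
  + by move/(A2 _ _ eE)/AB/(_ (B1 _ wW)).
  + by move/(B2 _ _ eE); move/(AB _ (A1 _ wW)).
  + exact: onF.
move=> e f z; rewrite !inE => /orP[eE|eE] /orP[fE|fE] ef; rewrite ?(G1 _ eE) ?(G2 _ eE) ?(G1 _ fE) ?(G2 _ fE).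
- move=> Se Sf; have [w wW ->] := meetE _ _ _ eE fE ef Se Sf.
  by exists w; rewrite ?inE ?wW ?g1.
- by move=> /(A2 _ _ eE)/AB h /(B2 _ _ fE)/h.
- by move=> /(B2 _ _ eE) h /(A2 _ _ fE)/AB/(_ h).
move=> Se Sf; have [w wW ->] := meetF _ _ _ eE fE ef Se Sf.
by exists w; rewrite ?inE ?wW ?orbT ?g2.
Qed.

Lemma drawing_add_edge W E p S u v (A : pt -> Prop) : drawing W E p S ->
  u \in W -> v \in W -> [set u; v]%SET \notin E -> arc (p u) (p v) A ->
  (forall w, w \in W -> A (p w) -> w = u \/ w = v) ->
  (forall e z, e \in E -> S e z -> A z -> z = p u \/ z = p v) ->
  drawing W ([set u; v]%SET |: E) p (set_edge S [set u; v]%SET A).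
Proof.
move=> [pI arcE onE meetE] uW vW uvE arcA Aw AS.
have s1 : set_edge S [set u; v]%SET A [set u; v]%SET = A by rewrite /set_edge eqxx.
have s2 e : e \in E -> set_edge S [set u; v]%SET A e = S e.
  by rewrite /set_edge => eE; case: eqP => // euv; move: uvE; rewrite -euv eE.
split=> //.
- move=> e; rewrite !inE => /orP[/eqP ->|eE]; first by exists u, v; rewrite s1.
  have [u' [v' [uW' vW' euv au]]] := arcE _ eE.
  by exists u', v'; rewrite s2.
- move=> e w; rewrite !inE => /orP[/eqP ->|eE] wW.
    by rewrite s1 => /(Aw _ wW)[] ->; rewrite !inE eqxx ?orbT.
  by rewrite s2//; apply: onE.
have H e z : e \in E -> S e z -> A z -> exists2 w, w \in W & z = p w.
  by move=> eE Se Az; have [->|->] := AS _ _ eE Se Az; [exists u|exists v].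
move=> e f z; rewrite !inE => /orP[/eqP ->|eE] /orP[/eqP ->|fE] ef //; rewrite ?s1 ?(s2 e)// ?(s2 f)//.
- by move=> Az Sf; apply: (H f).
- by move=> Se Az; apply: (H e).
exact: meetE.
Qed.

Lemma extend_stub W E a a' b p S s1 s2 y1 y2 (sg k : R) :
  half_drawing W E a b p S s1 s2 y1 y2 sg k -> [set a'; a]%SET \in E ->
  b \in W -> b <> a' -> (forall e, e \in E -> a \in e -> e = [set a'; a]%SET) ->
  half_drawing (W :\ a) (E :\ [set a'; a]%SET) a' b p S
    (fun z => S [set a'; a]%SET z \/ s1 z) s2 y1 y2 sg k.
Proof.
move=> [dr [sd1 sd2] [a1 a2 y12] [b1 b2 d] [c1 c2]] aaE bW ba' aonly.
have [pI arcE onE meetE] := dr.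
have [a'W aW au] := drawing_arc dr aaE.
have sEE : E :\ [set a'; a]%SET \subset E by rewrite subD1set.
have sWW : W :\ a \subset W by rewrite subD1set.
have inE1 e : e \in E :\ [set a'; a]%SET -> e \in E /\ e <> [set a'; a]%SET.
  by rewrite in_setD1 => /andP[/eqP ? ?].
have inW w : w \in W :\ a -> w \in W /\ w <> a.
  by rewrite in_setD1 => /andP[/eqP ? ?].
split.
- apply: drawing_sub dr sWW sEE _ => e /inE1[eE ene].
  have [u [v [uW vW euv _]]] := arcE _ eE.
  apply/subsetP => w we; rewrite in_setD1; apply/andP; split.
    by apply/eqP => wa; apply: ene; apply: aonly => //; rewrite -wa.
  by move: we; rewrite euv !inE => /orP[]/eqP ->.
- by split=> [w /inW[] /sd1//|e z /inE1[] /sd2 h _ /h].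
- split=> //; apply: arc_cat au a1 _ => z Sz sz.
  by have [h _] := c1 z _ aaE Sz; exact: h.
- split=> //.
    by move=> z [/(sd2 _ _ aaE)//|]; apply: b1.
  move=> z [Sz|s1z] s2z; last exact: (d z).
  have [_ h] := c1 z _ aaE Sz; have zb := h s2z.
  have : b \in [set a'; a]%SET by apply: (onE _ _ aaE bW); rewrite -zb.
  rewrite !inE => /orP[]/eqP // ba; subst b.
  by apply: (d (p a)); [exact: arc_source a1|exact: arc_source a2].
split=> [z e /inE1[eE ene] Se|w /inW[wW wa]].
  have anote : a \in e -> False by move=> ae; apply: ene; exact: aonly.
  have [h1 h2] := c1 z e eE Se; split=> // -[Saa|/h1 za]; last first.
    by case: anote; apply: (onE _ _ eE aW); rewrite -za.
  have [w wW zw] := meetE _ _ _ eE aaE ene Se Saa.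
  have : w \in [set a'; a]%SET by apply: (onE _ _ aaE wW); rewrite -zw.
  rewrite !inE => /orP[]/eqP wE; first by rewrite zw wE.
  by case: anote; apply: (onE _ _ eE aW); rewrite -wE -zw.
have [h1 h2] := c2 w wW; split=> // -[Sw|/h1//].
by have := onE _ _ aaE wW Sw; rewrite !inE => /orP[]/eqP.
Qed.

End Assembly.

Section Joining.
Variables (R : realType) (V : finType).
Local Notation pt := (R * R)%type.
Implicit Types (W : {set V}) (E : {set {set V}}) (p q : V -> pt) (S T : {set V} -> pt -> Prop).

Lemma half_drawing_neq W E a b p S s1 s2 y1 y2 (sg k : R) :
  half_drawing W E a b p S s1 s2 y1 y2 sg k -> a <> b.
Proof.
move=> [_ _ [a1 a2 _] [_ _ d] _] ab; subst b.
by apply: (d (p a)); [exact: arc_source a1|exact: arc_source a2].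
Qed.

Lemma edge_sub W E p S e : drawing W E p S -> e \in E -> e \subset W.
Proof.
move=> [_ arcE _ _] /arcE[u [v [uW vW -> _]]].
by apply/subsetP => w; rewrite !inE => /orP[]/eqP ->.
Qed.

Lemma seg_side (k sg y l y' : R) z : sg * sg = 1 -> 0 < l ->
  seg (k, y) (k + sg * l, y') z ->
  [/\ 0 <= sg * (z.1 - k), sg * (z.1 - k) <= l, z.1 = k + sg * (sg * (z.1 - k)) &
   z.2 * l = y * l + sg * (z.1 - k) * (y' - y)].
Proof.
move=> s1 l0 [t t1 -> /=].
have -> : sg * (k + t * (k + sg * l - k) - k) = t * l.
  by transitivity (sg * sg * (t * l)); [ring|rewrite s1 mul1r].
by split; [nra|nra|ring|ring].
Qed.

Lemma drawing_point v (x : pt) T : drawing [set v]%SET set0 (fun=> x) T.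
Proof.
by split=> [u w|e|e w|e f z]; rewrite ?inE // => /eqP -> /eqP ->.
Qed.

(* Joins both loose ends to a new vertex v, which gets a loose end of its own. *)
Lemma stub_apex W E a b p S s1 s2 y1 y2 (sg k : R) v : sg * sg = 1 ->
  half_drawing W E a b p S s1 s2 y1 y2 sg k -> a \in W -> b \in W -> v \notin W ->
  exists p' S' s y,
    stub_drawing (W :|: [set v]) ([set a; v] |: ([set b; v] |: E))%SET v p' S' s y
      sg (k + sg * 1 + sg * 1).
Proof.
move=> sg1 hd aW bW vW; have ab := half_drawing_neq hd.
have [dr [sd1 sd2] [a1 a2 y12] [b1 b2 d] [c1 c2]] := hd.
pose x0 : pt := (k + sg * 1, 0).
pose side (z : pt) := sg * (z.1 - k).
have side0 : side x0 = 1 by rewrite /side /x0 /=; nra.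
have zside (z : pt) : z.1 = k + sg * side z.
  by rewrite /side mulrA sg1 mul1r addrC subrK.
have zeq (z z' : pt) : side z = side z' -> z.2 = z'.2 -> z = z'.
  by move=> h1 h2; rewrite [z]surjective_pairing [z']surjective_pairing h2 zside h1 -zside.
have sidek (y : R) : side (k, y) = 0 by rewrite /side /= subrr mulr0.
pose p' := glue W p (fun=> x0).
have p'W w : w \in W -> p' w = p w by rewrite /p' /glue => ->.
have p'v : p' v = x0 by rewrite /p' /glue (negbTE vW).
have d1 : drawing (W :|: [set v]%SET) E p' (glue_edges E S S).
  rewrite -[E in drawing _ E]finset.setU0.
  apply: (@drawing_glue _ _ (fun z => side z < 0) (fun z => side z > 0)) => //.
  - exact: drawing_point.
  - by rewrite disjoint_sym disjoints1.
  - by move=> z z1 z2; have := lt_trans z1 z2; rewrite ltxx.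
  - by move=> w _; rewrite side0.
  - by move=> e z; rewrite inE.
set S1 := glue_edges E S S in d1.
have S1E e : S1 e = S e by rewrite /S1 /glue_edges if_same.
pose A i y z := i z \/ seg (k, y) x0 z.
have segA y z : seg (k, y) x0 z -> [/\ 0 <= side z, side z <= 1 & z.2 = y * (1 - side z)].
  by move=> /(seg_side sg1 ltr01)[? ? _ z2]; split=> //; rewrite /side; lra.
have arcA i y w : w \in W -> arc (p w) (k, y) i ->
    (forall z, i z -> z <> (k, y) -> side z < 0) -> arc (p' w) (p' v) (A i y).
  move=> wW ai iz; rewrite p'W// p'v; apply: (arc_cat ai).
    by apply: arc_seg => E0; have := sidek y; rewrite E0 side0; lra.
  move=> z si /segA[z0 _ _]; have [//|/eqP zk] := eqVneq z (k, y).
  by exfalso; have := iz _ si zk; lra.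
have sideW w : w \in W -> side (p w) < 0 by exact: sd1.
have sideE e z : e \in E -> S e z -> side z < 0 by exact: sd2.
have memW w : w \in (W :|: [set v])%SET -> w \in W \/ w = v.
  by rewrite !inE => /orP[|/eqP]; [left|right].
have AW i y w u : u \in W -> (forall w', w' \in W -> i (p w') -> w' = u) ->
    (forall z, i z -> z <> (k, y) -> side z < 0) ->
    w \in (W :|: [set v])%SET -> A i y (p' w) -> w = u \/ w = v.
  move=> uW iu iz /memW[wW|->]; last by right.
  rewrite p'W// => -[/iu|/segA[z0 _ _]]; first by left; auto.
  by exfalso; have := sideW _ wW; lra.
have notE u : [set u; v]%SET \notin E.
  by apply/negP => /(drawing_arc dr)[_]; rewrite (negbTE vW).
have d2 : drawing (W :|: [set v]%SET) ([set b; v]%SET |: E) p'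
    (set_edge S1 [set b; v]%SET (A s2 y2)).
  apply: drawing_add_edge => //.
  - by rewrite !inE bW.
  - by rewrite !inE eqxx orbT.
  - by apply: arcA.
  - by move=> w; apply: AW => // w' wW'; have [_] := c2 w' wW'.
  - move=> e z eE; rewrite S1E => Sz [s2z|/segA[z0 _ _]]; last by exfalso; have := sideE _ _ eE Sz; lra.
    by have [_ h] := c1 z e eE Sz; left; rewrite p'W//; apply: h.
set S2 := set_edge S1 _ _ in d2.
have S2b : S2 [set b; v]%SET = A s2 y2 by rewrite /S2 /set_edge eqxx.
have S2E e : e \in E -> S2 e = S e.
  by move=> eE; rewrite /S2 /set_edge; case: eqP => // eb; move: (notE b); rewrite -eb eE.
have abv : [set a; v]%SET <> [set b; v]%SET :> {set V}.
  move=> E0; have : a \in [set b; v]%SET by rewrite -E0 !inE eqxx.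
  by rewrite !inE => /orP[]/eqP // av; move: vW; rewrite -av aW.
have A12 z : A s1 y1 z -> A s2 y2 z -> z = x0.
  move=> [s1z|/segA[z0 z1 zy]] [s2z|/segA[z0' z1' zy']].
  - by case: (d z).
  - have [zk|/eqP zk] := eqVneq z (k, y1); last by exfalso; have := b1 _ s1z zk; rewrite -/(side z); lra.
    by case: y12; move: zy'; rewrite zk sidek /=; lra.
  - have [zk|/eqP zk] := eqVneq z (k, y2); last by exfalso; have := b2 _ s2z zk; rewrite -/(side z); lra.
    by case: y12; move: zy; rewrite zk sidek /=; lra.
  have : (y1 - y2) * (1 - side z) = 0 by lra.
  move/eqP; rewrite mulf_eq0 !subr_eq0 => /orP[/eqP//|/eqP sz].
  by apply: zeq; [rewrite side0|rewrite zy -sz /=; lra].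
have d3 : drawing (W :|: [set v]%SET) ([set a; v]%SET |: ([set b; v]%SET |: E)) p'
    (set_edge S2 [set a; v]%SET (A s1 y1)).
  apply: drawing_add_edge => //.
  - by rewrite !inE aW.
  - by rewrite !inE eqxx orbT.
  - by rewrite !inE negb_or notE andbT; apply/eqP.
  - by apply: arcA.
  - by move=> w; apply: AW => // w' wW'; have [] := c2 w' wW'.
  - move=> e z; rewrite !inE => /orP[/eqP ->|eE].
      by rewrite S2b p'v => h1 h2; right; apply: A12.
    rewrite S2E// => Sz [s1z|/segA[z0 _ _]]; last by exfalso; have := sideE _ _ eE Sz; lra.
    by have [h _] := c1 z e eE Sz; left; rewrite p'W//; apply: h.
set S3 := set_edge S2 _ _ in d3.
have S3z e z : e \in ([set a; v] |: ([set b; v] |: E))%SET -> S3 e z ->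
    [\/ side z < 0, A s1 y1 z | A s2 y2 z].
  rewrite /S3 /set_edge; case: eqP => [_ _|ea]; first by constructor 2.
  rewrite !inE => /orP[/eqP//|/orP[/eqP ->|eE]].
    by rewrite S2b; constructor 3.
  by rewrite S2E// => Sz; constructor 1; apply: (sideE e).
have Az i y z : (forall z, i z -> z <> (k, y) -> side z < 0) ->
    A i y z -> side z < 1 \/ z = x0.
  move=> iz [si|/segA[z0 z1 zy]].
    have [->|/eqP zk] := eqVneq z (k, y); first by left; rewrite sidek; lra.
    by left; have := iz _ si zk; lra.
  have [zs|zs] := eqVneq (side z) 1; last by left; rewrite lt_neqAle zs.
  by right; apply: zeq; [rewrite side0|rewrite zy zs /=; lra].
have S3z1 e z : e \in ([set a; v] |: ([set b; v] |: E))%SET -> S3 e z ->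
    side z < 1 \/ z = x0.
  by move=> eE /(S3z _ _ eE)[?|/(Az _ _ _ b1)|/(Az _ _ _ b2)] //; left; lra.
pose x1 : pt := (k + sg * 1 + sg * 1, 0).
have shift z : sg * (z.1 - (k + sg * 1 + sg * 1)) = side z - 2.
  by rewrite /side; nra.
have seg3 z : seg x0 x1 z -> [/\ 1 <= side z, side z <= 2 & z.2 = 0].
  move=> /(seg_side sg1 ltr01)[]; have -> : sg * (z.1 - (k + sg * 1)) = side z - 1.
    by rewrite /side; nra.
  by move=> *; split; lra.
exists p', S3, (seg x0 x1), 0; split=> //.
- by rewrite !inE eqxx orbT.
- split=> [w /memW[wW|->]|e z eE /(S3z1 _ _ eE)[?|->]]; rewrite shift.
  + by rewrite p'W//; have := sideW _ wW; lra.
  + by rewrite p'v side0; lra.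
  + by lra.
  + by rewrite side0; lra.
- split.
    rewrite p'v; apply: arc_seg => E0; have : side x0 = side x1 by rewrite E0.
    have := shift x1; rewrite /x1 /= subrr mulr0 side0; lra.
  move=> z /seg3[z1 z2 zy] zx; rewrite shift.
  have [z2'|z2'] := eqVneq (side z) 2; last by move: z2; rewrite le_eqVlt (negbTE z2') /=; lra.
  case: zx; apply: zeq => //; rewrite z2'; have := shift (k + sg * 1 + sg * 1, 0).
  by rewrite /= subrr mulr0; lra.
split=> [z e eE /(S3z1 _ _ eE)[z1|->] /seg3[z1' _ _]|w /memW[wW|->]//].
- by exfalso; lra.
- by rewrite p'v.
by rewrite p'W// => /seg3[z1 _ _]; exfalso; have := sideW _ wW; lra.
Qed.

Definition left_of (z : pt) := z.1 < 0.
Definition right_of (z : pt) := 1 < z.1.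

Lemma seg01 (y y' : R) z : seg (0, y) (1, y') z ->
  [/\ 0 <= z.1, z.1 <= 1 & z.2 = y + z.1 * (y' - y)].
Proof. by move=> [t t1 ->] /=; split; [lra|lra|ring]. Qed.

Lemma arc_bridge a b (s t : pt -> Prop) (y y' : R) :
  arc a (0, y) s -> (forall z, s z -> z <> (0, y) -> left_of z) ->
  arc b (1, y') t -> (forall z, t z -> z <> (1, y') -> right_of z) ->
  arc a b (fun z => s z \/ (seg (0, y) (1, y') z \/ t z)).
Proof.
move=> sa sl tb tr; apply: (arc_cat sa).
  apply: arc_cat (arc_sym tb) _; first by apply: arc_seg => -[]; lra.
  move=> z /seg01[z0 z1 _] tz; have [//|/eqP zy] := eqVneq z (1, y').
  by exfalso; have := tr _ tz zy; rewrite /right_of; lra.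
move=> z sz; have [//|/eqP zy] := eqVneq z (0, y).
have zl : z.1 < 0 by exact: sl sz zy.
have z1 : seg (0, y) (1, y') z \/ t z -> 0 <= z.1.
  move=> [/seg01[]//|tz]; have [->|/eqP zy'] := eqVneq z (1, y'); first exact: ler01.
  by apply: le_trans (ltW (tr _ tz zy')).
by move=> /z1; rewrite leNgt zl.
Qed.

Definition bridge (s t : pt -> Prop) (y y' : R) z := s z \/ (seg (0, y) (1, y') z \/ t z).

Lemma bridge_edge W1 E1 a p S s y W2 E2 b q T t y' : [disjoint W1 & W2] ->
  stub_drawing W1 E1 a p S s y 1 (0 : R) -> stub_drawing W2 E2 b q T t y' (-1) (1 : R) ->
  let r := glue W1 p q in
  [/\ drawing (W1 :|: W2) (E1 :|: E2) r (glue_edges E1 S T),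
      [/\ a \in W1 :|: W2, b \in W1 :|: W2 & [set a; b]%SET \notin E1 :|: E2],
      arc (r a) (r b) (bridge s t y y'),
      forall w, w \in W1 :|: W2 -> bridge s t y y' (r w) -> w = a \/ w = b
    & forall e z, e \in E1 :|: E2 -> glue_edges E1 S T e z -> bridge s t y y' z ->
        z = r a \/ z = r b].
Proof.
move=> dW [d1 aW [w1 e1] [as1 sl'] [m1 m1']] [d2 bW [w2 e2] [bt tl'] [m2 m2']] r.
have wl w : w \in W1 -> left_of (p w) by move/w1; rewrite /left_of; lra.
have el e z : e \in E1 -> S e z -> left_of z by move=> eE /(e1 _ _ eE); rewrite /left_of; lra.
have wr w : w \in W2 -> right_of (q w) by move/w2; rewrite /right_of; lra.
have er e z : e \in E2 -> T e z -> right_of z by move=> eE /(e2 _ _ eE); rewrite /right_of; lra.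
have sl z : s z -> z <> (0, y) -> left_of z by move=> sz /(sl' _ sz); rewrite /left_of; lra.
have tr z : t z -> z <> (1, y') -> right_of z by move=> tz /(tl' _ tz); rewrite /right_of; lra.
have s0 z : s z -> z.1 <= 0.
  by move=> sz; have [->//|/eqP zy] := eqVneq z (0, y); exact/ltW/(sl _ sz zy).
have t1 z : t z -> 1 <= z.1.
  by move=> tz; have [->//|/eqP zy] := eqVneq z (1, y'); exact/ltW/(tr _ tz zy).
have dis z : left_of z -> right_of z -> False by rewrite /left_of /right_of; lra.
have g1 w : w \in W1 -> glue W1 p q w = p w by rewrite /glue => ->.
have g2 w : w \in W2 -> glue W1 p q w = q w.
  by move=> wW; rewrite /glue (disjointFl dW wW).
have arcA := arc_bridge as1 sl bt tr.
split.
- exact: (drawing_glue d1 d2 dW dis).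
- split; [by rewrite !inE aW|by rewrite !inE bW orbT|].
  rewrite !inE negb_or; apply/andP; split; apply/negP => /edge_sub.
    move/(_ _ _ _ d1)/subsetP/(_ b); rewrite !inE eqxx orbT => /(_ isT) bW1.
    by move: (disjointFr dW bW1); rewrite bW.
  move/(_ _ _ _ d2)/subsetP/(_ a); rewrite !inE eqxx => /(_ isT) aW1.
  by move: (disjointFr dW aW); rewrite aW1.
- by rewrite /r g1// g2.
- move=> w; rewrite !inE => /orP[wW|wW]; rewrite /r ?(g1 _ wW) ?(g2 _ wW).
    have := wl _ wW; rewrite /left_of => pl [/(m1' _ wW)|[/seg01[? _ _]|/t1 ?]]; first by left.
      by exfalso; lra.
    by exfalso; lra.
  have := wr _ wW; rewrite /right_of => pl [/s0 ?|[/seg01[_ ? _]|/(m2' _ wW)]]; last by right.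
    by exfalso; lra.
  by exfalso; lra.
move=> e z; rewrite inE /glue_edges; case: ifP => [eE _ Sz|_ /= eE Tz].
  have := el _ _ eE Sz; rewrite /left_of => pl [sz|[/seg01[? _ _]|/t1 ?]].
  - by left; rewrite /r g1//; apply: (m1 _ e).
  - by exfalso; lra.
  - by exfalso; lra.
have := er _ _ eE Tz; rewrite /right_of => pl [/s0 ?|[/seg01[_ ? _]|tz]].
- by exfalso; lra.
- by exfalso; lra.
by right; rewrite /r g2//; apply: (m2 _ e).
Qed.

Lemma stub_join W1 E1 a p S s y W2 E2 b q T t y' : [disjoint W1 & W2] ->
  stub_drawing W1 E1 a p S s y 1 (0 : R) -> stub_drawing W2 E2 b q T t y' (-1) (1 : R) ->
  exists p' S', drawing (W1 :|: W2) ([set a; b] |: (E1 :|: E2))%SET p' S'.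
Proof.
move=> dW st1 st2; have [d [aW bW nE] arcA Aw Ae] := bridge_edge dW st1 st2.
by eexists; eexists; exact: (drawing_add_edge d aW bW nE arcA Aw Ae).
Qed.

(* The sign condition says that the loose ends appear in the same vertical order on
   both lines, so that the two connecting segments do not cross. *)
Lemma half_join W1 E1 a1 a2 p S s1 s2 y1 y2 W2 E2 b1 b2 q T t1 t2 x1 x2 :
  [disjoint W1 & W2] -> a1 \in W1 -> a2 \in W1 -> b1 \in W2 -> b2 \in W2 ->
  half_drawing W1 E1 a1 a2 p S s1 s2 y1 y2 1 (0 : R) ->
  half_drawing W2 E2 b1 b2 q T t1 t2 x1 x2 (-1) (1 : R) ->
  0 < (y1 - y2) * (x1 - x2) ->
  exists p' S', drawing (W1 :|: W2)
    ([set a1; b1] |: ([set a2; b2] |: (E1 :|: E2)))%SET p' S'.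
Proof.
move=> dW a1W a2W b1W b2W h1 h2 yx.
have st1 := half_stub a1W h1; have st2 := half_stub a2W (half_sym h1).
have st3 := half_stub b1W h2; have st4 := half_stub b2W (half_sym h2).
have ab := half_drawing_neq h1.
have [d [a2' b2' nE2] arc2 Aw2 Ae2] := bridge_edge dW st2 st4.
have [_ [a1' b1' nE1] arc1 Aw1 Ae1] := bridge_edge dW st1 st3.
have d2 := drawing_add_edge d a2' b2' nE2 arc2 Aw2 Ae2.
eexists; eexists; apply: (drawing_add_edge d2 a1' b1' _ arc1 Aw1).
  rewrite in_setU1 negb_or nE1 andbT; apply/eqP => e12.
  have : a1 \in [set a2; b2]%SET by rewrite -e12 !inE eqxx.
  by rewrite !inE => /orP[]/eqP // a1b2; move: (disjointFr dW a1W); rewrite a1b2 b2W.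
move=> e z; rewrite in_setU1 /set_edge; case: eqP => [_ _|_ /= eE]; last exact: Ae1.
have [_ _ [_ _ _] [s1l s2l ss] _] := h1; have [_ _ [_ _ _] [t1r t2r tt] _] := h2.
have sl1 z' : s1 z' -> z' = (0, y1) \/ z'.1 < 0.
  by move=> sz; have [->|/eqP zy] := eqVneq z' (0, y1); [left|right; have := s1l _ sz zy; lra].
have sl2 z' : s2 z' -> z' = (0, y2) \/ z'.1 < 0.
  by move=> sz; have [->|/eqP zy] := eqVneq z' (0, y2); [left|right; have := s2l _ sz zy; lra].
have tl1 z' : t1 z' -> z' = (1, x1) \/ 1 < z'.1.
  by move=> sz; have [->|/eqP zy] := eqVneq z' (1, x1); [left|right; have := t1r _ sz zy; lra].
have tl2 z' : t2 z' -> z' = (1, x2) \/ 1 < z'.1.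
  by move=> sz; have [->|/eqP zy] := eqVneq z' (1, x2); [left|right; have := t2r _ sz zy; lra].
move=> B2 B1; exfalso; move: B2 B1.
case=> [s2z|[g2|t2z]] [s1z|[g1|t1z]].
- exact: (ss z).
- case: (sl2 _ s2z) => [zE|z0]; move: (seg01 g1) => []; last by move: z0; lra.
  by rewrite zE /= => _ _ y12; move: yx; rewrite y12; lra.
- case: (sl2 _ s2z) => [zE|z0]; case: (tl1 _ t1z) => [zE'|z1].
  + by have := congr1 fst zE; rewrite zE' /=; lra.
  + by move: z1; rewrite zE /=; lra.
  + by move: z0; rewrite zE' /=; lra.
  + by move: z0 z1; lra.
- case: (sl1 _ s1z) => [zE|z0]; move: (seg01 g2) => []; last by move: z0; lra.
  by rewrite zE /= => _ _ y12; move: yx; rewrite y12; lra.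
- move: (seg01 g1) (seg01 g2) => [z0 z1 zy] [_ _ zy'].
  set u := z.1 in z0 z1 zy zy'; set P := y1 - y2 in yx; set Q := x1 - x2 in yx.
  have PP : 0 < P * P.
    rewrite -expr2 lt_neqAle sqr_ge0 andbT eq_sym sqrf_eq0; apply/eqP => P0.
    by move: yx; rewrite P0 mul0r ltxx.
  have e0 : P * P * (1 - u) + u * (P * Q) = 0.
    transitivity (P * (P * (1 - u) + u * Q)); first by ring.
    have -> : P * (1 - u) + u * Q = 0 by rewrite /P /Q; lra.
    by rewrite mulr0.
  have [u2|u2] := lerP u (1/2).
    have : P * P * (1/2) <= P * P * (1 - u) by rewrite ler_pM2l//; lra.
    have : 0 <= u * (P * Q) by rewrite mulr_ge0// ltW.
    lra.
  have : 0 < u * (P * Q) by rewrite mulr_gt0//; lra.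
  have : 0 <= P * P * (1 - u) by apply: mulr_ge0; [exact: ltW|lra].
  lra.
- case: (tl1 _ t1z) => [zE|z1]; move: (seg01 g2) => []; last by move: z1; lra.
  by rewrite zE /= => _ _ y12; move: yx; rewrite y12; lra.
- case: (sl1 _ s1z) => [zE|z0]; case: (tl2 _ t2z) => [zE'|z1].
  + by have := congr1 fst zE; rewrite zE' /=; lra.
  + by move: z1; rewrite zE /=; lra.
  + by move: z0; rewrite zE' /=; lra.
  + by move: z0 z1; lra.
- case: (tl2 _ t2z) => [zE|z1]; move: (seg01 g1) => []; last by move: z1; lra.
  by rewrite zE /= => _ _ y12; move: yx; rewrite y12; lra.
exact: (tt z).
Qed.

End Joining.

Section Planarity.
Local Open Scope classical_set_scope.
Local Open Scope ring_scope.
Variable R : realType.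

Definition plane (V : finType) (E : {set {set V}}) : Prop :=
  exists p (S : {set V} -> R * R -> Prop), drawing [set: V]%SET E p S.

Lemma arc_of_path (f : R -> R * R) : {within `[0, 1], continuous f} ->
  {in `[0, 1] &, injective f} ->
  arc (f 0) (f 1) (fun z => exists2 t : R, 0 <= t <= 1 & z = f t).
Proof.
move=> cf fI.
pose cl (t : R) := Num.min 1 (Num.max 0 t).
have cl1 (t : R) : 0 <= t <= 1 -> cl t = t.
  by move=> /andP[t0 t1]; rewrite /cl max_r// min_r.
have cl01 (t : R) : 0 <= cl t <= 1.
  by rewrite /cl le_min ler01 le_max lexx /= ge_min lexx.
have ccl : continuous cl.
  apply: cont_min; first exact: cont_cst.
  by apply: cont_max; [exact: cont_cst|exact: cont_id].
have cfc : continuous (f \o cl).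
  move=> t; have /subspace_continuousP/(_ (cl t)) := cf.
  rewrite /= in_itv/= => /(_ (cl01 t)) fcl.
  apply: (@cvg_comp _ _ _ cl f _ _ _ _ fcl) => B /(ccl t) h.
  have {}h : nbhs t (fun x => `[0, 1]%classic (cl x) -> B (cl x)) := h.
  change (nbhs t (fun x => B (cl x))); apply: filterS h => x; apply.
  by rewrite /= in_itv/=; exact: cl01.
have c1 : continuous (fun t => (f (cl t)).1).
  by move=> t; apply: (cvg_comp _ _ (cfc t)); exact: cvg_fst.
have c2 : continuous (fun t => (f (cl t)).2).
  by move=> t; apply: (cvg_comp _ _ (cfc t)); exact: cvg_snd.
have E (t : R) : 0 <= t <= 1 -> f t = ((f (cl t)).1, (f (cl t)).2).
  by move=> t1; rewrite -surjective_pairing cl1.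
exists (fun t => (f (cl t)).1), (fun t => (f (cl t)).2); split=> //.
- by move=> s t s1 t1 h1 h2; apply: fI; rewrite ?in_itv// E// h1 h2 -E.
- by apply: E; rewrite lexx ler01.
- by apply: E; rewrite lexx ler01.
by move=> z; split=> -[t t1 ->]; exists t => //; rewrite -E.
Qed.

Lemma planar_plane r (G : labelled_graph r) : planar R G -> plane (edges G).
Proof.
move=> [p [a [pI arcs avoid disj]]].
exists p, (fun e z => exists2 t : R, 0 <= t <= 1 & z = a e t).
have cases (t : R) : 0 <= t <= 1 -> [\/ t = 0, t = 1 | t \in `]0, 1[%R].
  move=> /andP[]; rewrite in_itv/= le_eqVlt => /orP[/eqP <-|t0]; first by constructor 1.
  by rewrite le_eqVlt => /orP[/eqP ->|t1]; [constructor 2|constructor 3; rewrite t0].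
have on e t : e \in edges G -> 0 <= t <= 1 ->
    (exists2 w, w \in e & a e t = p w) \/ t \in `]0, 1[%R.
  move=> eE /cases[->|->|]; last (by right);
    have [_ _ [u [v [-> a0 a1]]]] := arcs _ eE; left.
    by exists u; rewrite ?a0// !inE eqxx.
  by exists v; rewrite ?a1// !inE eqxx orbT.
split.
- by move=> u v _ _; apply: pI.
- move=> e eE; have [ce ie [u [v [euv a0 a1]]]] := arcs _ eE.
  by exists u, v; rewrite !inE -a0 -a1; split=> //; apply: arc_of_path.
- move=> e w eE _ [t t1 pw]; have [[w' we' aw']|/(avoid _ w _ eE)] := on e t eE t1.
    by have -> : w = w' by apply: pI; rewrite pw aw'.
  by rewrite -pw.
move=> e f z eE fE ef [s s1 ->] [t t1 st].
have [[w we aw]|s0] := on e s eE s1; first by exists w; rewrite ?inE.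
have [[w wf aw]|t0] := on f t fE t1; first by exists w; rewrite ?inE// st.
by case: (disj e f s t eE fE _ s0 t0 st); apply/eqP.
Qed.

Lemma plane_planar r (G : labelled_graph r) : plane (edges G) -> planar R G.
Proof.
move=> [p [S [pI arcE onE meetE]]].
pose good e (f : R -> R * R) := e \in edges G -> [/\ {within `[0, 1], continuous f},
   {in `[0, 1]%R &, injective f},
   exists u v, [/\ e = [set u; v]%SET, f 0 = p u & f 1 = p v]
   & forall t : R, 0 <= t <= 1 -> S e (f t)].
have /choice[a aP] : forall e, exists f, good e f.
  move=> e; have [eE|eE] := boolP (e \in edges G); last by exists (fun=> 0) => eE'; rewrite eE' in eE.
  have [u [v [_ _ euv [g [h [[cg ch] i pu pv Se]]]]]] := arcE _ eE.
  exists (fun t => (g t, h t)) => _; split.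
  - apply: continuous_subspaceT => t; exact: (cvg_pair (cg t) (ch t)).
  - by move=> s t; rewrite !in_itv/= => s1 t1 [gst hst]; apply: i.
  - by exists u, v; rewrite -pu -pv.
  - by move=> t t1; apply/Se; exists t.
have inn e v (t : R) : e \in edges G -> t \in `]0, 1[%R -> a e t <> p v.
  move=> eE; rewrite in_itv/= => /andP[t0 t1] atv.
  have [ca ia [x [y [exy a0 a1]]] Sa] := aP e eE.
  have t01 : 0 <= t <= 1 by rewrite !ltW.
  have Sv : S e (p v) by rewrite -atv; apply: Sa.
  have : v \in e by apply: onE; rewrite ?inE.
  rewrite exy !inE => /orP[]/eqP vE; move: atv; rewrite vE -?a0 -?a1 => /ia.
    by rewrite !in_itv/= lexx ler01 t01 => /(_ isT isT) t00; move: t0; rewrite t00 ltxx.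
  by rewrite !in_itv/= lexx ler01 t01 => /(_ isT isT) t00; move: t1; rewrite t00 ltxx.
exists p, a; split.
- by move=> u v; apply: pI; rewrite inE.
- by move=> e /aP[].
- exact: inn.
move=> e f s t eE fE ef s1 t1 st.
have [_ _ _ Sa] := aP e eE; have [_ _ _ Sf] := aP f fE.
have s01 : 0 <= s <= 1 by move: s1; rewrite in_itv/= => /andP[? ?]; rewrite !ltW.
have t01 : 0 <= t <= 1 by move: t1; rewrite in_itv/= => /andP[? ?]; rewrite !ltW.
have [|||w _ aw] := meetE e f (a e s) eE fE; [exact/eqP|exact: Sa|by rewrite st; exact: Sf|].
exact: inn aw.
Qed.

End Planarity.

(** * Moves that preserve planarity *)

Section Moves.
Variables (R : realType) (V : finType).
Local Notation pt := (R * R)%type.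
Implicit Types (W : {set V}) (E F : {set {set V}}) (p q : V -> pt) (S T : {set V} -> pt -> Prop).

Definition induced E W := [set e in E | e \subset W].

Lemma plane_sub W E F p S : drawing W E p S -> [set: V] \subset W -> F \subset E ->
  plane R F.
Proof.
move=> dr WT FE; exists p, S; apply: drawing_sub dr WT FE _ => e _.
exact: subsetT.
Qed.

Lemma drawing_induced E p S W : drawing [set: V] E p S -> drawing W (induced E W) p S.
Proof.
move=> dr; apply: (drawing_sub dr (subsetT _)).
  by apply/subsetP => e; rewrite inE => /andP[].
by move=> e; rewrite inE => /andP[].
Qed.

Lemma pair_subset (u v : V) W : ([set u; v] \subset W) = (u \in W) && (v \in W).
Proof. by rewrite subUset !sub1set. Qed.

Lemma arc_bounded x y (A : pt -> Prop) : arc x y A ->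
  exists2 M : R, 0 < M & forall z, A z -> z.1 < M.
Proof.
move=> [g [h [[cg ch] _ _ _ e]]].
have [t] := @EVT_max R g 0 1 ler01 (continuous_subspaceT cg).
rewrite in_itv/= => t1 tm; exists (Num.max 0 (g t) + 1).
  by rewrite ltr_wpDl// le_max lexx.
move=> z /e[s s1 ->] /=; have := tm s; rewrite in_itv/= => /(_ s1) gs.
by rewrite (le_lt_trans gs)// (@le_lt_trans _ _ (Num.max 0 (g t))) ?le_max ?lexx ?orbT// ltrDl.
Qed.

Lemma drawing_bounded W E p S : drawing W E p S -> exists2 M : R, 0 < M &
  (forall w, w \in W -> (p w).1 < M) /\ (forall e z, e \in E -> S e z -> z.1 < M).
Proof.
move=> [_ arcE _ _].
have ok (M r x : R) : 0 < M -> 0 < r -> r <= M^-1 -> x < M -> r * x < 1.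
  move=> M0 r0 rM xM; apply: (@lt_le_trans _ _ (r * M)); first by rewrite ltr_pM2l.
  by rewrite -(@mulVf _ M) ?gt_eqF// ler_pM2r.
have [r1 r10 H1] : exists2 r : R, 0 < r & forall w, w \in enum W ->
    forall r', r' <= r -> 0 < r' -> r' * (p w).1 < 1.
  apply: uniform_gt0 => w _; have M0 : 0 < `|(p w).1| + 1 by rewrite ltr_wpDl.
  exists (`|(p w).1| + 1)^-1 => [|r' r'1 r'0]; first by rewrite invr_gt0.
  by apply: ok M0 r'0 r'1 _; rewrite (le_lt_trans (ler_norm _))// ltrDl.
have [r2 r20 H2] : exists2 r : R, 0 < r & forall e, e \in enum E ->
    forall r', r' <= r -> 0 < r' -> forall z, S e z -> r' * z.1 < 1.
  apply: uniform_gt0 => e; rewrite mem_enum => /arcE[u [v [_ _ _ /arc_bounded[M M0 Mb]]]].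
  exists M^-1; first by rewrite invr_gt0.
  by move=> r' r'1 r'0 z /Mb zM; apply: ok r'1 zM.
pose r := Num.min r1 r2; have r0 : 0 < r by rewrite lt_min r10.
have rr1 : r <= r1 by rewrite ge_min lexx.
have rr2 : r <= r2 by rewrite ge_min lexx orbT.
exists r^-1; first by rewrite invr_gt0.
have fin (x : R) : r * x < 1 -> x < r^-1 by rewrite mulrC -ltr_pdivlMr// mul1r.
by split=> [w wW|e z eE Sz]; apply: fin; [apply: (H1 w); rewrite ?mem_enum|apply: (H2 e); rewrite ?mem_enum].
Qed.

Lemma plane_join_isolated E u v : plane R E -> u != v ->
  (forall e, e \in E -> (u \notin e) && (v \notin e)) -> plane R ([set u; v] |: E).
Proof.
move=> [p [S dr]] uv iso.
pose W := [set~ u] :\ v.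
have dW := drawing_induced W dr.
have [M M0 [Mw Me]] := drawing_bounded dW.
have subW e : e \in E -> e \subset W.
  move=> /iso/andP[ue ve]; apply/subsetP => w we; rewrite !inE.
  by apply/andP; split; apply: contraTneq we => ->.
have disj (x : R) (z : pt) : z.1 < x -> x <= z.1 -> False by move=> h1 h2; move: h1; rewrite ltNge h2.
have addv F U (q : V -> pt) T (x : R) t : drawing U F q T -> t \notin U ->
    (forall w, w \in U -> (q w).1 < x) -> (forall e z, e \in F -> T e z -> z.1 < x) ->
    drawing (U :|: [set t]) F (glue U q (fun=> (x, 0))) (glue_edges F T T).
  move=> dU tU Uw Ue; rewrite -[F in drawing _ F]setU0.
  apply: (drawing_glue dU (drawing_point t (x, 0) T) _ (disj x) Uw Ue).
  - by rewrite disjoint_sym disjoints1.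
  - by move=> w _; exact: lexx.
  - by move=> e z; rewrite inE.
have uW : u \notin W by rewrite !inE eqxx andbF.
have vW : v \notin W :|: [set u] by rewrite !inE eqxx eq_sym (negbTE uv).
have d1 := addv _ _ _ _ _ _ dW uW Mw Me.
set p1 := glue _ _ _ in d1; set S1 := glue_edges _ _ _ in d1.
have p1W w : w \in W -> p1 w = p w by rewrite /p1 /glue => ->.
have p1u : p1 u = (M, 0) by rewrite /p1 /glue (negbTE uW).
have S1E e : S1 e = S e by rewrite /S1 /glue_edges if_same.
have Mw1 w : w \in W :|: [set u] -> (p1 w).1 < M + 1.
  rewrite in_setU in_set1 => /orP[wW|/eqP ->]; last by rewrite p1u /= ltrDl.
  by rewrite p1W// (lt_trans (Mw _ wW))// ltrDl.
have Me1 e z : e \in induced E W -> S1 e z -> z.1 < M + 1.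
  by rewrite S1E => eE Sz; rewrite (lt_trans (Me _ _ eE Sz))// ltrDl.
have d2 := addv _ _ _ _ _ _ d1 vW Mw1 Me1.
set p2 := glue _ _ _ in d2; set S2 := glue_edges _ _ _ in d2.
have p2W w : w \in W :|: [set u] -> p2 w = p1 w by rewrite /p2 /glue => ->.
have uWu : u \in W :|: [set u] by rewrite !inE eqxx orbT.
have p2u : p2 u = (M, 0) by rewrite p2W.
have p2v : p2 v = (M + 1, 0) by rewrite /p2 /glue (negbTE vW).
have S2E e : S2 e = S e by rewrite /S2 /glue_edges if_same S1E.
have onseg z : seg (M, 0) (M + 1, 0) z -> M <= z.1.
  by move=> [t t1 ->] /=; lra.
have d3 : drawing (W :|: [set u] :|: [set v]) ([set u; v] |: induced E W) p2
    (set_edge S2 [set u; v] (seg (M, 0) (M + 1, 0))).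
  apply: drawing_add_edge => //.
  - by rewrite in_setU uWu.
  - by rewrite !inE eqxx orbT.
  - by apply/negP; rewrite inE => /andP[/iso]; rewrite !inE eqxx.
  - by rewrite p2u p2v; apply: arc_seg => -[]; lra.
  - move=> w; rewrite in_setU in_set1 => /orP[wWu|/eqP ->]; last by right.
    move: (wWu); rewrite in_setU in_set1 => /orP[wW|/eqP ->]; last by left.
    by rewrite p2W// p1W// => /onseg/(disj _ _ (Mw _ wW)).
  - by move=> e z eE; rewrite S2E => Sz /onseg/(disj _ _ (Me _ _ eE Sz)).
apply: (plane_sub d3).
  by apply/subsetP => w _; rewrite !inE; case: (w == u); rewrite ?orbT //=; case: (w == v).
by apply: setUS; apply/subsetP => e eE; rewrite inE eE subW.
Qed.

Lemma plane_subdivide E a b v : plane R E -> [set a; b] \in E ->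
  (forall e, e \in E -> v \notin e) ->
  plane R ([set a; v] |: ([set b; v] |: (E :\ [set a; b]))).
Proof.
move=> [p [S dr]] abE iso.
have va : v != a by apply: contraTneq isT => va; have := iso _ abE; rewrite va !inE eqxx.
have vb : v != b by apply: contraTneq isT => vb; have := iso _ abE; rewrite vb !inE eqxx orbT.
have subW e : e \in E -> e \subset [set~ v].
  by move=> /iso ve; apply/subsetP => w we; rewrite !inE; apply: contraTneq we => ->.
have eI : induced E [set~ v] = E.
  by apply/setP => e; rewrite inE; case: (boolP (e \in E)) => //= /subW.
have := drawing_induced [set~ v] dr; rewrite eI => dW.
have [p' [S' [s1 [s2 [y1 [y2 hd]]]]]] := stubs (-2) (mulr1 1) dW abE.
have [||| p2 [S2 [s [y [d2 _ _ _ _]]]]] := stub_apex (v := v) (mulr1 1) hd; rewrite ?inE 1?eq_sym ?eqxx//.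
apply: (plane_sub d2) => //.
by apply/subsetP => w _; rewrite !inE orNb.
Qed.

Lemma plane_move_leaf W E a b v w : plane R E ->
  (forall e, e \in E -> e \subset W \/ e \subset ~: W) ->
  [set a; b] \in E -> a \notin W -> b \notin W -> v \in W -> w \in W ->
  [set w; v] \in E -> (forall e, e \in E -> v \in e -> e = [set w; v]) ->
  plane R ([set a; v] |: ([set b; v] |: (E :\ [set a; b]))).
Proof.
move=> [p [S dr]] cut abE aW bW vW wW wvE only.
have d1 := drawing_induced (~: W) dr; have d2 := drawing_induced W dr.
have abE1 : [set a; b] \in induced E (~: W) by rewrite inE abE pair_subset !inE aW.
have wvE2 : [set w; v] \in induced E W by rewrite inE wvE pair_subset wW.
have [p1 [S1 [s1 [s2 [y1 [y2 h1]]]]]] := stubs (-2) (mulr1 1) d1 abE1.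
have m1 : (-1) * (-1) = 1 :> R by rewrite mulrNN mulr1.
have [p2 [S2 [t1 [t2 [x1 [x2 h2]]]]]] := stubs 1 m1 d2 wvE2.
have wv : w <> v := half_drawing_neq h2.
have vW1 : v \notin ~: W by rewrite !inE vW.
have [||p3 [S3 [s [y st1]]]] := stub_apex (mulr1 1) h1 _ _ vW1; rewrite ?inE//.
have := half_stub wW h2; move=> /(@stub_sub _ _ _ _ (W :\ v) (induced E W :\ [set w; v])) st2.
have {}st2 : stub_drawing (W :\ v) (induced E W :\ [set w; v]) w p2 S2 t1 x1 (-1) 1.
  apply: st2; rewrite ?subD1set// ?subxx//; first by rewrite !inE wW andbT; apply/eqP.
  move=> e; rewrite !inE => /and3P[ewv eE eW]; rewrite subsetD1 eW /=.
  by apply: contra ewv => ve; apply/eqP; exact: only.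
have k0 : -2 + 1 * 1 + 1 * 1 = 0 :> R by lra.
rewrite k0 in st1.
have [|p4 [S4 d4]] := stub_join _ st1 st2.
  rewrite disjoint_sym disjoints_subset; apply/subsetP => x; rewrite !inE negb_or.
  by move=> /andP[-> ->].
apply: (plane_sub d4).
  by apply/subsetP => x _; rewrite !inE; case: (x == v); rewrite ?orbT//= orbF orNb.
apply/subsetP => e; rewrite !inE => /or3P[->|->|/andP[eab eE]]; rewrite ?orbT//.
have [ewv|ewv] := eqVneq e [set w; v]; first by rewrite [[set v; w]]setUC ewv eqxx.
by rewrite eab eE /=; case: (cut _ eE) => ->; rewrite ?orbT.
Qed.

Lemma plane_move_path W E a b u v w x : plane R E ->
  (forall e, e \in E -> e \subset W \/ e \subset ~: W) ->
  [set a; b] \in E -> a \notin W -> b \notin W ->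
  v \in W -> w \in W -> [set u; v] \in E -> [set v; w] \in E -> [set x; w] \in E ->
  u \in W -> x \in W -> u <> w -> u <> x -> x <> v ->
  (forall e, e \in E -> v \in e -> e = [set u; v] \/ e = [set v; w]) ->
  (forall e, e \in E -> w \in e -> e = [set v; w] \/ e = [set x; w]) ->
  plane R ([set a; v] |: ([set b; v] |: ([set u; w] |: (E :\ [set a; b] :\ [set u; v])))).
Proof.
move=> [p [S dr]] cut abE aW bW vW wW uvE vwE xwE uW xW uw ux xv onlyv onlyw.
have d1 := drawing_induced (~: W) dr; have d2 := drawing_induced W dr.
have abE1 : [set a; b] \in induced E (~: W) by rewrite inE abE pair_subset !inE aW.
have vwE2 : [set v; w] \in induced E W by rewrite inE vwE pair_subset wW vW.
have [p1 [S1 [s1 [s2 [y1 [y2 h1]]]]]] := stubs (-2) (mulr1 1) d1 abE1.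
have m1 : (-1) * (-1) = 1 :> R by rewrite mulrNN mulr1.
have [p2 [S2 [t1 [t2 [x1 [x2 h2]]]]]] := stubs 3 m1 d2 vwE2.
have vw : v <> w := half_drawing_neq h2.
have vW1 : v \notin ~: W by rewrite !inE vW.
have [||p3 [S3 [s [y st1]]]] := stub_apex (mulr1 1) h1 _ _ vW1; rewrite ?inE//.
set E2 := induced E W :\ [set v; w] in h2.
have inE2 e : e \in E2 = [&& e != [set v; w], e \in E & e \subset W] by rewrite !inE.
have inp (y1' y2' : V) : y1' \in [set y1'; y2'] /\ y2' \in [set y1'; y2'] by rewrite !inE !eqxx orbT.
have uv_vw : [set u; v] != [set v; w].
  apply/eqP => e; have [h _] := inp u v; move: h; rewrite e !inE => /orP[]/eqP // uv.
  by have := drawing_arc dr uvE; rewrite uv => -[_ _ /arc_neq].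
have xw_vw : [set x; w] != [set v; w].
  apply/eqP => e; have [h _] := inp x w; move: h; rewrite e !inE => /orP[]/eqP // xw.
  by have := drawing_arc dr xwE; rewrite xw => -[_ _ /arc_neq].
have uvE2 : [set u; v] \in E2 by rewrite inE2 uv_vw uvE pair_subset uW.
have onlyv2 e : e \in E2 -> v \in e -> e = [set u; v].
  by rewrite inE2 => /and3P[/eqP evw eE _] /(onlyv _ eE)[].
have wu : w <> u by move=> wu; apply: uw.
have h3 := extend_stub h2 uvE2 wW wu onlyv2.
have xw_uv : [set x; w] != [set u; v].
  apply/eqP => e; have [_ h] := inp x w; move: h; rewrite e !inE => /orP[]/eqP wE.
    by apply: uw.
  by apply: vw.
have xwE3 : [set x; w] \in E2 :\ [set u; v] by rewrite in_setD1 xw_uv inE2 xw_vw xwE pair_subset xW.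
have uw' : u \in W :\ v.
  by rewrite in_setD1 uW andbT; apply/eqP => uv; move: uv_vw; have := drawing_arc dr uvE;
    rewrite uv => -[_ _ /arc_neq].
have onlyw2 e : e \in E2 :\ [set u; v] -> w \in e -> e = [set x; w].
  by rewrite in_setD1 inE2 => /andP[_ /and3P[/eqP evw eE _]] /(onlyw _ eE)[].
have h4 := extend_stub (half_sym h3) xwE3 uw' ux onlyw2.
have wW2 : w \notin W :\ v :\ w by rewrite !inE eqxx.
have xw : x <> w by move=> xw; have := drawing_arc dr xwE; rewrite xw => -[_ _ /arc_neq].
have [||p5 [S5 [s5 [y5 st2]]]] := stub_apex m1 h4 _ _ wW2.
- by rewrite !inE xW andbT; apply/andP; split; apply/eqP.
- by move: uw'; rewrite !inE => -> /=; rewrite andbT; apply/eqP.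
have k0 : -2 + 1 * 1 + 1 * 1 = 0 :> R by lra.
have k1 : 3 + -1 * 1 + -1 * 1 = 1 :> R by lra.
rewrite k0 in st1; rewrite k1 in st2.
have [|p4 [S4 d4]] := stub_join _ st1 st2.
  rewrite -setI_eq0; apply/eqP/setP => z; rewrite !inE.
  have [->|zw] := eqVneq z w; first by rewrite wW eq_sym; case: eqP vw.
  by have [->|zv] := eqVneq z v; rewrite ?andbF//= !orbF andNb.
apply: (plane_sub d4).
  apply/subsetP => z _; rewrite !inE; case: (z == v); rewrite ?orbT//=.
  by case: (z == w); rewrite ?orbT//= !orbF orNb.
apply/subsetP => e; rewrite !inE => /or4P[->|->|->|/and3P[euv eab eE]]; rewrite ?orbT//.
have [->|evw] := eqVneq e [set v; w] => //.
have [->|exw] := eqVneq e [set x; w]; first by rewrite ?eqxx ?orbT.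
by rewrite euv eab eE /=; case: (cut _ eE) => ->; rewrite ?orbT.
Qed.

Lemma plane_switch W E a1 a2 b1 b2 : plane R E ->
  (forall e, e \in E -> e \subset W \/ e \subset ~: W) ->
  [set a1; a2] \in E -> a1 \notin W -> a2 \notin W ->
  [set b1; b2] \in E -> b1 \in W -> b2 \in W ->
  let F := E :\ [set a1; a2] :\ [set b1; b2] in
  plane R ([set a1; b1] |: ([set a2; b2] |: F)) \/
  plane R ([set a1; b2] |: ([set a2; b1] |: F)).
Proof.
move=> [p [S dr]] cut aE a1W a2W bE b1W b2W F.
have d1 := drawing_induced (~: W) dr; have d2 := drawing_induced W dr.
have aE1 : [set a1; a2] \in induced E (~: W) by rewrite inE aE pair_subset !inE a1W.
have bE2 : [set b1; b2] \in induced E W by rewrite inE bE pair_subset b1W.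
have [p1 [S1 [s1 [s2 [y1 [y2 h1]]]]]] := stubs 0 (mulr1 1) d1 aE1.
have m1 : (-1) * (-1) = 1 :> R by rewrite mulrNN mulr1.
have [p2 [S2 [t1 [t2 [x1 [x2 h2]]]]]] := stubs 1 m1 d2 bE2.
have [_ _ [_ _ y12] _ _] := h1; have [_ _ [_ _ x12] _ _] := h2.
have dW : [disjoint ~: W & W] by rewrite disjoint_sym disjoints_subset setCK.
have a1W' : a1 \in ~: W by rewrite inE.
have a2W' : a2 \in ~: W by rewrite inE.
have FE : F \subset (induced E (~: W) :\ [set a1; a2]) :|: (induced E W :\ [set b1; b2]).
  apply/subsetP => e; rewrite !inE => /and3P[-> -> eE]; rewrite eE /=.
  by case: (cut _ eE) => ->; rewrite ?orbT.
have WT : [set: V] \subset ~: W :|: W by rewrite setUC setUCr.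
have fin c1 c2 : (exists p' S', drawing (~: W :|: W) ([set a1; c1] |: ([set a2; c2] |:
    ((induced E (~: W) :\ [set a1; a2]) :|: (induced E W :\ [set b1; b2])))) p' (S' : _ -> pt -> Prop)) ->
    plane R ([set a1; c1] |: ([set a2; c2] |: F)).
  by move=> [p' [S' d']]; apply: (plane_sub d' WT); rewrite !setUS.
have : (y1 - y2) * (x1 - x2) != 0 by rewrite mulf_eq0 !subr_eq0 negb_or; apply/andP; split; apply/eqP.
rewrite neq_lt => /orP[neg|pos]; [right|left]; apply: fin.
  by apply: (half_join dW a1W' a2W' b2W b1W h1 (half_sym h2)); lra.
exact: (half_join dW a1W' a2W' b1W b2W h1 h2 pos).
Qed.

End Moves.

(** * Connected components *)

Section Components.
Local Open Scope nat_scope.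
Variable V : finType.
Implicit Types (E F T : {set {set V}}) (x y z u v : V).

Definition simple E := [forall e in E, #|e| == 2].
Definition eadj E : rel V := fun u v => [set u; v] \in E.
Definition conn E := connect (eadj E).
Definition component E x := [set y | conn E x y].
Definition components E := [set component E x | x : V].

Lemma simpleP E : reflect (forall e, e \in E -> #|e| = 2) (simple E).
Proof.
by apply: (iffP forall_inP) => h e /h => [/eqP|->].
Qed.

Lemma simple_pair E (e : {set V}) : simple E -> e \in E -> exists p q, p != q /\ e = [set p; q].
Proof.
move=> /simpleP sE /sE/eqP/cards2P[p [q [pq eE]]].
by exists p, q.
Qed.

Lemma eadj_sym E : symmetric (eadj E).
Proof. by move=> u v; rewrite /eadj setUC. Qed.

Lemma conn_sym E x y : conn E x y = conn E y x.
Proof. exact: (sym_connect_sym (@eadj_sym E)). Qed.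

Lemma conn_refl E x : conn E x x.
Proof. exact: connect0. Qed.

Lemma conn_trans E y x z : conn E x y -> conn E y z -> conn E x z.
Proof. exact: connect_trans. Qed.

Lemma conn_edge E x y : [set x; y] \in E -> conn E x y.
Proof. exact: connect1. Qed.

Lemma conn_ind E (r : V -> V -> Prop) : (forall x, r x x) ->
  (forall x y z, eadj E x y -> r y z -> r x z) -> forall x y, conn E x y -> r x y.
Proof.
move=> r0 rS x y /connectP[p]; elim: p x => [|z p IH] x /=; first by move=> _ ->.
by move=> /andP[xz zp] yl; apply: rS xz _; apply: IH.
Qed.

Lemma conn_mono E F : (forall x y, eadj E x y -> conn F x y) ->
  forall x y, conn E x y -> conn F x y.
Proof.
move=> EF; apply: conn_ind => [x|x y z /EF]; first exact: conn_refl.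
exact: conn_trans.
Qed.

Lemma conn_subset E F x y : E \subset F -> conn E x y -> conn F x y.
Proof. by move=> /subsetP EF; apply: conn_mono => u v /EF; exact: conn_edge. Qed.

Lemma component_eq E x y : conn E x y -> component E x = component E y.
Proof.
move=> xy; apply/setP => z; rewrite !inE; apply/idP/idP => h.
  by apply: conn_trans h; rewrite conn_sym.
exact: conn_trans h.
Qed.

Lemma component_refl E x : x \in component E x.
Proof. by rewrite inE conn_refl. Qed.

Lemma componentP E A : reflect (exists x, A = component E x) (A \in components E).
Proof.
by apply: (iffP imsetP) => [[x _ ->]|[x ->]]; exists x.
Qed.

Lemma component_mem E A x : A \in components E -> x \in A -> A = component E x.
Proof. by move=> /componentP[y ->]; rewrite inE; apply: component_eq. Qed.

Lemma components_merge E F a b : ~~ conn E a b ->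
  (forall x y, eadj E x y -> conn F x y) ->
  (forall x y, eadj F x y -> conn E x y \/
     (conn E a x || conn E b x) && (conn E a y || conn E b y)) ->
  conn F a b -> #|components E| = #|components F|.+1.
Proof.
move=> nab EF FE ab.
set M := component E a :|: component E b.
have inM x : (x \in M) = conn E a x || conn E b x by rewrite !inE.
have aM : a \in M by rewrite inM conn_refl.
have bM : b \in M by rewrite inM conn_refl orbT.
have closedM x y : conn E x y -> x \in M -> y \in M.
  rewrite !inM => xy /orP[ax|bx]; first by rewrite (conn_trans ax xy).
  by rewrite (conn_trans bx xy) orbT.
have connE x y : conn F x y <-> conn E x y \/ (x \in M /\ y \in M).
  split.
    apply: (@conn_ind F (fun x y => conn E x y \/ (x \in M /\ y \in M))) => [{}x|{x y}x y z].
      by left; exact: conn_refl.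
    move=> /FE[xy|/andP[]]; rewrite -?inM.
      case=> [yz|[yM zM]]; first by left; exact: conn_trans yz.
      by right; split=> //; apply: closedM yM; rewrite conn_sym.
    by move=> xM yM [yz|[_ zM]]; right; split=> //; apply: closedM yz yM.
  have EFc := conn_mono EF.
  case=> [/EFc//|]; rewrite !inM.
  have toa z : conn E a z || conn E b z -> conn F a z.
    by case/orP => /EFc // bz; apply: conn_trans bz.
  by move=> [/toa ax /toa ay]; apply: conn_trans ay; rewrite conn_sym.
have compM x : x \in M -> component F x = M.
  move=> xM; apply/setP => y; rewrite inE; apply/idP/idP.
    by move/connE => [/closedM/(_ xM)|[]].
  by move=> yM; apply/connE; right.
have compN x : x \notin M -> component F x = component E x.
  move=> xM; apply/setP => y; rewrite !inE; apply/idP/idP.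
    by move/connE => [//|[]]; rewrite (negbTE xM).
  by move=> xy; apply/connE; left.
pose A := component E a; pose B := component E b.
have AE : A \in components E by apply/componentP; exists a.
have BE : B \in components E by apply/componentP; exists b.
have AB : B != A.
  apply: contra nab => /eqP AB; have : b \in A by rewrite -AB component_refl.
  by rewrite inE.
have FEq : components F = M |: (components E :\ A :\ B).
  apply/setP => D; rewrite !inE; apply/idP/idP.
    move=> /componentP[x ->]; have [xM|xM] := boolP (x \in M).
      by rewrite compM// eqxx.
    rewrite compN//; apply/orP; right; apply/and3P; split.
    - apply: contra xM => /eqP xB; have : x \in B by rewrite -xB component_refl.
      by rewrite inM inE => ->; rewrite orbT.
    - apply: contra xM => /eqP xA; have : x \in A by rewrite -xA component_refl.
      by rewrite inM inE => ->.
    - by apply/componentP; exists x.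
  case/orP => [/eqP ->|/and3P[DB DA /componentP[x Dx]]].
    by apply/componentP; exists a; rewrite compM.
  apply/componentP; exists x; rewrite compN ?Dx// inM negb_or.
  by apply/andP; split; [apply: contra DA|apply: contra DB] => xx; rewrite Dx; apply/eqP;
    apply: component_eq; rewrite conn_sym.
have BEA : B \in components E :\ A by rewrite in_setD1 AB.
have nM : M \notin components E :\ A :\ B.
  apply/negP; rewrite !in_setD1 => /and3P[_ MA ME].
  have MA' : M = A by apply: component_mem ME aM.
  by rewrite MA' eqxx in MA.
by rewrite FEq cardsU1 nM (cardsD1 A) AE (cardsD1 B (components E :\ A)) BEA.
Qed.

End Components.

Section Merging.
Local Open Scope nat_scope.
Variable V : finType.
Implicit Types (E F T : {set {set V}}) (e f g : {set V}) (x y z u v a b : V).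

Lemma set2_eq x y u v : [set x; y] = [set u; v] -> x = u /\ y = v \/ x = v /\ y = u.
Proof.
move=> e.
have : x \in [set u; v] by rewrite -e !inE eqxx.
have : y \in [set u; v] by rewrite -e !inE eqxx orbT.
have : u \in [set x; y] by rewrite e !inE eqxx.
have : v \in [set x; y] by rewrite e !inE eqxx orbT.
rewrite !inE => vxy uxy /orP[]/eqP yE /orP[]/eqP xE; subst x y; auto.
  by move: vxy; rewrite orbb => /eqP ->; left.
by move: uxy; rewrite orbb => /eqP ->; left.
Qed.

Lemma conn_setD1 T f x y : conn T x y ->
  conn (T :\ f) x y \/ exists2 z, z \in f & conn (T :\ f) x z.
Proof.
move=> xy; have [|nxy] := boolP (conn (T :\ f) x y); [by left|right; move: xy nxy].
move: x y; apply: conn_ind => [x|x y z xy IH nxz]; first by rewrite conn_refl.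
have [fE|fE] := eqVneq [set x; y] f; first by exists x; rewrite ?conn_refl// -fE !inE eqxx.
have xy' : conn (T :\ f) x y by apply: conn_edge; rewrite in_setD1 fE.
have [|t tf yt] := IH; first by apply: contra nxz; exact: conn_trans.
by exists t => //; exact: conn_trans yt.
Qed.

Lemma conn_setD1_far T f x y z : z \in f -> f \in T -> simple T -> ~~ conn T x z -> conn T x y ->
  conn (T :\ f) x y.
Proof.
move=> zf fT sT xz /(@conn_setD1 T f)[//|[t tf xt]].
case/negP: xz; apply: (@conn_trans _ _ t).
  by apply: conn_subset xt; exact: subD1set.
have [p [q [_ fE]]] := simple_pair sT fT.
have pq : conn T p q by apply: conn_edge; rewrite -fE.
move: tf zf; rewrite fE !inE => /orP[]/eqP -> /orP[]/eqP -> //; rewrite ?conn_refl//.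
by rewrite conn_sym.
Qed.

Lemma merge_edge E u v : ~~ conn E u v ->
  #|components E| = #|components ([set u; v] |: E)|.+1.
Proof.
move=> uv; apply: (components_merge uv).
- by move=> x y xy; apply: conn_edge; rewrite in_setU1 (xy : _ \in E) orbT.
- move=> x y; rewrite /eadj in_setU1 => /orP[/eqP/set2_eq[] [-> ->]|/conn_edge]; last by left.
    by right; rewrite !conn_refl orbT.
  by right; rewrite !conn_refl orbT.
by apply: conn_edge; rewrite setU11.
Qed.

Lemma merge_subdivide E a b v : [set a; b] \in E -> ~~ conn E a v ->
  #|components E| = #|components ([set a; v] |: ([set b; v] |: (E :\ [set a; b])))|.+1.
Proof.
move=> abE av; set F := _ |: _.
have Fa : conn F a v by apply: conn_edge; rewrite !inE eqxx.
have Fb : conn F b v by apply: conn_edge; rewrite !inE eqxx orbT.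
have Fab : conn F a b by apply: conn_trans Fa _; rewrite conn_sym.
apply: (components_merge av) => //.
- move=> x y xy; have [/set2_eq[] [-> ->]//|xyab] := eqVneq [set x; y] [set a; b].
    by rewrite conn_sym.
  by apply: conn_edge; rewrite !inE xyab; move: xy; rewrite /eadj => ->; rewrite !orbT.
have ab := conn_edge abE.
move=> x y; rewrite /eadj !inE => /or3P[/eqP/set2_eq[] [-> ->]|/eqP/set2_eq[] [-> ->]|/andP[_ /conn_edge]];
  by rewrite ?ab ?conn_refl ?orbT; auto.
Qed.

Lemma merge_path E a b u v w : [set a; b] \in E -> ~~ conn E a v ->
  [set u; v] \in E -> [set v; w] \in E -> u != w ->
  #|components E| = #|components ([set a; v] |: ([set b; v] |: ([set u; w] |:
      (E :\ [set a; b] :\ [set u; v]))))|.+1.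
Proof.
move=> abE av uvE vwE uw; set F := _ |: _.
have ab := conn_edge abE; have uv := conn_edge uvE; have vw := conn_edge vwE.
have Fa : conn F a v by apply: conn_edge; rewrite !inE eqxx.
have Fb : conn F b v by apply: conn_edge; rewrite !inE eqxx orbT.
have Fab : conn F a b by apply: conn_trans Fa _; rewrite conn_sym.
have Fuw : conn F u w by apply: conn_edge; rewrite !inE eqxx !orbT.
have vw_ab : [set v; w] != [set a; b].
  apply: contra av => /eqP/set2_eq[] [-> _]; [exact: conn_refl|exact: ab].
have vw_uv : [set v; w] != [set u; v].
  by apply: contra uw => /eqP/set2_eq[[<- ->]|[_ ->]].
have Fvw : conn F v w by apply: conn_edge; rewrite !inE vwE vw_ab vw_uv !orbT.
have Fuv : conn F u v by apply: conn_trans Fuw _; rewrite conn_sym.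
apply: (components_merge av) => //.
- move=> x y xy; have [/set2_eq[] [-> ->]//|xyab] := eqVneq [set x; y] [set a; b].
    by rewrite conn_sym.
  have [/set2_eq[] [-> ->]//|xyuv] := eqVneq [set x; y] [set u; v].
    by rewrite conn_sym.
  by apply: conn_edge; rewrite !inE xyab xyuv; move: xy; rewrite /eadj => ->; rewrite !orbT.
move=> x y; rewrite /eadj !inE => /or4P[/eqP/set2_eq[] [-> ->]|/eqP/set2_eq[] [-> ->]|/eqP/set2_eq[] [-> ->]|/and3P[_ _ /conn_edge]];
  rewrite ?ab ?conn_refl ?orbT; auto.
- by left; apply: conn_trans uv vw.
by left; rewrite conn_sym; apply: conn_trans uv vw.
Qed.

Lemma merge_switch E a1 a2 b1 b2 : simple E -> [set a1; a2] \in E -> [set b1; b2] \in E ->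
  ~~ conn E a1 b1 -> conn (E :\ [set a1; a2]) a1 a2 -> conn (E :\ [set b1; b2]) b1 b2 ->
  #|components E| = #|components ([set a1; b1] |: ([set a2; b2] |:
      (E :\ [set a1; a2] :\ [set b1; b2])))|.+1.
Proof.
move=> sE aE bE ab na nb; set F := _ |: _.
have a12 := conn_edge aE; have b12 := conn_edge bE.
have sD T e : simple T -> simple (T :\ e).
  by move=> /simpleP sT; apply/simpleP => f /setD1P[_ /sT].
have sub : E :\ [set a1; a2] :\ [set b1; b2] \subset F.
  by apply/subsetP => e eE; rewrite !in_setU1 eE !orbT.
have e_ne : [set a1; a2] != [set b1; b2].
  apply: contra ab => /eqP/set2_eq[] [-> _]; first exact: conn_refl.
  by rewrite conn_sym.
have Fa : conn F a1 a2.
  apply: (conn_subset sub); apply: (conn_setD1_far _ _ _ _ na (z := b1)).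
  - by rewrite !inE eqxx.
  - by rewrite in_setD1 eq_sym e_ne.
  - exact: sD.
  - by apply: contra ab; apply: conn_subset; exact: subD1set.
have Fb : conn F b1 b2.
  apply: (conn_subset sub).
  have -> : E :\ [set a1; a2] :\ [set b1; b2] = E :\ [set b1; b2] :\ [set a1; a2].
    by rewrite !setDDl setUC.
  apply: (conn_setD1_far _ _ _ _ nb (z := a1)).
  - by rewrite !inE eqxx.
  - by rewrite in_setD1 e_ne.
  - exact: sD.
  - by rewrite conn_sym; apply: contra ab; apply: conn_subset; exact: subD1set.
apply: (components_merge ab); last by apply: conn_edge; rewrite setU11.
- move=> x y xy; have [/set2_eq[] [-> ->]//|xya] := eqVneq [set x; y] [set a1; a2].
    by rewrite conn_sym.
  have [/set2_eq[] [-> ->]//|xyb] := eqVneq [set x; y] [set b1; b2].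
    by rewrite conn_sym.
  by apply: conn_edge; rewrite !inE xya xyb; move: xy; rewrite /eadj => ->; rewrite !orbT.
move=> x y; rewrite /eadj !inE => /or3P[/eqP/set2_eq[] [-> ->]|/eqP/set2_eq[] [-> ->]|/and3P[_ _ /conn_edge]];
  by rewrite ?a12 ?b12 ?conn_refl ?orbT; auto.
Qed.

End Merging.

(** * Spanning forests and 2-edge-cuts *)

Section Spanning.
Local Open Scope nat_scope.
Variable V : finType.
Implicit Types (E F T : {set {set V}}) (e f g : {set V}) (x y z u v a b p q : V).

Definition forest F := forall p q, [set p; q] \in F -> ~~ conn (F :\ [set p; q]) p q.

Lemma conn0 x y : conn set0 x y = (x == y).
Proof.
apply/idP/eqP => [|->]; last exact: conn_refl.
by move: x y; apply: conn_ind => // x y z; rewrite /eadj inE.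
Qed.

Lemma simple_sub E F : F \subset E -> simple E -> simple F.
Proof. by move=> /subsetP FE /simpleP sE; apply/simpleP => e /FE/sE. Qed.

Lemma forest_sub F T : T \subset F -> forest F -> forest T.
Proof.
move=> TF fF p q pq; apply: contra (fF p q (subsetP TF _ pq)).
by apply: conn_subset; exact: setSD.
Qed.

Lemma forest_card F : simple F -> forest F -> #|F| + #|components F| = #|V|.
Proof.
elim: {F}_.+1 {-2}F (ltnSn #|F|) => // n IH F Fn sF fF.
have [->|/set0Pn[e eF]] := eqVneq F set0.
  rewrite cards0 add0n /components card_imset ?cardsT// => x y.
  by move/setP/(_ y); rewrite !inE !conn0 eqxx => /eqP.
have [p [q [_ eE]]] := simple_pair sF eF; rewrite eE in eF.
have sub : F :\ e \subset F := subD1set _ _.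
have := IH (F :\ [set p; q]); rewrite (merge_edge (fF _ _ eF)) setD1K// => IH'.
rewrite (cardsD1 [set p; q] F) eF add1n addSnnS IH'//.
- by rewrite -ltnS (leq_trans _ Fn)// [#|F|](cardsD1 [set p; q]) eF.
- by apply: simple_sub sF; exact: subD1set.
- by apply: forest_sub fF; exact: subD1set.
Qed.

Definition inside F (A : {set V}) := [set e in F | e \subset A].

Lemma forest_inside F A : simple F -> forest F -> A != set0 -> #|inside F A| < #|A|.
Proof.
move=> sF fF /set0Pn[a aA].
have sub : inside F A \subset F by apply/subsetP => e; rewrite inE => /andP[].
have := forest_card (simple_sub sub sF) (forest_sub sub fF).
set T := inside F A => TV.
have single x : x \notin A -> component T x = [set x].
  move=> xA; apply/setP => y; rewrite !inE; apply/idP/eqP => [xy|->]; last exact: conn_refl.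
  move: x y xy xA; apply: (@conn_ind _ T (fun x y => x \notin A -> y = x)) => // x y z.
  rewrite /eadj !inE => /andP[_ /subsetP xyA] _ /negP[].
  by apply: xyA; rewrite !inE eqxx.
have cA : component T a \notin [set [set x] | x in ~: A].
  apply/imsetP => -[x]; rewrite inE => xA cx; case/negP: xA.
  by have := component_refl T a; rewrite cx inE => /eqP <-.
have : #|component T a |: [set [set x] | x in ~: A]| <= #|components T|.
  apply/subset_leq_card/subsetP => D; rewrite in_setU1 => /orP[/eqP ->|/imsetP[x]].
    by apply/componentP; exists a.
  by rewrite inE => /single cx ->; apply/componentP; exists x.
rewrite cardsU1 cA add1n card_imset; last exact: set1_inj.
have := cardsC A; lia.
Qed.

Definition spanning E T := T \subset E /\ (forall x y, conn E x y -> conn T x y).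

Lemma spanning_forest E : simple E -> exists2 T, spanning E T & forest T.
Proof.
elim: {E}_.+1 {-2}E (ltnSn #|E|) => // n IH E En sE.
have [/forallP fE|] := boolP [forall p, forall q, ([set p; q] \in E) ==>
    ~~ conn (E :\ [set p; q]) p q].
  exists E; first by split=> //; exact: subxx.
  by move=> p q pq; have /forallP/(_ q)/implyP := fE p; apply.
rewrite negb_forall => /existsP[p]; rewrite negb_forall => /existsP[q].
rewrite negb_imply negbK => /andP[pqE pq].
have [||T [TE cT] fT] := IH (E :\ [set p; q]).
- by rewrite -ltnS (leq_trans _ En)// [#|E|](cardsD1 [set p; q]) pqE.
- by apply: simple_sub sE; exact: subD1set.
exists T => //; split; first exact: subset_trans TE (subD1set _ _).
move=> x y xy; apply: cT; move: x y xy; apply: conn_mono => x y xy.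
have [/set2_eq[] [-> ->]//|nxy] := eqVneq [set x; y] [set p; q].
  by rewrite conn_sym.
by apply: conn_edge; rewrite in_setD1 nxy.
Qed.

Definition linked T e := [forall p in e, forall q in e, conn T p q].
Definition nonbridge E e := linked (E :\ e) e.
(* For a nonbridge e, the edges f such that {e, f} is a 2-edge-cut. *)
Definition cut_partners E e := [set f in E :\ e | ~~ linked (E :\ e :\ f) e].

Lemma linked2 T p q : linked T [set p; q] = conn T p q.
Proof.
apply/forall_inP/idP => [h|pq x].
  by apply: (forall_inP (h p _)); rewrite !inE eqxx ?orbT.
rewrite !inE => /orP[]/eqP ->; apply/forall_inP => y; rewrite !inE => /orP[]/eqP ->;
  by rewrite ?conn_refl// conn_sym.
Qed.

Lemma linkedE T e p q : e = [set p; q] -> linked T e = conn T p q.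
Proof. by move=> ->; exact: linked2. Qed.

Lemma linked_subset E F e : E \subset F -> linked E e -> linked F e.
Proof.
move=> EF /forall_inP h; apply/forall_inP => p pe; apply/forall_inP => q qe.
by apply: conn_subset EF _; apply: (forall_inP (h p pe)).
Qed.

Section Partners.
Variables (E T : {set {set V}}).
Hypotheses (sE : simple E) (spanT : spanning E T).

Lemma nontree_nonbridge e : e \in E -> e \notin T -> nonbridge E e.
Proof.
move=> eE eT; have [p [q [_ pq]]] := simple_pair sE eE.
rewrite /nonbridge (linkedE _ pq); apply: (@conn_subset _ T).
  by rewrite subsetD1 eT andbT; case: spanT.
by case: spanT => _; apply; apply: conn_edge; rewrite -pq.
Qed.

(* Without f the forest separates the ends of e, so e reconnects the two sides. *)
Lemma partner_facts e f : e \in E -> e \notin T -> f \in cut_partners E e ->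
  [/\ f \in T, f != e, ~~ linked (E :\ e :\ f) f &
   forall x y p q, f = [set x; y] -> e = [set p; q] ->
     conn (T :\ f) p x /\ conn (T :\ f) q y \/ conn (T :\ f) p y /\ conn (T :\ f) q x].
Proof.
move=> eE eT; rewrite !inE => /andP[/andP[fe fE] nl].
have [TE cT] := spanT.
have TsubE : T :\ f \subset E :\ e :\ f.
  by apply: setSD; rewrite subsetD1 TE eT.
have [p0 [q0 [_ epq]]] := simple_pair sE eE.
have [x0 [y0 [_ fxy]]] := simple_pair sE fE.
have cTe p q : e = [set p; q] -> conn T p q.
  by move=> e2; apply: cT; apply: conn_edge; rewrite -e2.
have nTf p q : e = [set p; q] -> ~~ conn (T :\ f) p q.
  by move=> e2; apply: contra nl => pq; rewrite (linkedE _ e2); apply: conn_subset TsubE _.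
split=> //.
- apply: contraR nl => fT; apply: (@linked_subset T); last by rewrite epq linked2 cTe.
  by rewrite !subsetD1 TE eT fT.
- apply: contra nl; rewrite (linkedE _ fxy) (linkedE _ epq) => xy.
  have := cTe _ _ epq; apply: conn_mono => u v uv.
  have [uvf|nuv] := eqVneq [set u; v] f.
    by move: uvf; rewrite {1}fxy => /set2_eq[] [-> ->] //; rewrite conn_sym.
  by apply: conn_edge; apply: (subsetP TsubE); rewrite in_setD1 nuv.
move=> x y p q fE' eE'.
have pq := cTe _ _ eE'; have npq := nTf _ _ eE'.
have [h|[z zf pz]] := conn_setD1 f pq; first by rewrite h in npq.
have qp : conn T q p by rewrite conn_sym.
have [h|[t tf qt]] := conn_setD1 f qp; first by rewrite conn_sym h in npq.
have ne : z != t.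
  by apply: contra npq => /eqP zt; rewrite (conn_trans pz)// zt conn_sym.
move: zf tf pz qt ne; rewrite fE' !inE => /orP[]/eqP -> /orP[]/eqP ->; rewrite ?eqxx//; auto.
Qed.

Lemma partner_inj e e' f : e \in E -> e \notin T -> e' \in E -> e' \notin T ->
  f \in cut_partners E e -> f \in cut_partners E e' -> e = e'.
Proof.
move=> eE eT e'E e'T fe fe'.
have [fT fne _ h] := partner_facts eE eT fe.
have [_ fne' nl' _] := partner_facts e'E e'T fe'.
have [TE _] := spanT.
apply/eqP; apply: contraR nl' => ee'.
have [x [y [_ fxy]]] := simple_pair sE (subsetP TE _ fT).
have [p [q [_ epq]]] := simple_pair sE eE.
have sub : T :\ f \subset E :\ e' :\ f.
  by apply: setSD; rewrite subsetD1 TE e'T.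
have pq : conn (E :\ e' :\ f) p q.
  by apply: conn_edge; rewrite !in_setD1 -epq ee' eE eq_sym fne.
rewrite (linkedE _ fxy).
have [[px qy]|[py qx]] := h _ _ _ _ fxy epq.
  apply: conn_trans (conn_subset sub qy).
  by apply: conn_trans pq; rewrite conn_sym; apply: conn_subset px.
apply: conn_trans (conn_subset sub py).
rewrite conn_sym; apply: conn_trans pq _; exact: conn_subset sub qx.
Qed.

Lemma partner_inside e f a : e \in E -> e \notin T -> f \in cut_partners E e ->
  e \subset component E a -> f \subset component E a.
Proof.
move=> eE eT fe ea; have [fT _ _ h] := partner_facts eE eT fe.
have [TE _] := spanT.
have [x [y [_ fxy]]] := simple_pair sE (subsetP TE _ fT).
have [p [q [_ epq]]] := simple_pair sE eE.
have xy : conn E x y by apply: conn_edge; rewrite -fxy (subsetP TE).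
have ap : conn E a p.
  by have /subsetP/(_ p) := ea; rewrite epq !inE eqxx => /(_ isT).
have sub : T :\ f \subset E := subset_trans (subD1set _ _) TE.
have ax : conn E a x.
  have [[px _]|[py _]] := h _ _ _ _ fxy epq.
    by apply: conn_trans ap (conn_subset sub px).
  apply: conn_trans ap _; apply: conn_trans (conn_subset sub py) _.
  by rewrite conn_sym.
apply/subsetP => z; rewrite fxy !inE => /orP[]/eqP -> //.
exact: conn_trans ax xy.
Qed.

Lemma card_dep (I J : finType) (P : pred I) (Q : I -> pred J) :
  #|[set x : I * J | P x.1 && Q x.1 x.2]| = \sum_(i | P i) #|[set j | Q i j]|.
Proof.
rewrite -sum1_card (eq_bigl (fun x : I * J => P x.1 && Q x.1 x.2)); last first.
  by move=> x; rewrite inE.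
rewrite -(pair_big_dep P Q (fun _ _ => 1)) /=.
by apply: eq_bigr => i _; rewrite -sum1_card; apply: eq_bigl => j; rewrite inE.
Qed.

Lemma sum_partners a : \sum_(e in inside E (component E a) :\: T) #|cut_partners E e|
  <= #|inside T (component E a)|.
Proof.
set A := component E a; set D := inside E A :\: T.
have inD e : e \in D -> [/\ e \in E, e \notin T & e \subset A].
  by rewrite !inE => /andP[eT /andP[]].
have -> : \sum_(e in D) #|cut_partners E e| =
    #|[set x : {set V} * {set V} | (x.1 \in D) && (x.2 \in cut_partners E x.1)]|.
  rewrite (card_dep (fun e => e \in D) (fun e f => f \in cut_partners E e)).
  by apply: eq_bigr => e _; apply: eq_card => f; rewrite [RHS]inE.
have inP e f : (e, f) \in [set x : {set V} * {set V} | (x.1 \in D) && (x.2 \in cut_partners E x.1)] ->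
    e \in D /\ f \in cut_partners E e by rewrite inE => /andP[].
rewrite -(@card_in_imset _ _ snd); last first.
  move=> [e f] [e' f'] /inP[/inD[h1 h2 _] h3] /inP[/inD[h4 h5 _] h6] /= ff.
  by subst f'; congr (_, _); apply: (partner_inj h1 h2 h4 h5 h3 h6).
apply/subset_leq_card/subsetP => g /imsetP[[e f] /inP[/inD[h1 h2 h3] h4] ->] /=.
by rewrite inE; have [-> _ _ _] := partner_facts h1 h2 h4; exact: (partner_inside h1 h2 h4).
Qed.

End Partners.

(* The bound 56 is twice the threshold 28 for few edges outside the forest. *)
Definition small E e := [&& e \in E, nonbridge E e & #|cut_partners E e| < 56].

Lemma small_count E T a : simple E -> spanning E T -> forest T ->
  let A := component E a in
  #|A| <= 28 * #|inside E A :\: T| -> #|A| <= 56 * #|[set e in inside E A | small E e]|.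
Proof.
move=> sE sT fT A nt.
have [TE _] := sT.
have TA : #|inside T A| < #|A|.
  apply: forest_inside fT _; first exact: simple_sub TE sE.
  by apply/set0Pn; exists a; exact: component_refl.
have := sum_partners sE sT a; rewrite -/A.
set D := inside E A :\: T in nt * => sumD.
pose B := [set e in D | 56 <= #|cut_partners E e|].
have BD e : (e \in B) = (e \in D) && (56 <= #|cut_partners E e|) by rewrite inE.
have B56 : 56 * #|B| <= #|A|.
  apply: leq_trans (ltnW TA); apply: leq_trans sumD.
  rewrite mulnC -sum_nat_const [X in _ <= X](bigID (fun e => e \in B)) /=.
  rewrite [X in _ <= X + _](eq_bigl (fun e => e \in B)); last by move=> e; rewrite BD andbA andbb.
  apply: leq_trans (leq_addr _ _); apply: leq_sum => e.
  by rewrite BD => /andP[].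
have DB : D \subset [set e in inside E A | small E e] :|: B.
  apply/subsetP => e eD; rewrite in_setU; apply/orP.
  have [eB|eB] := boolP (e \in B); [by right|left].
  move: (eD); rewrite in_setD => /andP[eT eA].
  have eE : e \in E by move: eA; rewrite inE => /andP[].
  rewrite inE eA /small eE /= (nontree_nonbridge sE sT)//=.
  by move: eB; rewrite BD eD /= -ltnNge.
have := subset_leq_card DB; have [] := leq_card_setU [set e in inside E A | small E e] B.
lia.
Qed.

End Spanning.

(** * Counting moves *)

Section Degrees.
Local Open Scope nat_scope.
Variable V : finType.
Implicit Types (E F T A : {set {set V}}) (e f g : {set V}) (x y z u v a b p q w : V).

Definition deg E x := #|[set e in E | x \in e]|.
Definition nbrs E x := [set u | eadj E x u].

Lemma nbrsP E x u : (u \in nbrs E x) = ([set x; u] \in E).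
Proof. by rewrite inE. Qed.

Lemma nbrs_sym E x u : (u \in nbrs E x) = (x \in nbrs E u).
Proof. by rewrite !nbrsP setUC. Qed.

Lemma edge_neq E x y : simple E -> [set x; y] \in E -> x != y.
Proof. by move=> /simpleP sE /sE; rewrite cards2; case: (x == y). Qed.

Lemma deg_nbrs E x : simple E -> deg E x = #|nbrs E x|.
Proof.
move=> sE; rewrite -(@card_imset _ _ (fun u => [set x; u])); last first.
  by move=> u u' /set2_eq[[_ ->]|[<- ->]].
apply: eq_card => e; rewrite inE; apply/andP/imsetP.
  move=> [eE xe]; have [p [q [_ epq]]] := simple_pair sE eE.
  move: xe; rewrite epq !inE => /orP[]/eqP ->.
    by exists q; rewrite ?nbrsP -?epq.
  by exists p; rewrite ?nbrsP setUC -?epq.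
by move=> [u]; rewrite nbrsP => uE ->; rewrite uE !inE eqxx.
Qed.

Lemma component_closed E a x y : [set x; y] \in E -> x \in component E a -> y \in component E a.
Proof. by move=> xy; rewrite !inE => ax; apply: conn_trans ax (conn_edge xy). Qed.

Lemma handshake E a : simple E ->
  \sum_(x in component E a) deg E x = 2 * #|inside E (component E a)|.
Proof.
move=> sE; set A := component E a.
have degE x : deg E x = \sum_(e in E) (x \in e).
  rewrite /deg -sum1_card big_mkcond [RHS]big_mkcond /=; apply: eq_bigr => e _.
  by rewrite inE; case: (e \in E) => //=; case: (x \in e).
rewrite (eq_bigr _ (fun x _ => degE x)) exchange_big /=.
rewrite -sum1_card big_distrr /= (bigID (fun e => e \subset A)) /=.
rewrite [X in _ + X]big1 ?addn0 => [|e /andP[eE eA]].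
  have -> : \sum_(e in inside E A) 2 * 1 = \sum_(e in E | e \subset A) 2.
    by apply: eq_bigl => e; rewrite inE.
  apply: eq_bigr => e /andP[eE eA].
  move/simpleP: (sE) => /(_ _ eE) <-; rewrite -sum1_card [RHS]big_mkcond [LHS]big_mkcond /=.
  apply: eq_bigr => x _; have [xe|] := boolP (x \in e); last by case: ifP.
  by rewrite (subsetP eA _ xe).
rewrite big1// => x xA; apply/eqP; rewrite eqb0; apply: contra eA => xe.
have [p [q [_ epq]]] := simple_pair sE eE.
have pqE : [set p; q] \in E by rewrite -epq.
have qpE : [set q; p] \in E by rewrite setUC -epq.
apply/subsetP => y; move: xe; rewrite epq !in_set2 => /orP[]/eqP xE /orP[]/eqP ->; rewrite -?xE //.
  by apply: (component_closed (x := p)); rewrite -?xE // xE.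
by apply: (component_closed (x := q)); rewrite -?xE // xE.
Qed.

Lemma component_deg_gt0 E a x : 1 < #|component E a| -> x \in component E a -> 0 < deg E x.
Proof.
move=> A1 xA; have [y yA yx] : exists2 y, y \in component E a & y != x.
  have /card_gt1P[p [q [pA qA pq]]] := A1.
  have [px|px] := eqVneq p x; last by exists p.
  by exists q; rewrite // eq_sym -px.
have xy : conn E x y.
  by move: xA yA; rewrite !inE => ax ay; apply: conn_trans ay; rewrite conn_sym.
have [z xz] : exists z, [set x; z] \in E.
  move: x y xy yx {xA yA}; apply: conn_ind => [x|x y z xy _ _]; first by rewrite eqxx.
  by exists y.
by rewrite card_gt0; apply/set0Pn; exists [set x; z]; rewrite !inE xz eqxx.
Qed.

Definition good E v := [&& deg E v == 2, [forall w in nbrs E v, deg E w == 2] &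
  [forall u in nbrs E v, forall w in nbrs E v, ~~ eadj E u w]].
Definition light E v := (deg E v <= 1) || good E v.

Lemma triangle_component E x u w : simple E -> deg E x = 2 -> deg E u = 2 -> deg E w = 2 ->
  [set x; u] \in E -> [set x; w] \in E -> [set u; w] \in E ->
  component E x \subset [set x; u; w].
Proof.
move=> sE dx du dw xu xw uw.
have nx := edge_neq sE xu; have nxw := edge_neq sE xw; have nuw := edge_neq sE uw.
have two y z t : deg E y = 2 -> z != t -> [set y; z] \in E -> [set y; t] \in E ->
    nbrs E y = [set z; t].
  move=> dy zt yz yt; apply/esym/eqP; rewrite eqEcard -deg_nbrs// dy cards2 zt andbT.
  by apply/subsetP => s; rewrite !inE => /orP[]/eqP ->.
have Nx := two x u w dx nuw xu xw.
have Nu : nbrs E u = [set x; w] by apply: two => //; rewrite setUC.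
have Nw : nbrs E w = [set x; u] by apply: two => //; rewrite setUC.
have closed s t : conn E s t -> s \in [set x; u; w] -> t \in [set x; u; w].
  apply: (@conn_ind _ E (fun s t => s \in [set x; u; w] -> t \in [set x; u; w])) => // {}s {}t r.
  rewrite -[eadj E s t]/([set s; t] \in E) -nbrsP => st IH sS; apply: IH.
  move: sS; rewrite !inE -orbA => /or3P[]/eqP ss; move: st; rewrite ss ?Nx ?Nu ?Nw !inE;
    by move=> /orP[]/eqP ->; rewrite eqxx ?orbT.
by apply/subsetP => y; rewrite inE => /closed; apply; rewrite !inE eqxx.
Qed.

(* The degree sum is close to 2 |A|, so unless there are many leaves, few vertices
   have degree at least 3 and few edges leave the vertices of degree different
   from 2. *)
Lemma poor_light E T a : simple E -> spanning E T -> forest T ->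
  let A := component E a in
  1 < #|A| -> 28 * #|inside E A :\: T| < #|A| ->
  #|A| <= 56 * #|[set v in A | light E v]|.
Proof.
move=> sE sT fT A A1 few.
have [TE _] := sT.
have TA : #|inside T A| < #|A|.
  apply: forest_inside fT _; first exact: simple_sub TE sE.
  by apply/set0Pn; exists a; exact: component_refl.
have mT : #|inside E A| <= #|inside E A :\: T| + #|inside T A|.
  rewrite -(cardsID T (inside E A)) addnC leq_add2l; apply/subset_leq_card/subsetP => e.
  by rewrite !inE => /andP[/andP[_ ->] ->].
have hs := handshake a sE; rewrite -/A in hs.
have few28 : 28 * #|inside E A| + 28 < 29 * #|A| by lia.
pose D1 := [set x in A | deg E x == 1].
pose D2 := [set x in A | deg E x == 2].
pose D3 := [set x in A | 2 < deg E x].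
have D1E x : (x \in D1) = (x \in A) && (deg E x == 1) by rewrite [LHS]inE.
have D2E x : (x \in D2) = (x \in A) && (deg E x == 2) by rewrite [LHS]inE.
have D3E x : (x \in D3) = (x \in A) && (2 < deg E x) by rewrite [LHS]inE.
have cD (P : pred V) : #|[set x in A | P x]| = \sum_(x in A | P x) 1.
  by rewrite -sum1_card; apply: eq_bigl => x; rewrite !inE.
have cardA : #|A| = #|D1| + #|D2| + #|D3|.
  rewrite /D1 /D2 /D3 !cD -sum1_card (bigID (fun x => deg E x == 1)) /= -addnA; congr (_ + _).
  rewrite (bigID (fun x => deg E x == 2)) /=; congr (_ + _).
    by apply: eq_bigl => x; case: (x \in A) => //=; case: eqP => // ->.
  apply: eq_bigl => x; case: (boolP (x \in A)) => //= /(component_deg_gt0 A1); lia.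
pose hsum := \sum_(x in D3) deg E x.
have sumA : \sum_(x in A) deg E x = #|D1| + 2 * #|D2| + hsum.
  rewrite (bigID (fun x => deg E x == 1)) /= -addnA; congr (_ + _).
    by rewrite /D1 cD; apply: eq_bigr => x /andP[_ /eqP].
  rewrite (bigID (fun x => deg E x == 2)) /=; congr (_ + _).
    rewrite /D2 cD big_distrr /=.
    by apply: eq_big => x; [case: (x \in A) => //=; case: eqP => // ->|move=> /andP[_ /eqP ->]].
  apply: eq_bigl => x; rewrite D3E; case: (boolP (x \in A)) => //= /(component_deg_gt0 A1); lia.
have h3 : 3 * #|D3| <= hsum.
  by rewrite mulnC -sum_nat_const; apply: leq_sum => x; rewrite D3E => /andP[].
pose L := [set v in A | light E v].
have LE x : (x \in L) = (x \in A) && light E x by rewrite [LHS]inE.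
have D1L : #|D1| <= #|L|.
  apply/subset_leq_card/subsetP => x; rewrite D1E LE => /andP[-> /eqP d1] /=.
  by rewrite /light d1.
pose G := [set x in D2 | good E x].
have GE x : (x \in G) = (x \in D2) && good E x by rewrite [LHS]inE.
have GL : #|G| <= #|L|.
  apply/subset_leq_card/subsetP => x; rewrite GE D2E LE => /andP[/andP[-> _] g] /=.
  by rewrite /light g orbT.
pose U := [set x : V * V | (x.1 \in D1 :|: D3) && (x.2 \in nbrs E x.1)].
have cU : #|U| <= #|D1| + hsum.
  rewrite (card_dep (fun x => x \in D1 :|: D3) (fun x y => y \in nbrs E x)).
  apply: (@leq_trans (\sum_(x in D1 :|: D3) deg E x)).
    by apply: leq_sum => x _; rewrite deg_nbrs//; apply/subset_leq_card/subsetP => y; rewrite inE.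
  rewrite (bigID (fun x => x \in D1)) /=; apply: leq_add.
    rewrite -sum1_card (eq_bigl (fun x => x \in D1)); last first.
      by move=> x; rewrite in_setU; case: (x \in D1); rewrite ?andbF.
    by apply: leq_sum => x; rewrite D1E => /andP[_ /eqP ->].
  rewrite [hsum](eq_bigl (fun x => (x \in D1 :|: D3) && (x \notin D1))) //.
  by move=> x; rewrite in_setU D1E D3E; case: (x \in A) => //=; case: eqP => [->|_] //=; rewrite ?andbT.
have D2G : #|D2| <= #|G| + #|U|.
  rewrite -(cardsID [set x | good E x] D2); apply: leq_add.
    by apply/subset_leq_card/subsetP => x; rewrite !inE.
  apply: leq_trans (leq_imset_card snd U); apply/subset_leq_card/subsetP => x.
  rewrite in_setD D2E inE => /andP[ng /andP[xA dx]].
  have Ax : A = component E x by move: xA; rewrite inE; exact: component_eq.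
  have [nd|] := boolP [forall w in nbrs E x, deg E w == 2].
    move: ng; rewrite /good dx nd /= => /forall_inPn[u ux /forall_inPn[w wx]].
    rewrite negbK => uw; exfalso.
    have du := forall_inP nd _ ux; have dw := forall_inP nd _ wx.
    have sub : A \subset [set x; u; w].
      by rewrite Ax; apply: triangle_component => //; rewrite -?nbrsP//; exact/eqP.
    have hA : \sum_(y in A) deg E y = 2 * #|A|.
      rewrite mulnC -sum_nat_const; apply: eq_bigr => y /(subsetP sub).
      by rewrite !inE -orbA => /or3P[]/eqP ->; apply/eqP.
    have : #|A| <= 3.
      apply: leq_trans (subset_leq_card sub) _; rewrite -[3]/(2 + 1).
      apply: leq_trans (leq_card_setU _ _).1 _; rewrite cards1 leq_add2r.
      by rewrite cards2; case: (_ != _).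
    lia.
  case/forall_inPn => w wx dw; apply/imsetP; exists (w, x) => //.
  have wA : w \in A by rewrite Ax inE; apply: conn_edge; rewrite -nbrsP.
  have := component_deg_gt0 A1 wA.
  rewrite /U inE /= in_setU D1E D3E wA nbrs_sym wx andbT /=; lia.
change (#|A| <= 56 * #|L|).
rewrite hs in sumA; lia.
Qed.

End Degrees.

Section Forward.
Local Open Scope nat_scope.
Variable V : finType.
Implicit Types (E F T : {set {set V}}) (A B : {set V}) (e f : {set V}) (u v a b p q w : V).

Definition lights E A := [set v in A | light E v].
Definition smalls E A := [set e in inside E A | small E e].
Definition isolated E A := [set v in A | deg E v == 0].

Lemma mem_lights E A v : (v \in lights E A) = (v \in A) && light E v.
Proof. by rewrite inE. Qed.

Lemma mem_isolated E A v : (v \in isolated E A) = (v \in A) && (deg E v == 0).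
Proof. by rewrite inE. Qed.

Lemma component_profile E a : simple E -> let A := component E a in
  [/\ #|A| = 1, 1 <= #|lights E A| & 1 <= #|isolated E A|] \/
  #|A| <= 2 * #|inside E A| /\ (#|A| <= 56 * #|lights E A| \/ #|A| <= 56 * #|smalls E A|).
Proof.
move=> sE A; have aA : a \in A by exact: component_refl.
have [A1|A1] := leqP #|A| 1.
  have Aa : A = [set a].
    by apply/eqP; rewrite eq_sym eqEcard sub1set aA cards1.
  have d0 : deg E a = 0.
    apply/eqP; rewrite deg_nbrs// cards_eq0; apply/eqP/setP => u; rewrite nbrsP inE.
    apply/negP => au; have := component_closed au aA; rewrite -/A Aa inE => /eqP ua.
    by move: (edge_neq sE au); rewrite ua eqxx.
  left; split; first by rewrite Aa cards1.
    by rewrite card_gt0; apply/set0Pn; exists a; rewrite mem_lights aA /light d0.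
  by rewrite card_gt0; apply/set0Pn; exists a; rewrite mem_isolated aA d0.
right; split.
  rewrite -handshake// -/A -sum1_card; apply: leq_sum => x xA.
  exact: (component_deg_gt0 A1 xA).
have [T sT fT] := spanning_forest sE.
have [few|many] := ltnP (28 * #|inside E A :\: T|) #|A|.
  by left; apply: (poor_light sE sT fT A1 few).
by right; apply: (small_count sE sT fT many).
Qed.

Definition apart E e f := [forall p in e, forall q in f, ~~ conn E p q].

Lemma apartP E e f : reflect (forall p q, p \in e -> q \in f -> ~~ conn E p q) (apart E e f).
Proof.
apply: (iffP forall_inP) => [h p q pe qf|h p pe].
  exact: (forall_inP (h p pe)).
by apply/forall_inP => q; apply: h.
Qed.

(* The moves available in E: codes0 joins two isolated vertices, codes1 subdivides
   the edge with the light vertex, codes2 switches two small edges. *)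
Definition codes0 E := [set x : V * V | [&& deg E x.1 == 0, deg E x.2 == 0 & x.1 != x.2]].
Definition codes1 E := [set x : {set V} * V | [&& x.1 \in E, light E x.2 & apart E x.1 [set x.2]]].
Definition codes2 E :=
  [set x : {set V} * {set V} | [&& small E x.1, small E x.2 & apart E x.1 x.2]].

Definition component_pairs E :=
  [pred x : {set V} * {set V} | [&& x.1 \in components E, x.2 \in components E & x.2 != x.1]].

Lemma sum_pairs E (I J : finType) (X : {set I * J}) (f : {set V} -> {set I})
    (g : {set V} -> {set J}) :
  (forall A B i j, component_pairs E (A, B) -> i \in f A -> j \in g B -> (i, j) \in X) ->
  (forall A B i, A \in components E -> B \in components E -> i \in f A -> i \in f B -> A = B) ->
  (forall A B j, A \in components E -> B \in components E -> j \in g A -> j \in g B -> A = B) ->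
  \sum_(x | component_pairs E x) #|f x.1| * #|g x.2| <= #|X|.
Proof.
move=> fgX fI gI.
rewrite (eq_bigr (fun x => #|[set y : I * J | (y.1 \in f x.1) && (y.2 \in g x.2)]|)); last first.
  move=> x _; rewrite -cardsX; apply: eq_card => y; rewrite !inE; by case: y.
rewrite -(card_dep (component_pairs E) (fun (x : {set V} * {set V}) (y : I * J) => (y.1 \in f x.1) && (y.2 \in g x.2))).
set D := [set _ | _].
have inD (x : {set V} * {set V}) (y : I * J) : (x, y) \in D -> [/\ component_pairs E x, y.1 \in f x.1 & y.2 \in g x.2].
  by rewrite inE => /and3P[].
rewrite -(@card_in_imset _ _ snd D).
  apply/subset_leq_card/subsetP => y /imsetP[[[A B] [i j]] /inD[/= AB iA jB] ->] /=.
  exact: fgX AB iA jB.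
move=> [[A B] [i j]] [[A' B'] [i' j']] /inD[/= /and3P[/= AE BE _] iA jB].
move=> /inD[/= /and3P[/= AE' BE' _] iA' jB'] [ii jj]; subst i' j'.
by rewrite (fI _ _ _ AE AE' iA iA') (gI _ _ _ BE BE' jB jB').
Qed.

Lemma sum_component_pairs E : #|V| * #|components E|.-1 <=
  \sum_(x | component_pairs E x) #|x.1| * #|x.2|.
Proof.
have gt0 A : A \in components E -> 0 < #|A|.
  by move=> /componentP[x ->]; rewrite card_gt0; apply/set0Pn; exists x; exact: component_refl.
have sumV : \sum_(A in components E) #|A| = #|V|.
  transitivity (\sum_(x : V) 1); last by rewrite sum1_card.
  rewrite (partition_big (component E) (fun A => A \in components E)) /=; last first.
    by move=> x _; apply/componentP; exists x.
  apply: eq_bigr => A AE; rewrite -sum1_card; apply: eq_bigl => x.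
  apply/idP/eqP => [xA|<-]; last exact: component_refl.
  by rewrite -(component_mem AE xA).
apply: (@leq_trans (\sum_(x | component_pairs E x) #|x.1|)); last first.
  by apply: leq_sum => x /and3P[_ /gt0 x2 _]; rewrite leq_pmulr.
rewrite -(pair_big_dep (fun A => A \in components E)
  (fun A B => (B \in components E) && (B != A)) (fun A _ => #|A|)) /=.
rewrite -sumV big_distrl /=; apply: leq_sum => A AE.
rewrite sum_nat_const mulnC leq_mul2r; apply/orP; right.
rewrite (cardsD1 A) AE /=; apply/subset_leq_card/subsetP => B.
by rewrite !inE unfold_in /= andbC.
Qed.

Lemma apart_components E A B : component_pairs E (A, B) ->
  forall p q, p \in A -> q \in B -> ~~ conn E p q.
Proof.
move=> /and3P[/= AE BE BA] p q pA qB; apply: contra BA => pq.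
by rewrite (component_mem AE pA) (component_mem BE qB) (component_eq pq).
Qed.

Lemma inside_uniq E A B e : simple E -> A \in components E -> B \in components E ->
  e \in inside E A -> e \in inside E B -> A = B.
Proof.
move=> sE AE BE; rewrite !inE => /andP[eE eA] /andP[_ eB].
have [p [q [_ epq]]] := simple_pair sE eE.
have pe : p \in e by rewrite epq !inE eqxx.
by rewrite (component_mem AE (subsetP eA _ pe)) (component_mem BE (subsetP eB _ pe)).
Qed.

Lemma mem_uniq E A B v : A \in components E -> B \in components E ->
  v \in A -> v \in B -> A = B.
Proof. by move=> AE BE vA vB; rewrite (component_mem AE vA) (component_mem BE vB). Qed.

Lemma many_codes E : simple E -> #|V| * #|components E|.-1 <=
  3136 * (#|codes0 E| + 2 * #|codes1 E| + #|codes2 E|).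
Proof.
move=> sE; apply: leq_trans (sum_component_pairs E) _.
pose m A := #|inside E A|; pose l A := #|lights E A|.
pose s A := #|smalls E A|; pose i A := #|isolated E A|.
apply: (@leq_trans (\sum_(x | component_pairs E x) 3136 *
    (i x.1 * i x.2 + (m x.1 * l x.2 + l x.1 * m x.2) + s x.1 * s x.2))).
  apply: leq_sum => -[_ _] /and3P[/= /componentP[a ->] /componentP[b ->] _].
  have := component_profile a sE; have := component_profile b sE.
  rewrite /= -/(m _) -/(m _) -/(l _) -/(l _) -/(s _) -/(s _) -/(i _) -/(i _).
  set n1 := #|component E a|; set n2 := #|component E b|.
  move: (m _) (m _) (l _) (l _) (s _) (s _) (i _) (i _) => m1 m2 l1 l2 s1 s2 i1 i2.
  case=> [[-> l2p i2p]|[h2 h2']]; case=> [[-> l1p i1p]|[h1 h1']].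
  - by have := leq_mul i1p i2p; lia.
  - by have := leq_mul h1 l2p; lia.
  - by have := leq_mul h2 l1p; lia.
  case: h2' => h2'; first by have := leq_mul h1 h2'; lia.
  case: h1' => h1'; first by have := leq_mul h1' h2; lia.
  by have := leq_mul h1' h2'; lia.
rewrite -big_distrr /= leq_mul2l /= !big_split /=.
have memL A v : v \in lights E A -> v \in A /\ light E v by rewrite inE => /andP[].
have memI A v : v \in isolated E A -> v \in A /\ deg E v == 0 by rewrite inE => /andP[].
have memS A e : e \in smalls E A -> e \in inside E A /\ small E e by rewrite inE => /andP[].
have memM A e : e \in inside E A -> e \in E /\ e \subset A by rewrite inE => /andP[].
have ap A B e f : component_pairs E (A, B) -> e \subset A -> f \subset B -> apart E e f.
  move=> AB /subsetP eA /subsetP fB; apply/apartP => p q /eA pA /fB qB.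
  exact: apart_components AB _ _ pA qB.
have h0 : \sum_(x | component_pairs E x) i x.1 * i x.2 <= #|codes0 E|.
  apply: sum_pairs => [A B u v AB /memI[uA du] /memI[vB dv]|A B u AE BE /memI[uA _] /memI[uB _]
     |A B u AE BE /memI[uA _] /memI[uB _]]; last 2 first.
  - exact: mem_uniq AE BE uA uB.
  - exact: mem_uniq AE BE uA uB.
  rewrite inE /= du dv; have := apart_components AB uA vB.
  by apply: contra => /eqP ->; exact: conn_refl.
have h1 : \sum_(x | component_pairs E x) m x.1 * l x.2 <= #|codes1 E|.
  apply: sum_pairs => [A B e v AB /memM[eE eA] /memL[vB lv]|A B e AE BE|A B u AE BE /memL[uA _] /memL[uB _]].
  - by rewrite inE /= eE lv (ap _ _ _ _ AB eA)// sub1set.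
  - exact: inside_uniq.
  - exact: mem_uniq AE BE uA uB.
have h2 : \sum_(x | component_pairs E x) l x.1 * m x.2 <= #|codes1 E|.
  pose X := [set x : V * {set V} | (x.2, x.1) \in codes1 E].
  have -> : #|codes1 E| = #|X|.
    rewrite -(@card_imset _ _ (fun x : V * {set V} => (x.2, x.1)) X) => [|[? ?] [? ?] [-> ->]//].
    apply: eq_card => -[e v]; apply/idP/imsetP => [ev|[[v' e']]]; last by rewrite inE => h [-> ->].
    by exists (v, e); rewrite // inE.
  apply: sum_pairs => [A B v e AB /memL[vA lv] /memM[eE eB]|A B u AE BE /memL[uA _] /memL[uB _]|A B e AE BE].
  - rewrite !inE /= eE lv /=; apply/apartP => p q pe; rewrite inE => /eqP ->.
    by rewrite conn_sym; apply: (apart_components AB vA); exact: (subsetP eB).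
  - exact: mem_uniq AE BE uA uB.
  - exact: inside_uniq.
have h3 : \sum_(x | component_pairs E x) s x.1 * s x.2 <= #|codes2 E|.
  apply: sum_pairs => [A B e f AB /memS[/memM[eE eA] se] /memS[/memM[fE fB] sf]
    |A B e AE BE /memS[eA _] /memS[eB _]|A B e AE BE /memS[eA _] /memS[eB _]].
  - by rewrite inE /= se sf (ap _ _ _ _ AB eA fB).
  - exact: inside_uniq eA eB.
  - exact: inside_uniq eA eB.
apply: leq_trans (leq_add (leq_add h0 (leq_add h1 h2)) h3) _; rewrite mul2n -addnn; exact: leqnn.
Qed.

End Forward.

Section Reverse.
Local Open Scope nat_scope.
Variable V : finType.
Implicit Types (E F T : {set {set V}}) (e f g h : {set V}) (u v a b p q w : V).

Lemma double_count (I J : finType) (M : {set I}) (Y : {set J}) (R : I -> J -> Prop) c :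
  (forall x, x \in M -> exists2 y, y \in Y & R x y) ->
  (forall y, y \in Y -> exists2 D : {set I}, #|D| <= c & forall x, x \in M -> R x y -> x \in D) ->
  #|M| <= #|Y| * c.
Proof.
move=> MY YM.
pose P := [set x : J * I | (x.1 \in Y) && ((x.2 \in M) && `[< R x.2 x.1 >])].
apply: (@leq_trans #|P|).
  apply: leq_trans (leq_imset_card snd P); apply/subset_leq_card/subsetP => x xM.
  have [y yY Rxy] := MY x xM; apply/imsetP; exists (y, x) => //.
  by rewrite inE /= yY xM; apply/asboolP.
rewrite (card_dep (fun y => y \in Y) (fun y x => (x \in M) && `[< R x y >])) -sum_nat_const.
apply: leq_sum => y /YM[D Dc MD]; apply: leq_trans Dc; apply/subset_leq_card/subsetP => x.
by rewrite inE => /andP[xM /asboolP]; apply: MD.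
Qed.

Lemma nbrsU1 E a b v : nbrs ([set a; b] |: E) v =
  (if v == a then [set b] else set0) :|: (if v == b then [set a] else set0) :|: nbrs E v.
Proof.
apply/setP => u; rewrite nbrsP in_setU1 !in_setU nbrsP; congr (_ || _).
apply/eqP/orP.
  by move=> /set2_eq[] [-> ->]; rewrite eqxx set11; [left|right].
by case: eqP => [->|_]; case: eqP => [->|_]; rewrite ?inE => -[] // /eqP -> //; rewrite setUC.
Qed.

Definition join_isolated E u v := [set u; v] |: E.
Definition subdivide E a b v := [set a; v] |: ([set b; v] |: (E :\ [set a; b])).
Definition reroute E a b u v w :=
  [set a; v] |: ([set b; v] |: ([set u; w] |: (E :\ [set a; b] :\ [set u; v]))).
Definition switch E a1 a2 b1 b2 :=
  [set a1; b1] |: ([set a2; b2] |: (E :\ [set a1; a2] :\ [set b1; b2])).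

Lemma conn_isolated E u v : simple E -> deg E u = 0 -> conn E u v -> u = v.
Proof.
move=> sE du uv; move: u v uv du; apply: conn_ind => // u v w uv _ /eqP.
by rewrite deg_nbrs// cards_eq0 => /eqP/setP/(_ v); rewrite nbrsP inE -[_ \in E]/(eadj E u v) uv.
Qed.

Lemma reverse_join F : exists2 D : {set {set {set V}} * (V * V)}, #|D| <= #|V| &
  forall E u v, simple E -> deg E u = 0 -> F = join_isolated E u v -> u != v -> [set u; v] \notin E ->
    (E, (u, v)) \in D.
Proof.
pose dec u := let v := odflt u [pick v | v \in nbrs F u] in (F :\ [set u; v], (u, v)).
exists [set dec u | u : V]; first exact: leq_trans (leq_imset_card _ _) (max_card _).
move=> E u v sE du FE uv nE; apply/imsetP; exists u => //.
have Nu : nbrs F u = [set v].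
  rewrite FE nbrsU1 eqxx (negbTE uv) setU0; move/eqP: du; rewrite deg_nbrs// cards_eq0.
  by move/eqP ->; rewrite setU0.
rewrite /dec Nu; case: pickP => [w|/(_ v)]; last by rewrite set11.
by rewrite inE => /eqP -> /=; rewrite FE /join_isolated setU1K.
Qed.

Lemma card_small_subsets (A : {set V}) : #|A| <= 3 -> #|[set e in powerset A]| <= 8.
Proof.
move=> A3; rewrite (_ : [set e in powerset A] = powerset A); last by apply/setP => e; rewrite inE.
by rewrite card_powerset (leq_trans (leq_pexp2l _ A3)).
Qed.

Lemma conn_new_edge E a b v p : [set a; b] \in E -> ~~ conn E a v -> p \in [set a; b] ->
  [set p; v] \notin E /\ p != v.
Proof.
move=> abE av pab; have ap : conn E a p.
  by move: pab; rewrite !inE => /orP[]/eqP ->; [exact: conn_refl|exact: conn_edge].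
split; first by apply: contra av => /conn_edge; exact: conn_trans.
by apply: contra av => /eqP <-.
Qed.

(* F and the pair (v, e) determine E; since v has degree at most 3 in F, at most 8
   sets e are possible for each v. *)
Lemma reverse_subdivide F : exists2 D : {set {set {set V}} * ({set V} * V)}, #|D| <= 8 * #|V| &
  forall E a b v, simple E -> [set a; b] \in E -> deg E v <= 1 -> ~~ conn E a v ->
    F = subdivide E a b v -> (E, ([set a; b], v)) \in D.
Proof.
pose X := [set x : V * {set V} | (x.1 \in [set v | #|nbrs F v| <= 3]) && (x.2 \subset nbrs F x.1)].
pose dec (x : V * {set V}) := (x.2 |: (F :\: [set [set p; x.1] | p in x.2]), (x.2, x.1)).
exists (dec @: X).
  apply: leq_trans (leq_imset_card _ _) _; rewrite (card_dep (fun v => v \in _) (fun v e => e \subset nbrs F v)).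
  apply: (@leq_trans (\sum_(v in [set v | #|nbrs F v| <= 3]) 8)).
    apply: leq_sum => v; rewrite inE => /card_small_subsets; apply: leq_trans.
    by apply/subset_leq_card/subsetP => e; rewrite !inE.
  by rewrite sum_nat_const mulnC leq_mul2l max_card orbT.
move=> E a b v sE abE dv av FE; apply/imsetP; exists (v, [set a; b]).
  have [_ va] := conn_new_edge abE av (set21 a b); have [_ vb] := conn_new_edge abE av (set22 a b).
  have NF : nbrs F v = [set a; b] :|: nbrs E v.
    rewrite FE /subdivide !nbrsU1 !eqxx eq_sym (negbTE va) [v == b]eq_sym (negbTE vb) !set0U setUA.
    congr (_ :|: _); apply/setP => u; rewrite !nbrsP in_setD1 andb_idl// => _.
    apply/eqP => /set2_eq[] [vE _]; first by rewrite vE eqxx in va.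
    by rewrite vE eqxx in vb.
  rewrite !inE /= NF subsetUl andbT.
  apply: leq_trans (leq_card_setU _ _).1 _; rewrite cards2 -deg_nbrs//.
  by case: (a != b); lia.
rewrite /dec /=; congr (_, _).
have im : [set [set p; v] | p in [set a; b]] = [set [set a; v]; [set b; v]].
  by rewrite imsetU1 imset_set1.
rewrite im FE /subdivide; apply/setP => e; rewrite !inE.
have [->|ne] := eqVneq e [set a; b]; first by rewrite abE.
have [ea|nea] := eqVneq e [set a; v] => /=.
  by rewrite ea; apply/negbTE; have [] := conn_new_edge abE av (set21 a b).
have [eb|neb] := eqVneq e [set b; v] => //=.
by rewrite eb; apply/negbTE; have [] := conn_new_edge abE av (set22 a b).
Qed.

(* F and v, e, w, u determine E; for each v at most 8 * 3 * 3 choices are possible. *)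
Lemma reverse_reroute F : exists2 D : {set {set {set V}} * ({set V} * V)}, #|D| <= 72 * #|V| &
  forall E a b u v w, simple E -> [set a; b] \in E -> ~~ conn E a v ->
    nbrs E v = [set u; w] -> u != w -> deg E w = 2 -> [set u; w] \notin E ->
    F = reroute E a b u v w -> (E, ([set a; b], v)) \in D.
Proof.
pose N := [set v | #|nbrs F v| <= 3].
pose Q v (x : {set V} * (V * V)) := (x.1 \subset nbrs F v) &&
  ((x.2.1 \in N :&: nbrs F v) && (x.2.2 \in nbrs F x.2.1)).
pose X := [set x : V * ({set V} * (V * V)) | (x.1 \in N) && Q x.1 x.2].
pose dec (x : V * ({set V} * (V * V))) :=
  let v := x.1 in let e := x.2.1 in let w := x.2.2.1 in let u := x.2.2.2 in
  (e |: ([set u; v] |: (F :\: [set [set p; v] | p in e] :\ [set u; w])), (e, v)).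
exists (dec @: X).
  apply: leq_trans (leq_imset_card _ _) _.
  rewrite (card_dep (fun v => v \in N) Q).
  apply: (@leq_trans (\sum_(v in N) 72)).
    apply: leq_sum => v vN; have v3 : #|nbrs F v| <= 3 by move: vN; rewrite inE.
    rewrite (card_dep (fun e => e \subset nbrs F v)
      (fun _ (y : V * V) => (y.1 \in N :&: nbrs F v) && (y.2 \in nbrs F y.1))).
    rewrite sum_nat_const -[72]/(8 * 9); apply: leq_mul.
      by apply: leq_trans (card_small_subsets v3); apply/subset_leq_card/subsetP => e; rewrite !inE.
    rewrite (card_dep (fun w => w \in N :&: nbrs F v) (fun w u => u \in nbrs F w)).
    apply: (@leq_trans (\sum_(w in N :&: nbrs F v) 3)).
      apply: leq_sum => w; rewrite in_setI inE => /andP[w3 _]; apply: leq_trans w3.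
      by apply/subset_leq_card/subsetP => u; rewrite inE.
    rewrite sum_nat_const -[9]/(3 * 3) leq_mul2r /=; apply: leq_trans v3.
    exact/subset_leq_card/subsetIr.
  by rewrite sum_nat_const mulnC leq_mul2l max_card orbT.
move=> E a b u v w sE abE av Nv uw dw uwE FE.
have [na va] := conn_new_edge abE av (set21 a b); have [nb vb] := conn_new_edge abE av (set22 a b).
have vuE : [set v; u] \in E by rewrite -nbrsP Nv !inE eqxx.
have vwE : [set v; w] \in E by rewrite -nbrsP Nv !inE eqxx orbT.
have vu := edge_neq sE vuE; have vw := edge_neq sE vwE.
have far p : conn E v p -> p \notin [set a; b].
  move=> vp; apply: contra av => pab; apply: (@conn_trans _ _ p); last by rewrite conn_sym.
  by move: pab; rewrite !inE => /orP[]/eqP ->; [exact: conn_refl|exact: conn_edge].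
have := far _ (conn_edge vwE); rewrite !inE negb_or => /andP[wa wb].
have := far _ (conn_edge vuE); rewrite !inE negb_or => /andP[ua ub].
have keep p q : p \notin [set a; b] -> [set p; q] != [set a; b].
  by apply: contra => /eqP <-; rewrite set21.
have vab : v \notin [set a; b] by rewrite in_set2 negb_or [v == a]eq_sym [v == b]eq_sym va.
have NFv : nbrs F v = [set a; b] :|: [set w].
  rewrite FE /reroute !nbrsU1 !eqxx [v == a]eq_sym [v == b]eq_sym (negbTE va) (negbTE vb) (negbTE vu) (negbTE vw) !set0U.
  rewrite setUA; congr (_ :|: _); apply/setP => p.
  rewrite nbrsP !in_setD1 -nbrsP Nv (keep _ _ vab) in_set2 in_set1 /=.
  have [->|pw] := eqVneq p w.
    rewrite orbT andbT; apply: contra uw => /eqP/set2_eq[[vu' _]|[_ ->]] //.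
    by rewrite vu' eqxx in vu.
  by rewrite orbF; apply/negP => /andP[+ /eqP pu]; rewrite pu setUC eqxx.
have NFw : #|nbrs F w| <= 3.
  rewrite FE /reroute !nbrsU1 (negbTE wa) (negbTE wb) [w == v]eq_sym (negbTE vw) [w == u]eq_sym (negbTE uw) eqxx !set0U.
  apply: leq_trans (leq_card_setU _ _).1 _; rewrite cards1 -[3]/(1 + 2) leq_add2l.
  rewrite -dw deg_nbrs//; apply/subset_leq_card/subsetP => p.
  by rewrite !nbrsP !in_setD1 => /and3P[].
have uFw : u \in nbrs F w by rewrite nbrsP FE !inE [[set w; u]]setUC eqxx !orbT.
apply/imsetP; exists (v, ([set a; b], (w, u))).
  have NE t : (t \in N) = (#|nbrs F t| <= 3) by rewrite inE.
  rewrite inE /= /Q /= in_setI uFw !NE NFw NFv subsetUl in_setU set11 orbT !andbT /=.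
  apply: leq_trans (leq_card_setU _ _).1 _; rewrite cards2 cards1.
  by case: (a != b).
rewrite /dec /=; congr (_, _).
have im : [set [set p; v] | p in [set a; b]] = [set [set a; v]; [set b; v]].
  by rewrite imsetU1 imset_set1.
rewrite im FE /reroute; apply/setP => e; rewrite !inE.
have [->|ne] := eqVneq e [set a; b]; first by rewrite abE.
have [->|ne'] := eqVneq e [set u; v]; first by rewrite setUC vuE.
have [ea|nea] := eqVneq e [set a; v] => /=; first by rewrite ea andbF; exact/negbTE.
have [eb|neb] := eqVneq e [set b; v] => /=; first by rewrite eb andbF; exact/negbTE.
have [eu|neu] := eqVneq e [set u; w] => //=; first by rewrite eu; exact/negbTE.
Qed.

End Reverse.

Section Switching.
Local Open Scope nat_scope.
Variable V : finType.
Implicit Types (E F T : {set {set V}}) (e f g h : {set V}) (u v a b p q w : V).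

Lemma cut_partnersP E e g : (g \in cut_partners E e) =
  [&& g != e, g \in E & ~~ linked (E :\ e :\ g) e].
Proof. by rewrite in_set in_setD1 andbA. Qed.

Lemma switch_partner E a1 a2 b1 b2 : simple E ->
  small E [set a1; a2] -> small E [set b1; b2] -> ~~ conn E a1 b1 ->
  let F := switch E a1 a2 b1 b2 in
  [set a2; b2] \in cut_partners F [set a1; b1] /\ #|cut_partners F [set a1; b1]| <= 111.
Proof.
move=> sE /and3P[aE an ac] /and3P[bE bn bc] ab F.
have a12 := conn_edge aE; have b12 := conn_edge bE.
move: an bn; rewrite /nonbridge !linked2 => an bn.
have ab2 : ~~ conn E a2 b2.
  apply: contra ab => h; apply: conn_trans a12 _; apply: conn_trans h _.
  by rewrite conn_sym.
have n1E : [set a1; b1] \notin E by apply: contra ab; exact: conn_edge.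
have n2E : [set a2; b2] \notin E by apply: contra ab2; exact: conn_edge.
have n12 : [set a1; b1] != [set a2; b2].
  apply/eqP => /set2_eq[[a _]|[a1b2 _]].
    by move: (edge_neq sE aE); rewrite a eqxx.
  by move: ab; rewrite a1b2 conn_sym b12.
set F0 := E :\ [set a1; a2] :\ [set b1; b2].
have F0E : F0 \subset E by apply: subset_trans (subD1set _ _) (subD1set _ _).
have Fn1 : F :\ [set a1; b1] = [set a2; b2] |: F0.
  rewrite /F /switch setU1K// in_setU1 negb_or n12 /=.
  by apply: contra n1E; exact: (subsetP F0E).
split.
  rewrite cut_partnersP eq_sym n12 Fn1 linked2 setU1K; last by apply: contra n2E; exact: (subsetP F0E).
  by rewrite /F /switch !inE eqxx orbT /=; apply: contra ab; exact: conn_subset.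
have sub : cut_partners F [set a1; b1] \subset
    [set a2; b2] |: (cut_partners E [set a1; a2] :|: cut_partners E [set b1; b2]).
  apply/subsetP => g; rewrite cut_partnersP Fn1 => /and3P[gn1 gF ncut].
  rewrite in_setU1; case: eqP => //= /eqP gn2.
  have : g \in F0 by move: gF; rewrite /F /switch !in_setU1 (negbTE gn1) (negbTE gn2).
  rewrite !in_setD1 => /and3P[gb ga gE].
  rewrite in_setU !cut_partnersP ga gb gE /= !linked2 -negb_and; apply: contra ncut.
  move=> /andP[ca cb].
  have e_ne : [set a1; a2] != [set b1; b2].
    apply: contra ab => /eqP/set2_eq[] [-> _]; first exact: conn_refl.
    by rewrite conn_sym.
  have sD T e : simple T -> simple (T :\ e) by apply: simple_sub; exact: subD1set.
  have sDE (e1 e2 : {set V}) : E :\ e1 :\ e2 \subset E.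
    exact: subset_trans (subD1set _ _) (subD1set _ _).
  have h1 : conn (E :\ [set a1; a2] :\ g :\ [set b1; b2]) a1 a2.
    apply: (conn_setD1_far _ _ _ _ ca (z := b1)).
    - by rewrite !inE eqxx.
    - by rewrite !in_setD1 [_ == g]eq_sym gb [_ == [set a1; a2]]eq_sym e_ne.
    - exact: sD (sD _ _ sE).
    - by apply: contra ab; apply: conn_subset.
  have h2 : conn (E :\ [set b1; b2] :\ g :\ [set a1; a2]) b1 b2.
    apply: (conn_setD1_far _ _ _ _ cb (z := a1)).
    - by rewrite !inE eqxx.
    - by rewrite !in_setD1 [_ == g]eq_sym ga e_ne.
    - exact: sD (sD _ _ sE).
    - by rewrite conn_sym; apply: contra ab; apply: conn_subset.
  have s1 : E :\ [set a1; a2] :\ g :\ [set b1; b2] \subset ([set a2; b2] |: F0) :\ g.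
    apply/subsetP => e; rewrite !in_setD1 in_setU1 !in_setD1 => /and4P[-> -> -> ->].
    by rewrite orbT.
  have s2 : E :\ [set b1; b2] :\ g :\ [set a1; a2] \subset ([set a2; b2] |: F0) :\ g.
    apply/subsetP => e; rewrite !in_setD1 in_setU1 !in_setD1 => /and4P[-> -> -> ->].
    by rewrite orbT.
  rewrite linked2; apply: conn_trans (conn_subset s1 h1) _.
  apply: (@conn_trans _ _ b2); last by rewrite conn_sym; exact: conn_subset s2 h2.
  by apply: conn_edge; rewrite in_setD1 setU11 eq_sym gn2.
apply: leq_trans (subset_leq_card sub) _; rewrite cardsU1.
rewrite -[111]/(1 + (55 + 55)); apply: leq_add; first exact: leq_b1.
by apply: leq_trans (leq_card_setU _ _).1 _; apply: leq_add; rewrite -ltnS.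
Qed.

Lemma switchC E a1 a2 b1 b2 : switch E a1 a2 b1 b2 = switch E a2 a1 b2 b1.
Proof. by rewrite /switch setUCA [[set a2; a1]]setUC [[set b2; b1]]setUC. Qed.

(* The two new edges form a 2-edge-cut of F, so one of them is in a spanning forest
   and the other is one of its at most 111 cut partners; an end of each of them
   then determines E. *)
Lemma reverse_switch F : simple F ->
  exists2 D : {set {set {set V}} * ({set V} * {set V})}, #|D| <= 444 * #|V| &
  forall E a1 a2 b1 b2, simple E -> small E [set a1; a2] -> small E [set b1; b2] ->
    ~~ conn E a1 b1 -> F = switch E a1 a2 b1 b2 ->
    (E, ([set a1; a2], [set b1; b2])) \in D.
Proof.
move=> sF; have [T [TF cT] fT] := spanning_forest sF.
have TV : #|T| <= #|V| by rewrite -(forest_card (simple_sub TF sF) fT) leq_addr.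
pose P g := (g \in T) && (#|cut_partners F g| <= 111).
pose Q g (x : {set V} * (V * V)) := (x.1 \in cut_partners F g) && ((x.2.1 \in g) && (x.2.2 \in x.1)).
pose X := [set x : {set V} * ({set V} * (V * V)) | P x.1 && Q x.1 x.2].
pose dec (x : {set V} * ({set V} * (V * V))) :=
  let g := x.1 in let h := x.2.1 in let c := x.2.2.1 in let d := x.2.2.2 in
  let e := [set c; d] in let f := (g :\ c) :|: (h :\ d) in
  (e |: (f |: (F :\ g :\ h)), (e, f)).
exists (dec @: X).
  apply: leq_trans (leq_imset_card _ _) _; rewrite (card_dep P Q).
  apply: (@leq_trans (\sum_(g in T) 444)); last by rewrite sum_nat_const mulnC leq_mul2l TV orbT.
  rewrite big_mkcond [X in _ <= X]big_mkcond /=; apply: leq_sum => g _.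
  rewrite /P; case: (boolP (g \in T)) => //= gT; case: ifP => // g111.
  rewrite (card_dep (fun h => h \in cut_partners F g) (fun h (y : V * V) => (y.1 \in g) && (y.2 \in h))).
  apply: (@leq_trans (\sum_(h in cut_partners F g) 4)); last first.
    by rewrite sum_nat_const -[444]/(111 * 4) leq_mul2r g111.
  apply: leq_sum => h; rewrite cut_partnersP => /and3P[_ hF _].
  rewrite (card_dep (fun c => c \in g) (fun _ d => d \in h)) sum_nat_const.
  rewrite (simpleP _ sF _ (subsetP TF _ gT)) -[4]/(2 * 2) leq_mul2l /= -(simpleP _ sF _ hF).
  by apply/subset_leq_card/subsetP => d; rewrite inE.
move=> E a1 a2 b1 b2 sE ae be ab FE.
have [aE _ _] := and3P ae; have [bE _ _] := and3P be.
have a12 := conn_edge aE; have b12 := conn_edge bE.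
have ab2 : ~~ conn E a2 b2.
  apply: contra ab => h; apply: conn_trans a12 _; apply: conn_trans h _.
  by rewrite conn_sym.
have a1b1 : a1 != b1 by apply: contra ab => /eqP ->; exact: conn_refl.
have a2b2 : a2 != b2 by apply: contra ab2 => /eqP ->; exact: conn_refl.
have n1E : [set a1; b1] \notin E by apply: contra ab; exact: conn_edge.
have n2E : [set a2; b2] \notin E by apply: contra ab2; exact: conn_edge.
have e_ne : [set a1; a2] != [set b1; b2].
  apply: contra ab => /eqP/set2_eq[] [-> _]; first exact: conn_refl.
  by rewrite conn_sym.
have [c1 k1] := switch_partner sE ae be ab.
have ae' : small E [set a2; a1] by rewrite setUC.
have be' : small E [set b2; b1] by rewrite setUC.
have [c2 k2] := switch_partner sE ae' be' ab2.
rewrite -FE in c1 k1; rewrite -switchC -FE in c2 k2.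
have back : E = [set a1; a2] |: ([set b1; b2] |: (F :\ [set a1; b1] :\ [set a2; b2])).
  apply/setP => e; rewrite FE !inE.
  have [->//|ea] := eqVneq e [set a1; a2]; have [->//|eb] := eqVneq e [set b1; b2] => /=.
  have [->|en1] := eqVneq e [set a1; b1]; first by rewrite (negbTE n1E) andbF.
  by have [->|en2] := eqVneq e [set a2; b2]; first by rewrite (negbTE n2E).
have fE : [set b1; b2] = ([set a1; b1] :\ a1) :|: ([set a2; b2] :\ a2).
  by rewrite !setU1K // !inE.
have inT : ([set a1; b1] \in T) || ([set a2; b2] \in T).
  apply: contraR ab; rewrite negb_or => /andP[t1 t2].
  have h : conn T a1 b1 by apply: cT; apply: conn_edge; rewrite FE !inE eqxx.
  apply: conn_subset h; apply/subsetP => e eT.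
  have : e \in F by exact: (subsetP TF).
  rewrite FE !inE => /or3P[/eqP E1|/eqP E1|/and3P[]//].
    by rewrite -E1 eT in t1.
  by rewrite -E1 eT in t2.
apply/imsetP; case/orP: inT => nT.
  exists ([set a1; b1], ([set a2; b2], (a1, a2))).
    by rewrite inE /P /Q /= nT k1 c1 !inE !eqxx.
  by rewrite /dec /= -fE -back.
exists ([set a2; b2], ([set a1; b1], (a2, a1))).
  by rewrite inE /P /Q /= nT k2 c2 !inE !eqxx.
have swap : F :\ [set a2; b2] :\ [set a1; b1] = F :\ [set a1; b1] :\ [set a2; b2].
  by rewrite !setDDl setUC.
by rewrite /dec /= swap [[set a2; a1]]setUC [_ :|: ([set a1; b1] :\ a1)]setUC -fE -back.
Qed.

End Switching.

Section Ratio.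
Local Open Scope nat_scope.
Variable V : finType.
Implicit Types (E F T : {set {set V}}) (e f g h : {set V}) (u v a b p q w : V).
Variable C : {set {set V}} -> Prop.
Hypothesis C_simple : forall E, C E -> simple E.
Hypothesis C_join : forall E u v, C E -> u != v -> deg E u = 0 -> deg E v = 0 -> C (join_isolated E u v).
Hypothesis C_subdivide : forall E a b v, C E -> [set a; b] \in E -> deg E v <= 1 ->
  ~~ conn E a v -> C (subdivide E a b v).
Hypothesis C_reroute : forall E a b u v w, C E -> [set a; b] \in E -> ~~ conn E a v ->
  nbrs E v = [set u; w] -> u != w -> deg E w = 2 -> [set u; w] \notin E ->
  C (reroute E a b u v w).
Hypothesis C_switch : forall E a1 a2 b1 b2, C E -> [set a1; a2] \in E -> [set b1; b2] \in E ->
  ~~ conn E a1 b1 -> C (switch E a1 a2 b1 b2) \/ C (switch E a1 a2 b2 b1).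

Definition layer k := [set E | `[< C E >] && (#|components E| == k)].

Lemma layerP k E : (E \in layer k) <-> C E /\ #|components E| = k.
Proof. by rewrite inE; split=> [/andP[/asboolP ? /eqP]|[? /eqP ->]] //; rewrite andbT; apply/asboolP. Qed.

Definition coded (I : finType) (code : {set {set V}} -> {set I}) k :=
  [set x : {set {set V}} * I | (x.1 \in layer k) && (x.2 \in code x.1)].

Lemma card_coded (I : finType) (code : {set {set V}} -> {set I}) k :
  #|coded code k| = \sum_(E in layer k) #|code E|.
Proof.
rewrite (card_dep (fun E => E \in layer k) (fun E i => i \in code E)).
by apply: eq_bigr => E _; apply: eq_card => i; rewrite inE.
Qed.

Lemma codedP (I : finType) (code : {set {set V}} -> {set I}) k E (i : I) :
  (E, i) \in coded code k -> [/\ C E, #|components E| = k & i \in code E].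
Proof. by rewrite inE => /andP[/layerP[]]. Qed.

Lemma coded0_le k : #|coded (@codes0 V) k.+1| <= #|layer k| * #|V|.
Proof.
pose R (x : {set {set V}} * (V * V)) F :=
  [/\ F = join_isolated x.1 x.2.1 x.2.2, x.2.1 != x.2.2 & ~~ conn x.1 x.2.1 x.2.2].
apply: (@double_count _ _ _ _ R) => [[E [u v]]|F _].
  move=> /codedP[CE cE]; rewrite inE /= => /and3P[/eqP du /eqP dv uv].
  have nc : ~~ conn E u v.
    by apply: contra uv => /(conn_isolated (C_simple CE) du) ->.
  exists (join_isolated E u v); last by [].
  by apply/layerP; split; [exact: C_join|have := merge_edge nc; rewrite cE => -[]].
have [D Dn HD] := reverse_join F.
exists D => // -[E [u v]] /codedP[CE _]; rewrite inE /= => /and3P[/eqP du /eqP dv uv] [/= FE _ nc].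
apply: HD => //; first exact: C_simple.
by apply: contra nc; exact: conn_edge.
Qed.

Lemma coded1_le k : #|coded (@codes1 V) k.+1| <= #|layer k| * (80 * #|V|).
Proof.
pose R1 (x : {set {set V}} * ({set V} * V)) F := exists a b,
  [/\ x.2.1 = [set a; b], ~~ conn x.1 a x.2.2, deg x.1 x.2.2 <= 1 & F = subdivide x.1 a b x.2.2].
pose R2 (x : {set {set V}} * ({set V} * V)) F := exists a b u w,
  [/\ x.2.1 = [set a; b], ~~ conn x.1 a x.2.2, nbrs x.1 x.2.2 = [set u; w],
     [/\ u != w, deg x.1 w = 2 & [set u; w] \notin x.1] & F = reroute x.1 a b u x.2.2 w].
apply: (@double_count _ _ _ _ (fun x F => R1 x F \/ R2 x F)) => [[E [e v]]|F _].
  move=> /codedP[CE cE]; rewrite inE /= => /and3P[eE lv /apartP ev].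
  have sE := C_simple CE.
  have [a [b [_ eab]]] := simple_pair sE eE.
  rewrite eab in eE; have av : ~~ conn E a v by apply: ev; rewrite ?eab ?set21 ?set11.
  case/orP: lv => [dv|/and3P[dv /forall_inP dN /forall_inP nadj]].
    exists (subdivide E a b v); last by left; exists a, b.
    apply/layerP; split; first exact: C_subdivide.
    by have := merge_subdivide eE av; rewrite cE => -[].
  move: dv; rewrite deg_nbrs// => /cards2P[u [w [uw Nv]]].
  have uN : u \in nbrs E v by rewrite Nv set21.
  have wN : w \in nbrs E v by rewrite Nv set22.
  have dw : deg E w = 2 by apply/eqP/dN.
  have uwE : [set u; w] \notin E by exact: (forall_inP (nadj u uN) w wN).
  exists (reroute E a b u v w); last by right; exists a, b, u, w.
  apply/layerP; split; first exact: C_reroute.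
  have uvE : [set u; v] \in E by rewrite setUC -nbrsP.
  have vwE : [set v; w] \in E by rewrite -nbrsP.
  by have := merge_path eE av uvE vwE uw; rewrite cE => -[].
have [D1 D1n H1] := reverse_subdivide F; have [D2 D2n H2] := reverse_reroute F.
exists (D1 :|: D2).
  by apply: leq_trans (leq_card_setU _ _).1 _; have := leq_add D1n D2n; rewrite -mulnDl.
move=> [E [e v]] /codedP[CE _]; rewrite inE /= => /and3P[eE _ _] R; rewrite in_setU; apply/orP.
have sE := C_simple CE.
case: R => [[a [b [/= eab av dv FE]]]|[a [b [u [w [/= eab av Nv [uw dw uwE] FE]]]]]]; subst e.
  by left; apply: H1.
by right; apply: (H2 _ _ _ u v w).
Qed.

Lemma coded2_le k : #|coded (@codes2 V) k.+1| <= #|layer k| * (444 * #|V|).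
Proof.
pose R (x : {set {set V}} * ({set V} * {set V})) F := exists a1 a2 b1 b2,
  [/\ x.2.1 = [set a1; a2], x.2.2 = [set b1; b2] & F = switch x.1 a1 a2 b1 b2].
apply: (@double_count _ _ _ _ R) => [[E [e f]]|F /layerP[CF _]].
  move=> /codedP[CE cE]; rewrite inE /= => /and3P[se sf /apartP ef].
  have sE := C_simple CE.
  have [eE _ _] := and3P se; have [fE _ _] := and3P sf.
  have [a1 [a2 [_ ea]]] := simple_pair sE eE.
  have [b1 [b2 [_ fb]]] := simple_pair sE fE.
  subst e f.
  have ab : ~~ conn E a1 b1 by apply: ef; rewrite set21.
  have ab' : ~~ conn E a1 b2 by apply: ef; rewrite ?set21 ?set22.
  have [_ an _] := and3P se; have [_ bn _] := and3P sf.
  rewrite /nonbridge !linked2 in an bn.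
  have [CS|CS] := C_switch CE eE fE ab.
    exists (switch E a1 a2 b1 b2); last by exists a1, a2, b1, b2.
    by apply/layerP; split=> //; have := merge_switch sE eE fE ab an bn; rewrite cE => -[].
  exists (switch E a1 a2 b2 b1); last by exists a1, a2, b2, b1; rewrite [[set b2; b1]]setUC.
  apply/layerP; split=> //; rewrite conn_sym [[set b1; b2]]setUC in bn.
  rewrite [[set b1; b2]]setUC in fE.
  by have := merge_switch sE eE fE ab' an bn; rewrite cE => -[].
have [D Dn HD] := reverse_switch (C_simple CF).
exists D => // -[E [e f]] /codedP[CE _]; rewrite inE /= => /and3P[se sf /apartP ef].
move=> [a1 [a2 [b1 [b2 [/= ea fb FE]]]]]; subst e f; apply: HD => //.
  exact: C_simple.
by apply: ef; rewrite set21.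
Qed.

(* 3136 = 56 ^ 2 comes from many_codes, and 605 = 1 + 2 * 80 + 444. *)
Lemma layer_ratio k : k * #|layer k.+1| <= 3136 * 605 * #|layer k|.
Proof.
have [V0|V0] := posnP #|V|.
  suff -> : layer k.+1 = set0 by rewrite cards0 muln0.
  apply/setP => E; rewrite [RHS]inE; apply/negP => /layerP[_ cE].
  have : 0 < #|components E| by rewrite cE.
  move=> /card_gt0P[A /componentP[x _]].
  by have := max_card (pred1 x); rewrite V0 card1.
rewrite -(leq_pmul2l V0).
have h : #|V| * (k * #|layer k.+1|) <=
    3136 * (#|coded (@codes0 V) k.+1| + 2 * #|coded (@codes1 V) k.+1| + #|coded (@codes2 V) k.+1|).
  rewrite !card_coded mulnA mulnC -sum_nat_const.
  rewrite [2 * _]big_distrr -!big_split /= big_distrr /=; apply: leq_sum => E /layerP[CE cE].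
  by have := many_codes (C_simple CE); rewrite cE.
apply: leq_trans h _.
have := coded0_le k; have := coded1_le k; have := coded2_le k.
move: #|layer k| #|V| #|coded _ _| #|coded _ _| #|coded _ _| => x n c0 c1 c2 h2 h1 h0.
have e0 : x * n = n * x by rewrite mulnC.
have e1 : x * (80 * n) = 80 * (n * x) by rewrite mulnC -mulnA.
have e2 : x * (444 * n) = 444 * (n * x) by rewrite mulnC -mulnA.
rewrite e0 in h0; rewrite e1 in h1; rewrite e2 in h2.
rewrite [n * (_ * _)](_ : _ = 3136 * 605 * (n * x)); last by rewrite mulnCA.
move: (n * x) h0 h1 h2 => N h0 h1 h2.
apply: (@leq_trans (3136 * (N + 2 * (80 * N) + 444 * N))).
  by rewrite leq_mul2l !leq_add ?leq_mul2l.
by rewrite -mulnA leq_mul2l; apply/orP; right; lia.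
Qed.

End Ratio.

(** * Planar graphs with bounded degrees *)

Section Instance.
Local Open Scope nat_scope.
Variables (R : realType) (V : finType) (d D : nat).
Hypothesis D3 : 3 <= D.
Implicit Types (E F T : {set {set V}}) (e f g h : {set V}) (u v a b p q w x : V).

Definition bounded_plane E :=
  [/\ plane R E, simple E & forall v, d <= deg E v <= D].

Lemma degU1 E e x : e \notin E -> deg (e |: E) x = (x \in e) + deg E x.
Proof.
move=> eE; rewrite /deg; have [xe|xe] := boolP (x \in e).
  rewrite (_ : [set f in e |: E | x \in f] = e |: [set f in E | x \in f]).
    by rewrite cardsU1 inE (negbTE eE).
  by apply/setP => f; rewrite !inE; case: eqP => [->|]; rewrite ?xe.
rewrite add0n; apply: eq_card => f; rewrite !inE; case: eqP => [->|] //=.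
by rewrite (negbTE xe) andbF.
Qed.

Lemma degD1 E e x : e \in E -> deg E x = (x \in e) + deg (E :\ e) x.
Proof. by move=> eE; rewrite -degU1 ?setD1K// !inE eqxx. Qed.

Lemma simpleU1 E a b : a != b -> simple E -> simple ([set a; b] |: E).
Proof.
move=> ab /simpleP sE; apply/simpleP => e; rewrite in_setU1 => /orP[/eqP ->|/sE //].
by rewrite cards2 ab.
Qed.

Lemma simpleD1 E e : simple E -> simple (E :\ e).
Proof. exact: simple_sub (subD1set _ _). Qed.

Lemma in_pair a b x : a != b -> (x \in [set a; b]) = (x == a) + (x == b) :> nat.
Proof. by rewrite !inE => ab; case: eqP => [->|//]; rewrite (negbTE ab). Qed.

Lemma deg0_notin E v e : deg E v = 0 -> e \in E -> v \notin e.
Proof.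
move=> dv eE; apply/negP => ve; suff : 0 < deg E v by rewrite dv.
by rewrite card_gt0; apply/set0Pn; exists e; rewrite inE eE.
Qed.

Lemma nbrs_edge E v e : simple E -> e \in E -> v \in e -> exists2 u, u \in nbrs E v & e = [set u; v].
Proof.
move=> sE eE; have [p [q [_ epq]]] := simple_pair sE eE.
rewrite epq !inE => /orP[]/eqP ->.
  by exists q; rewrite ?nbrsP -?epq// epq setUC.
by exists p; rewrite ?nbrsP ?[[set q; p]]setUC -?epq.
Qed.

Lemma component_cut E v e : simple E -> e \in E ->
  e \subset component E v \/ e \subset ~: component E v.
Proof.
move=> sE eE; have [p [q [_ epq]]] := simple_pair sE eE.
have pqE : [set p; q] \in E by rewrite -epq.
have qpE : [set q; p] \in E by rewrite setUC.
rewrite epq !pair_subset !in_setC.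
have [pv|pv] := boolP (p \in component E v); first by left; rewrite (component_closed pqE).
by right; rewrite /=; apply: contra pv; exact: component_closed qpE.
Qed.

Lemma bounded_plane_join E u v : bounded_plane E -> u != v -> deg E u = 0 -> deg E v = 0 ->
  bounded_plane (join_isolated E u v).
Proof.
move=> [pE sE bE] uv du dv; split.
- apply: plane_join_isolated => // e eE.
  by rewrite (deg0_notin du eE) (deg0_notin dv eE).
- exact: simpleU1.
move=> x; rewrite degU1 ?in_pair//; last first.
  by apply/negP => /(deg0_notin du); rewrite set21.
have := bE x; have := bE u; have := bE v; rewrite du dv.
by case: eqP => [->|_]; case: eqP => [->|_]; rewrite ?du ?dv; lia.
Qed.

Lemma bounded_plane_subdivide E a b v : bounded_plane E -> [set a; b] \in E -> deg E v <= 1 ->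
  ~~ conn E a v -> bounded_plane (subdivide E a b v).
Proof.
move=> [pE sE bE] abE dv av.
have [na va] := conn_new_edge abE av (set21 a b); have [nb vb] := conn_new_edge abE av (set22 a b).
have ab := edge_neq sE abE.
split.
- move: dv; rewrite leq_eqVlt ltnS leqn0 => /orP[/eqP d1|/eqP d0]; last first.
    by apply: plane_subdivide => // e eE; exact: deg0_notin eE.
  move/eqP: (d1); rewrite deg_nbrs// => /cards1P[w Nv].
  have wN : w \in nbrs E v by rewrite Nv set11.
  have wvE : [set w; v] \in E by rewrite setUC -nbrsP.
  apply: (@plane_move_leaf _ _ (component E v) _ _ _ _ w) => //.
  + by move=> e; exact: component_cut.
  + by rewrite inE conn_sym.
  + by rewrite inE conn_sym; apply: contra av; apply: conn_trans; exact: conn_edge.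
  + exact: component_refl.
  + by rewrite inE conn_sym; exact: conn_edge.
  + move=> e eE /(nbrs_edge sE eE)[u]; rewrite Nv inE => /eqP -> //.
- by do 2! (apply: simpleU1 => //); exact: simpleD1.
move=> x; have := bE x; have := degD1 x abE.
rewrite /subdivide !degU1.
- rewrite !in_pair//; have [->|_] := eqVneq x v; last by case: (x == a); case: (x == b); lia.
  by rewrite [v == a]eq_sym [v == b]eq_sym (negbTE va) (negbTE vb); move: dv D3; lia.
- by rewrite in_setD1 (negbTE nb) andbF.
- rewrite in_setU1 in_setD1 (negbTE na) andbF orbF.
  by apply: contra ab => /eqP/set2_eq[[->]|[_ vb']] //; rewrite vb' eqxx in vb.
Qed.

Lemma bounded_plane_reroute E a b u v w : bounded_plane E -> [set a; b] \in E -> ~~ conn E a v ->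
  nbrs E v = [set u; w] -> u != w -> deg E w = 2 -> [set u; w] \notin E ->
  bounded_plane (reroute E a b u v w).
Proof.
move=> [pE sE bE] abE av Nv uw dw uwE.
have [na va] := conn_new_edge abE av (set21 a b); have [nb vb] := conn_new_edge abE av (set22 a b).
have ab := edge_neq sE abE.
have uN : u \in nbrs E v by rewrite Nv set21.
have wN : w \in nbrs E v by rewrite Nv set22.
have uvE : [set u; v] \in E by rewrite setUC -nbrsP.
have vwE : [set v; w] \in E by rewrite -nbrsP.
have uv := edge_neq sE uvE; have vw := edge_neq sE vwE.
have dv : deg E v = 2 by rewrite deg_nbrs// Nv cards2 uw.
have vN : v \in nbrs E w by rewrite nbrs_sym.
have [x Nw xv] : exists2 x, nbrs E w = [set x; v] & x != v.
  move/eqP: dw; rewrite deg_nbrs// => /cards2P[p [q [pq Nw]]].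
  move: vN; rewrite Nw !inE => /orP[]/eqP ->; first by exists q; rewrite 1?setUC 1?eq_sym.
  by exists p.
have xwE : [set x; w] \in E by rewrite setUC -nbrsP Nw set21.
have conv p : conn E v p -> p \in component E v by rewrite inE.
have uvab : [set u; v] != [set a; b].
  by apply/eqP => /set2_eq[[_ vE]|[_ vE]]; [rewrite vE eqxx in vb|rewrite vE eqxx in va].
split.
- apply: (@plane_move_path _ _ (component E v) _ _ _ u v w x) => //.
  + by move=> e; exact: component_cut.
  + by rewrite inE conn_sym.
  + by rewrite inE conn_sym; apply: contra av; apply: conn_trans; exact: conn_edge.
  + exact: component_refl.
  + by apply: conv; exact: conn_edge.
  + by apply: conv; rewrite conn_sym; exact: conn_edge.
  + apply: conv; apply: conn_trans (conn_edge vwE) _.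
    by rewrite conn_sym; exact: conn_edge.
  + exact/eqP.
  + by move=> ux; move: uwE; rewrite ux xwE.
  + exact/eqP.
  + move=> e eE /(nbrs_edge sE eE)[p]; rewrite Nv !inE => /orP[]/eqP -> ->; first by left.
    by right; rewrite setUC.
  + by move=> e eE /(nbrs_edge sE eE)[p]; rewrite Nw !inE => /orP[]/eqP -> ->; [right|left].
- by do 3! (apply: simpleU1 => //); do 2! (apply: simpleD1).
move=> y; have := bE y; have := degD1 y abE.
have uvE' : [set u; v] \in E :\ [set a; b] by rewrite in_setD1 uvab.
rewrite (degD1 y uvE') /reroute !degU1.
- rewrite !in_pair//; have [->|yv] := eqVneq y v.
    rewrite [v == a]eq_sym [v == b]eq_sym (negbTE va) (negbTE vb) [v == u]eq_sym (negbTE uv) (negbTE vw).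
    by rewrite dv; move: (deg (_ :\ _ :\ _) _) D3; clear; lia.
  have [->|yw] := eqVneq y w; last first.
    by move: (deg (_ :\ _ :\ _) _) (deg E y); clear; case: (y == a); case: (y == b); case: (y == u); lia.
  rewrite [w == u]eq_sym (negbTE uw) dw; move: (deg (_ :\ _ :\ _) _) D3; clear.
  by case: (w == a); case: (w == b); lia.
- by rewrite !in_setD1 (negbTE uwE) !andbF.
- rewrite in_setU1 !in_setD1 (negbTE nb) !andbF orbF.
  by apply/eqP => /set2_eq[[_ vE]|[_ vE]]; [rewrite vE eqxx in vw|rewrite vE eqxx in uv].
- rewrite !in_setU1 !in_setD1 (negbTE na) !andbF orbF negb_or; apply/andP; split.
    by apply: contra ab => /eqP/set2_eq[[->]|[_ vb']] //; rewrite vb' eqxx in vb.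
  by apply/eqP => /set2_eq[[_ vE]|[_ vE]]; [rewrite vE eqxx in vw|rewrite vE eqxx in uv].
Qed.

Lemma bounded_plane_switch E a1 a2 b1 b2 : bounded_plane E ->
  [set a1; a2] \in E -> [set b1; b2] \in E -> ~~ conn E a1 b1 ->
  bounded_plane (switch E a1 a2 b1 b2) \/ bounded_plane (switch E a1 a2 b2 b1).
Proof.
move=> [pE sE bE] aE bbE ab.
have a12 := conn_edge aE; have b12 := conn_edge bbE.
have na := edge_neq sE aE; have nb := edge_neq sE bbE.
have e_ne : [set a1; a2] != [set b1; b2].
  apply: contra ab => /eqP/set2_eq[] [-> _]; first exact: conn_refl.
  by rewrite conn_sym.
have fine c1 c2 : [set c1; c2] = [set b1; b2] -> plane R (switch E a1 a2 c1 c2) ->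
    bounded_plane (switch E a1 a2 c1 c2).
  move=> cb; have nab p q : p \in [set a1; a2] -> q \in [set c1; c2] -> ~~ conn E p q.
    move=> pa; rewrite cb => qb; apply: contra ab => pq.
    have ap : conn E a1 p by move: pa; rewrite !inE => /orP[]/eqP ->; rewrite ?conn_refl.
    have qb1 : conn E q b1.
      by move: qb; rewrite !inE => /orP[]/eqP ->; rewrite ?conn_refl// conn_sym.
    exact: conn_trans ap (conn_trans pq qb1).
  have nc : c1 != c2 by have := cards2 c1 c2; rewrite cb cards2 nb; case: (c1 != c2).
  have cE : [set c1; c2] \in E by rewrite cb.
  have n1 := nab a1 c1 (set21 _ _) (set21 _ _); have n2 := nab a2 c2 (set22 _ _) (set22 _ _).
  have nE p q : ~~ conn E p q -> [set p; q] \notin E by apply: contra; exact: conn_edge.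
  have ne p q : ~~ conn E p q -> p != q by apply: contra => /eqP ->; exact: conn_refl.
  move=> pF; split=> //.
    by do 2! (apply: simpleU1; first exact: ne); do 2! (apply: simpleD1).
  move=> x; have := bE x; rewrite (degD1 x aE).
  have cE' : [set c1; c2] \in E :\ [set a1; a2] by rewrite in_setD1 cE cb eq_sym e_ne.
  rewrite (degD1 x cE') /switch !degU1.
  - have m1 := ne _ _ n1; have m2 := ne _ _ n2.
    rewrite !in_pair//; move: (deg (_ :\ _ :\ _) _) (nat_of_bool (x == a1)).
    move: (nat_of_bool (x == a2)) (nat_of_bool (x == c1)) (nat_of_bool (x == c2)).
    clear; lia.
  - by rewrite !in_setD1 (negbTE (nE _ _ n2)) !andbF.
  - rewrite in_setU1 !in_setD1 (negbTE (nE _ _ n1)) !andbF orbF.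
    apply: contra na => /eqP/set2_eq[[->]|[ac _]] //.
    by move: (nab a1 c2 (set21 _ _) (set22 _ _)); rewrite ac conn_refl.
have b1W : b1 \in component E b1 by exact: component_refl.
have b2W : b2 \in component E b1 by rewrite inE.
have a1W : a1 \notin component E b1 by rewrite inE conn_sym.
have a2W : a2 \notin component E b1.
  by rewrite inE conn_sym; apply: contra ab; exact: conn_trans.
have cut e (eE : e \in E) := component_cut b1 sE eE.
have [p|p] := plane_switch pE cut aE a1W a2W bbE b1W b2W; first by left; apply: fine.
right; apply: fine; first by rewrite setUC.
by rewrite /switch [[set b2; b1]]setUC.
Qed.

End Instance.

Section Counting.
Variables (R : realType) (r d D : nat).
Hypothesis D3 : (3 <= D)%N.

Definition ratio_bound : nat := (3136 * 605)%N.

Definition planar_layer k : {set labelled_graph r} :=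
  [set G in planar_graphs R r d D | #|components (edges G)| == k]%SET.

Lemma edges_simple (G : labelled_graph r) : simple (edges G).
Proof. exact: valP. Qed.

Lemma card_planar_layer k : #|planar_layer k| = #|layer (fun E : {set {set 'I_r}} => bounded_plane R d D E) k|.
Proof.
rewrite -(card_imset _ val_inj); apply: eq_card => E; apply/imsetP/idP.
  move=> [G GL ->]; apply/layerP; move: GL.
  rewrite !inE => /andP[/andP[/asboolP pG /forallP bG] /eqP cG]; split=> //; split; [exact: planar_plane|exact: edges_simple|exact: bG].
move=> /layerP[[pE sE bE] cE]; exists (Sub E sE : labelled_graph r) => //.
have eG : edges (Sub E sE : labelled_graph r) = E by [].
rewrite !inE eG cE eqxx andbT; apply/andP; split.
  by apply/asboolP; apply: plane_planar; rewrite eG.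
by apply/forallP => v; exact: bE.
Qed.

Lemma planar_layer_ratio k :
  (k * #|planar_layer k.+1| <= ratio_bound * #|planar_layer k|)%N.
Proof.
rewrite !card_planar_layer; apply: layer_ratio.
- by move=> E [].
- by move=> E u v; exact: bounded_plane_join.
- by move=> E a b v; exact: bounded_plane_subdivide.
- by move=> E a b u v w; exact: bounded_plane_reroute.
- by move=> E a1 a2 b1 b2; exact: bounded_plane_switch.
Qed.

Lemma planar_layer_le k :
  (#|planar_layer k.+1|%:R : R) <= ratio_bound%:R ^+ k / k`!%:R * #|planar_layer 1|%:R.
Proof.
elim: k => [|k IH]; first by rewrite expr0 fact0 divr1 mul1r.
have k0 : 0 < (k.+1%:R : R) by rewrite ltr0n.
rewrite -(ler_pM2l k0) -natrM.
apply: (@le_trans _ _ (ratio_bound * #|planar_layer k.+1|)%:R).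
  by rewrite ler_nat; exact: planar_layer_ratio.
rewrite natrM; apply: (@le_trans _ _ (ratio_bound%:R *
  (ratio_bound%:R ^+ k / k`!%:R * #|planar_layer 1|%:R))).
  by rewrite ler_wpM2l.
rewrite exprS factS natrM le_eqVlt; apply/orP; left; apply/eqP.
by field; rewrite nat1r !pnatr_eq0 -lt0n fact_gt0.
Qed.

Lemma connected_layer (G : labelled_graph r) : (#|components (edges G)| <= 1)%N -> connected_graph G.
Proof.
move=> c1; apply/forallP => u; apply/forallP => v.
have uC : component (edges G) u \in components (edges G) by apply/componentP; exists u.
have vC : component (edges G) v \in components (edges G) by apply/componentP; exists v.
have uv := card_le1_eqP c1 _ _ uC vC.
by have := component_refl (edges G) v; rewrite uv inE.
Qed.

Lemma card_planar_graphs :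
  (#|planar_graphs R r d D| = \sum_(0 <= k < r.+1) #|planar_layer k|)%N.
Proof.
rewrite big_mkord -sum1_card.
have bnd (G : labelled_graph r) : (#|components (edges G)| < r.+1)%N.
  rewrite ltnS -[X in (_ <= X)%N]card_ord; exact: leq_trans (leq_imset_card _ _) (max_card _).
rewrite (partition_big (fun G : labelled_graph r => Ordinal (bnd G)) xpredT) //=.
apply: eq_bigr => k _; rewrite -sum1_card; apply: eq_bigl => G.
by rewrite [RHS]inE; congr (_ && _).
Qed.

Lemma card_planar_graphs_le :
  #|planar_graphs R r d D|%:R <=
    expR ratio_bound%:R * #|[set G in planar_graphs R r d D | connected_graph G]%SET|%:R :> R.
Proof.
set conn := #|[set G in planar_graphs R r d D | connected_graph G]%SET|.
have lay k : (k <= 1)%N -> (#|planar_layer k| <= conn)%N.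
  move=> k1; apply/subset_leq_card/subsetP => G; rewrite !inE => /andP[-> /eqP ck] /=.
  by apply: connected_layer; rewrite ck.
have [r0|r_gt0] := posnP r.
  rewrite card_planar_graphs (_ : index_iota 0 r.+1 = index_iota 0 1) ?r0// big_nat1.
  apply: (@le_trans _ _ conn%:R); first by rewrite ler_nat lay.
  by rewrite ler_peMl// (le_trans _ (expR_ge1Dx _))// lerDl.
have e0 : #|planar_layer 0| = 0%N.
  apply/eqP; rewrite cards_eq0; apply/eqP/setP => G; rewrite !inE; apply/negP => /andP[_].
  rewrite cards_eq0 => /eqP/setP/(_ (component (edges G) (Ordinal r_gt0))).
  by rewrite inE => /componentP; apply; exists (Ordinal r_gt0).
rewrite card_planar_graphs big_nat_recl// e0 add0n natr_sum.
apply: (@le_trans _ _ (\sum_(0 <= k < r) exp_coeff (ratio_bound%:R : R) k * #|planar_layer 1|%:R)).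
  by apply: ler_sum => k _; exact: planar_layer_le.
rewrite -big_distrl /=; apply: (@le_trans _ _ (expR ratio_bound%:R * #|planar_layer 1|%:R)).
  apply: ler_wpM2r => //; apply: (@nondecreasing_cvgn_le _ (series (exp_coeff ratio_bound%:R))).
    by apply: nondecreasing_series => n _ _; exact: exp_coeff_ge0.
  exact: is_cvg_series_exp_coeff.
by rewrite ler_wpM2l ?expR_ge0// ler_nat lay.
Qed.

End Counting.

Theorem theorem1 (R : realType) :
  exists c : R, 0 < c /\
    forall r d D : nat, (3 <= D)%N ->
      planar_graphs R r d D <> finset.set0 ->
      c < uniformly_random_prob R (planar_graphs R r d D) (@connected_graph r).
Proof.
exists (2 * expR (ratio_bound%:R))^-1; split; first by rewrite invr_gt0 mulr_gt0 ?expR_gt0.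
move=> r d D D3 /eqP ne0; rewrite /uniformly_random_prob.
have S0 : 0 < (#|planar_graphs R r d D|%:R : R) by rewrite ltr0n card_gt0.
have le := card_planar_graphs_le R r d D3.
have K0 : 0 < expR ratio_bound%:R :> R := expR_gt0 _.
set conn : R := (X in _ <= _ * X) in le; have c0 : 0 < conn.
  by rewrite -(pmulr_rgt0 _ K0); exact: lt_le_trans le.
rewrite ltr_pdivlMr// mulrC ltr_pdivrMr ?mulr_gt0//.
apply: (le_lt_trans le); rewrite [ltRHS]mulrC -mulrA -[ltLHS]mul1r.
by rewrite ltr_pM2r ?mulr_gt0//; lra.
Qed.
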